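(* Let $a,b,c\in\mathbb C$ with $\operatorname{Re}(a)<0$, and let $g:\mathbb R\to\mathbb C$ be the extended Gaussian $g(x)=e^{ax^2+bx+c}$. Then $g$ has maximal frame set, and its Zak transform $Zg$ has a unique zero in the unit square $[0,1)^2$, and this zero is simple. In particular, if $b=0$, then the zero is at $(1/2,1/2)$.
   Context: For $t,\xi\in\mathbb R$, let $T_t f(x)=f(x-t)$ and $M_\xi f(x)=e^{2\pi i\xi x}f(x)$ be the translation and modulation operators on $L^2(\mathbb R)$. For $g\in L^2(\mathbb R)$ and $\alpha,\beta>0$, the Gabor system with window $g$ and lattice $\alpha\mathbb Z\times\beta\mathbb Z$ is $\mathcal G(g,\alpha\mathbb Z\times\beta\mathbb Z)=\{M_{\beta j}T_{\alpha k}g: j,k\in\mathbb Z\}$. It is a frame of $L^2(\mathbb R)$ if there exist constants $A,B>0$ such that $$A\|f\|_{L^2(\mathbb R)}^2\le\sum_{j,k\in\mathbb Z}|\langle f,M_{\beta j}T_{\alpha k}g\rangle|^2\le B\|f\|_{L^2(\mathbb R)}^2\quad\text{for all } f\in L^2(\mathbb R).$$ The frame set $F(g)$ is the set of all pairs $(\alpha,\beta)$ with $\alpha,\beta>0$ such that $\mathcal G(g,\alpha\mathbb Z\times\beta\mathbb Z)$ is a frame of $L^2(\mathbb R)$. The function $g$ is said to have maximal frame set if $F(g)$ contains all pairs $(\alpha,\beta)$ with $\alpha,\beta>0$ and $\alpha\beta<1$. The Zak transform of $f$ is the function on $\mathbb R^2$ given by $Zf(t,\omega)=\sum_{k\in\mathbb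 Z}f(t-k)e^{2\pi i k\omega}$ (for extended Gaussians the series converges absolutely at every point and $Zf$ is continuous on $\mathbb R^2$). A point $(t_0,\omega_0)$ is a simple zero of $Zf$ if $Zf(t_0,\omega_0)=0$ and there are a neighbourhood $\Omega\subset\mathbb R^2$ of $(t_0,\omega_0)$ and constants $A,B$ such that $Zf$ is continuous on $\Omega$ and $$0<A\le\frac{|Zf(t,\omega)|}{\sqrt{(t-t_0)^2+(\omega-\omega_0)^2}}\le B<\infty$$ for all $(t,\omega)\in\Omega\setminus\{(t_0,\omega_0)\}$. *)

(* Defs.v *)
(* MathComp-Analysis; the field C of complex numbers is R[i], R : realType. *)
From HB Require Import structures.
From mathcomp Require Import all_boot all_order all_algebra.
From mathcomp Require Import complex.
From mathcomp Require Import all_classical all_reals all_analysis.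
Set Implicit Arguments.
Unset Strict Implicit.
Unset Printing Implicit Defensive.
Import Order.TTheory GRing.Theory Num.Theory.
Import numFieldNormedType.Exports.
Local Open Scope classical_set_scope.
Local Open Scope ring_scope.
Local Open Scope complex_scope.

Section Defs.
Context {R : realType}.
Local Notation C := R[i].
Local Notation mu := (@lebesgue_measure R).

(* The modulus as an element of R: `|z| is an element of C. *)
Local Notation cabs := ComplexField.Normc.normc.

Definition cexp (z : C) : C := (expR (complex.Re z))%:C * (cos (complex.Im z) +i* sin (complex.Im z)).

(* e^{2 pi i x} *)
Definition expi (x : R) : C := cexp (0 +i* (2 * pi * x)).

Definition translation (t : R) (f : R -> C) : R -> C := fun x => f (x - t).

Definition modulation (xi : R) (f : R -> C) : R -> C :=
  fun x => expi (xi * x) * f x.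

Definition sqL2norm (f : R -> C) : \bar R :=
  (\int[mu]_x (cabs (f x) ^+ 2)%:E)%E.

(* Functions, not classes modulo a.e. equality; every class has a Borel
   measurable representative, and norms and inner products are invariant under
   a.e. modification. *)
Definition L2 (f : R -> C) : Prop :=
  [/\ measurable_fun [set: R] (fun x => complex.Re (f x)),
      measurable_fun [set: R] (fun x => complex.Im (f x)) &
      (sqL2norm f < +oo)%E].

Definition inner (f h : R -> C) : C :=
  (\int[mu]_x complex.Re (f x * (h x)^*)) +i* (\int[mu]_x complex.Im (f x * (h x)^*)).

Definition gabor_atom (g : R -> C) (alpha beta : R) (jk : int * int) : R -> C :=
  modulation (beta * jk.1%:~R) (translation (alpha * jk.2%:~R) g).

Definition is_gabor_frame (g : R -> C) (alpha beta : R) : Prop :=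
  exists A B : R, [/\ 0 < A, 0 < B &
    forall f : R -> C, L2 f ->
      let S := (\esum_(jk in [set: int * int])
                 (cabs (inner f (gabor_atom g alpha beta jk)) ^+ 2)%:E)%E in
      (A%:E * sqL2norm f <= S)%E /\ (S <= B%:E * sqL2norm f)%E].

Definition frame_set (g : R -> C) : set (R * R) :=
  [set p | [/\ 0 < p.1, 0 < p.2 & is_gabor_frame g p.1 p.2]].

Definition maximal_frame_set (g : R -> C) : Prop :=
  [set p : R * R | [/\ 0 < p.1, 0 < p.2 & p.1 * p.2 < 1]] `<=` frame_set g.

(* C with the topology of its modulus *)
Local Notation Ct := (C^o).

(* Sum over Z of an absolutely convergent series: the sum of the terms of
   index 0, 1, 2, ... plus that of the terms of index -1, -2, ... (Negz n is
   the integer - n - 1). *)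
Definition zsum (u : int -> C) : C :=
  (limn (series (fun n => u (Posz n) : Ct)) : C)
  + (limn (series (fun n => u (Negz n) : Ct)) : C).

Definition zak (f : R -> C) (p : R * R) : C :=
  zsum (fun k => f (p.1 - k%:~R) * expi (k%:~R * p.2)).

Definition simple_zero (F : R * R -> C) (p : R * R) : Prop :=
  F p = 0 /\
  exists (Omega : set (R * R)) (A B : R),
    [/\ nbhs p Omega, {within Omega, continuous (F : R * R -> Ct)}, 0 < A &
      forall q, Omega q -> q != p ->
        A <= cabs (F q) / Num.sqrt ((q.1 - p.1) ^+ 2 + (q.2 - p.2) ^+ 2) <= B].

Definition extended_gaussian (a b c : C) : R -> C :=
  fun x => cexp (a * x%:C ^+ 2 + b * x%:C + c).

Definition unit_square : set (R * R) :=
  [set p | 0 <= p.1 < 1 /\ 0 <= p.2 < 1].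

End Defs.

(* Main.v *)
Require Import Defs.
From mathcomp Require Import all_boot all_order all_algebra.
From mathcomp Require Import complex.
From mathcomp Require Import all_classical all_reals all_analysis.
From mathcomp Require Import measurable_realfun.
From mathcomp Require Import ring lra zify.
Set Implicit Arguments.
Unset Strict Implicit.
Unset Printing Implicit Defensive.
Import Order.TTheory GRing.Theory Num.Theory.
Import numFieldNormedType.Exports.
Local Open Scope classical_set_scope.
Local Open Scope ring_scope.
Local Open Scope complex_scope.

(** The two halves of the theorem rest on one feature of the Gaussian: its
    samples on an arithmetic progression have ratios that are geometric
    sequences, so that sums of translates are values of explicit products.

    Zak transform.  Expanding the square,
    g(t - k) e^{2 pi i k w} = g(t) e^{a k^2 + zeta k} with zeta affine in (t, w),
    hence Zg(t, w) = g(t) theta(zeta) with theta(zeta) the sum over k in Z of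
    e^{a k^2 + zeta k} ([zak_theta]).  With p = e^{2a} and x = e^{zeta + a},
    the Jacobi triple product writes theta, up to a nonzero constant, as the
    product over j >= 0 of (1 + x p^j) (1 + p^(j+1) / x).  In the strip
    |Re (zeta + a)| <= - Re a every factor but 1 + x is close to 1, with
    geometrically small errors, so |theta| is comparable with |1 + x|
    ([theta_bounds]).  The strip is a band of width 1 in t, and the
    quasi-periodicity of Zg carries the estimate to the whole plane.  Therefore
    the zeros form one translate of Z^2, given by 1 + x = 0, and since
    |1 - e^w| is comparable with |w| near 0 they are simple.  The triple product
    is only used for finitely many factors, where it is the q-binomial theorem,
    together with an exponentially small error.

    Frame property.  Put lam = 1 / beta, so that alpha < lam.  For a Lipschitz f
    of compact support, the inner products of f with the M_{beta j} T_{alpha k} g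
    are, for fixed k, the Fourier coefficients of the lam-periodic function
    x |-> sum_l f(x + lam l) conj(g(x + lam l - alpha k)), so by Parseval's
    identity the frame inequalities for f follow from inequalities between
    sum_l |d_l|^2 and sum_k |sum_l d_l g(x + lam l - alpha k)|^2, uniform in x.
    The upper one is Schur's test, the Gaussian being rapidly decreasing
    ([sampling_upper]).  For the lower one ([sampling_lower]) each d_m must be
    recovered from the samples by weights that decay away from the sample
    nearest to x + lam m.  The quotient g(u - alpha i + lam s) / g(u - alpha i)
    is a constant times q^(s i), with q = e^{- 2 a alpha lam}; so the weights
    v_i / g(u - alpha i) annihilate every shift s with 0 < |s| <= n as soon as
    the polynomial with coefficients v_i vanishes at the q^s.  The product of
    the (1 - p^j X) (X - p^j), 1 <= j <= n, with p = 1 / q, does so; its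
    coefficient at distance k from the middle has size about
    e^{(Re a) alpha lam k^2}, whereas 1 / |g| at the k-th sample is about
    e^{- (Re a) alpha^2 k^2}.  Their product decreases precisely because
    alpha < lam, which is where alpha beta < 1 enters.

    Finally Lipschitz functions of compact support are dense among the
    square-integrable ones ([test_function_dense]), and both frame inequalities
    survive the passage to the limit with worse constants
    ([frame_upper_extend], [frame_lower_extend]). *)

Local Notation Re := complex.Re.
Local Notation Im := complex.Im.
Local Notation gauss := extended_gaussian.
Local Notation cabs := ComplexField.Normc.normc.

#[global] Arguments cexp : simpl never.
#[global] Arguments expi : simpl never.
#[global] Arguments ComplexField.Normc.normc : simpl never.

(** * Modulus and exponential of complex numbers *)

Section ComplexModulus.
Variable R : realType.
Local Notation C := R[i].
Implicit Types z w : C.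

Lemma cabsE z : cabs z = Num.sqrt (Re z ^+ 2 + Im z ^+ 2).
Proof. by case: z. Qed.

Lemma le_of_eq (x y : R) : x = y -> x <= y. Proof. by move=> ->. Qed.

Lemma sqr_cabs z : cabs z ^+ 2 = Re z ^+ 2 + Im z ^+ 2.
Proof. by rewrite cabsE sqr_sqrtr // addr_ge0 // sqr_ge0. Qed.

Lemma cabs_ge0 z : 0 <= cabs z.
Proof. by rewrite cabsE sqrtr_ge0. Qed.

Lemma cabs0 : cabs (0 : C) = 0. Proof. exact: ComplexField.Normc.normc0. Qed.
Lemma cabs1 : cabs (1 : C) = 1. Proof. exact: ComplexField.Normc.normc1. Qed.

Lemma cabs_eq0 z : (cabs z == 0) = (z == 0).
Proof. by apply/eqP/eqP => [/ComplexField.Normc.eq0_normc //|->]; rewrite cabs0. Qed.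

Lemma cabs_gt0 z : (0 < cabs z) = (z != 0).
Proof. by rewrite lt_neqAle cabs_ge0 andbT eq_sym cabs_eq0. Qed.

Lemma cabsM z w : cabs (z * w) = cabs z * cabs w.
Proof. exact: ComplexField.Normc.normcM. Qed.

Lemma cabsV z : cabs z^-1 = (cabs z)^-1.
Proof. exact: ComplexField.Normc.normcV. Qed.

Lemma cabsD z w : cabs (z + w) <= cabs z + cabs w.
Proof. exact: le_normcD. Qed.

Lemma cabsN z : cabs (- z) = cabs z.
Proof. exact: normcN. Qed.

Lemma cabsB z w : cabs (z - w) = cabs (w - z).
Proof. by rewrite -cabsN opprB. Qed.

Lemma cabsX z n : cabs (z ^+ n) = cabs z ^+ n.
Proof. by elim: n => [|n IH]; rewrite ?expr0 ?cabs1 // !exprS cabsM IH. Qed.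

Lemma cabs_real (x : R) : cabs x%:C = `|x|.
Proof. by rewrite cabsE /= expr0n addr0 sqrtr_sqr. Qed.

Lemma cabsJ z : cabs z^* = cabs z.
Proof. by rewrite !cabsE; case: z => x y /=; rewrite sqrrN. Qed.

Lemma cabs_prod (I : Type) (r : seq I) (P : pred I) (F : I -> C) :
  cabs (\prod_(i <- r | P i) F i) = \prod_(i <- r | P i) cabs (F i).
Proof. by apply: (big_morph _ cabsM cabs1). Qed.

Lemma cabs_sum (I : Type) (r : seq I) (P : pred I) (F : I -> C) :
  cabs (\sum_(i <- r | P i) F i) <= \sum_(i <- r | P i) cabs (F i).
Proof.
elim/big_rec2: _ => [|i x y _ h]; first by rewrite cabs0.
by apply: le_trans (cabsD _ _) _; rewrite lerD2l.
Qed.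

Lemma cabs_distD z w : cabs z - cabs w <= cabs (z - w).
Proof. by rewrite lerBlDr -{1}(subrK w z) cabsD. Qed.

Lemma Re_le_cabs z : `|Re z| <= cabs z.
Proof.
by rewrite -(ler_pXn2r (ltn0Sn 1)) ?nnegrE ?cabs_ge0 // sqr_cabs real_normK ?num_real // lerDl sqr_ge0.
Qed.

Lemma Im_le_cabs z : `|Im z| <= cabs z.
Proof.
by rewrite -(ler_pXn2r (ltn0Sn 1)) ?nnegrE ?cabs_ge0 // sqr_cabs real_normK ?num_real // lerDr sqr_ge0.
Qed.

Lemma cabs_le_ReIm z : cabs z <= `|Re z| + `|Im z|.
Proof.
rewrite -(ler_pXn2r (ltn0Sn 1)) ?nnegrE ?cabs_ge0 ?addr_ge0 // sqr_cabs sqrrD.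
by rewrite !real_normK ?num_real // lerD2r lerDl mulrn_wge0 // mulr_ge0.
Qed.

Lemma ReM z w : Re (z * w) =
  Re z * Re w - Im z * Im w.
Proof. by case: z w => [x y] [x' y']. Qed.

Lemma ImM z w : Im (z * w) =
  Re z * Im w + Im z * Re w.
Proof. by case: z w => [x y] [x' y']. Qed.

Lemma ReD z w : Re (z + w) = Re z + Re w.
Proof. by case: z w => [x y] [x' y']. Qed.
Lemma ImD z w : Im (z + w) = Im z + Im w.
Proof. by case: z w => [x y] [x' y']. Qed.
Lemma ReN z : Re (- z) = - Re z. Proof. by case: z. Qed.
Lemma ImN z : Im (- z) = - Im z. Proof. by case: z. Qed.
Lemma ReJ z : Re z^* = Re z. Proof. by case: z. Qed.
Lemma ImJ z : Im z^* = - Im z. Proof. by case: z. Qed.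

Lemma Re_sum (I : Type) (r : seq I) (P : pred I) (F : I -> C) :
  Re (\sum_(i <- r | P i) F i) = \sum_(i <- r | P i) Re (F i).
Proof. by apply: (big_morph _ ReD). Qed.

Lemma Im_sum (I : Type) (r : seq I) (P : pred I) (F : I -> C) :
  Im (\sum_(i <- r | P i) F i) = \sum_(i <- r | P i) Im (F i).
Proof. by apply: (big_morph _ ImD). Qed.

Lemma complex_eqP z w : Re z = Re w ->
  Im z = Im w -> z = w.
Proof. by case: z w => [x y] [x' y'] /= -> ->. Qed.

Lemma conjcM z w : conjc (z * w) = conjc z * conjc w. Proof. exact: rmorphM. Qed.

Lemma cexp0 : cexp (0 : C) = 1.
Proof. by rewrite /cexp /= expR0 cos0 sin0 mul1r. Qed.

Lemma cexpD z w : cexp (z + w) = cexp z * cexp w.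
Proof.
rewrite /cexp ReD ImD expRD cosD sinD; apply: complex_eqP; rewrite !(ReM, ImM) /=; ring.
Qed.

Lemma cabs_cexp z : cabs (cexp z) = expR (Re z).
Proof.
rewrite /cexp cabsM cabs_real ger0_norm ?expR_ge0 // cabsE /= cos2Dsin2.
by rewrite sqrtr1 mulr1.
Qed.

Lemma cexp_neq0 z : cexp z != 0.
Proof. by rewrite -cabs_gt0 cabs_cexp expR_gt0. Qed.

Lemma cexpN z : cexp (- z) = (cexp z)^-1.
Proof.
by apply: (mulfI (cexp_neq0 z)); rewrite -cexpD subrr cexp0 mulfV // cexp_neq0.
Qed.

Lemma cexpXn z n : cexp (z * n%:R) = cexp z ^+ n.
Proof.
elim: n => [|n IH]; first by rewrite mulr0 cexp0 expr0.
by rewrite -natr1 mulrDr mulr1 cexpD IH exprSr.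
Qed.

Lemma cexpJ z : (cexp z)^* = cexp z^*.
Proof.
by rewrite /cexp ReJ ImJ cosN sinN; apply: complex_eqP; rewrite !(ReJ,ImJ,ReM,ImM) /=; ring.
Qed.

Lemma expiE (x : R) : expi x = cexp ('i * (2 * pi * x)%:C).
Proof. by congr cexp; apply: complex_eqP; rewrite !(ReM,ImM) /=; ring. Qed.

Lemma cabs_expi (x : R) : cabs (expi x) = 1.
Proof. by rewrite /expi cabs_cexp /= expR0. Qed.

Lemma expi0 : expi (0 : R) = 1.
Proof. by rewrite /expi mulr0 cexp0. Qed.

Lemma expiD (x y : R) : expi (x + y) = expi x * expi y.
Proof. by rewrite /expi -cexpD; congr cexp; apply: complex_eqP; rewrite ?(ReD,ImD) /=; ring. Qed.

Lemma expiN (x : R) : expi (- x) = (expi x)^*.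
Proof. by rewrite /expi cexpJ; congr cexp; apply: complex_eqP; rewrite ?(ReJ,ImJ) /=; ring. Qed.

Lemma expi1 : expi (1 : R) = 1.
Proof.
by rewrite /expi mulr1 /cexp /= expR0 mul1r mulr_natl cos2pi sin2pi.
Qed.

Lemma expi_int (k : int) : expi (k%:~R : R) = 1.
Proof.
have h n : expi (n%:R : R) = 1.
  by elim: n => [|n IH]; rewrite ?expi0 // -natr1 expiD IH expi1 mulr1.
by case: k => n; [exact: h | rewrite NegzE mulrNz expiN h conjc1].
Qed.

Lemma expi_eq1 (x : R) : expi x = 1 -> exists k : int, x = k%:~R.
Proof.
move=> h; exists (Num.floor x).
set y := x - (Num.floor x)%:~R.
have y01 : 0 <= y < 1 by rewrite /y subr_ge0 floor_le /= ltrBlDl -[1]/(1%:~R) -intrD floorD1_gt.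
have hy : expi y = 1.
  by rewrite /y expiD h mul1r -mulrNz expi_int.
suff : y = 0 by move/eqP; rewrite subr_eq0 => /eqP.
have pi0 := @pi_gt0 R.
have : cos (2 * pi * y) = 1 by move/(congr1 (@Re R)): hy; rewrite /expi /cexp /= expR0; lra.
rewrite -mulrA mulr_natl mulr2n cosD -!expr2 => /eqP; rewrite (_ : _ == 1 = (sin (pi * y) == 0)); last first.
  by rewrite -[sin _ == 0](sqrf_eq0) cos2sin2; apply/eqP/eqP; lra.
case/andP: y01 => y0 y1 /eqP s0; apply/eqP/negPn/negP => yn0.
have : 0 < sin (pi * y).
  apply: sin_gt0_pi; rewrite mulr_gt0 // ?lt_neqAle ?y0 1?eq_sym ?yn0 //=; nra.
by rewrite s0 ltxx.
Qed.

End ComplexModulus.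

(** * Finite sums over the integers and the Schur test *)

Section IntSums.
Variable R : realType.

(** The window [-N, N[, listed so that sums over it are the partial sums of
    the two halves of [zsum]. *)
Definition zrange (N : nat) : seq int :=
  [seq Posz i | i <- iota 0 N] ++ [seq Negz i | i <- iota 0 N].

Lemma mem_zrange N (k : int) : (k \in zrange N) = (- N%:Z <= k < N%:Z).
Proof.
rewrite mem_cat; case: k => n.
  rewrite mem_map; last by move=> i j [].
  rewrite mem_iota /= add0n (_ : Posz n \in map Negz _ = false) ?orbF; last by apply/negP => /mapP[].
  by apply/idP/idP; lia.
rewrite (_ : Negz n \in map Posz _ = false) /=; last by apply/negP => /mapP[].
rewrite mem_map; last by move=> i j [].
by rewrite mem_iota /= add0n; apply/idP/idP; lia.
Qed.

Lemma zrange_uniq N : uniq (zrange N).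
Proof.
rewrite cat_uniq !map_inj_uniq ?iota_uniq; [|by move=> i j []|by move=> i j []].
by rewrite andbT; apply/hasPn => _ /mapP[i _ ->]; apply/negP => /mapP[].
Qed.

Lemma big_zrange (V : nmodType) N (F : int -> V) :
  \sum_(k <- zrange N) F k = \sum_(i < N) F (Posz i) + \sum_(i < N) F (Negz i).
Proof. by rewrite big_cat !big_map /= -{1 2}(subn0 N) !big_mkord. Qed.

Lemma big_zrangeS (V : nmodType) N (F : int -> V) :
  \sum_(k <- zrange N.+1) F k = \sum_(k <- zrange N) F k + (F (Posz N) + F (Negz N)).
Proof. by rewrite !big_zrange !big_ord_recr /= addrACA. Qed.

Lemma telescope_zrange (V : zmodType) N (F : int -> V) :
  \sum_(k <- zrange N) (F k - F (k + 1)) = F (- N%:Z) - F N%:Z.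
Proof.
elim: N => [|N IH]; first by rewrite big_zrange !big_ord0 oppr0 subrr addr0.
rewrite big_zrangeS IH (_ : Posz N + 1 = Posz N.+1); last by lia.
rewrite (_ : Negz N + 1 = - Posz N) ?NegzE; last by lia.
by rewrite addrA subrKA addrC addrA subrK.
Qed.

Lemma ler_sum_sub (T : eqType) (s s' : seq T) (F : T -> R) :
  uniq s -> uniq s' -> {subset s <= s'} -> (forall x, 0 <= F x) ->
  \sum_(x <- s) F x <= \sum_(x <- s') F x.
Proof.
move=> us us' ss' F0.
rewrite (perm_big [seq x <- s' | x \in s]); last first.
  apply: uniq_perm => //; first exact: filter_uniq.
  by move=> x; rewrite mem_filter; case: (boolP (x \in s)) => // /ss' ->.
rewrite big_filter big_mkcond ler_sum // => x _.
by case: ifP.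
Qed.

Definition geo (k : int) : R := 2^-1 ^+ `|k|%N.

Lemma geo_ge0 k : 0 <= geo k. Proof. by rewrite exprn_ge0 // invr_ge0. Qed.

Lemma sum_geo_zrange N : \sum_(k <- zrange N) geo k <= 3 - 3 * 2^-1 ^+ N.
Proof.
elim: N => [|N IH]; first by rewrite big_zrange !big_ord0 expr0; lra.
rewrite big_zrangeS (_ : geo (Posz N) = 2^-1 ^+ N) // (_ : geo (Negz N) = 2^-1 * 2^-1 ^+ N) -?exprS //.
rewrite exprS; move: IH; move: (\sum_(k <- _) _) (2^-1 ^+ N) => x y; lra.
Qed.

Lemma seq_sub_zrange (s : seq int) : exists N, {subset s <= zrange N}.
Proof.
exists (\max_(k <- s) `|k|%N).+1 => k ks; rewrite mem_zrange.
have : (`|k| <= \max_(k <- s) `|k|)%N by exact: leq_bigmax_seq.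
by lia.
Qed.

Lemma sum_geo (s : seq int) : uniq s -> \sum_(k <- s) geo k <= 3.
Proof.
move=> us; have [N sN] := seq_sub_zrange s.
apply: (le_trans (ler_sum_sub us (zrange_uniq N) sN geo_ge0)).
apply: (le_trans (sum_geo_zrange N)).
by rewrite lerBlDr lerDl mulr_ge0 // exprn_ge0 // invr_ge0.
Qed.

Lemma sum_geo_inj (T : eqType) (s : seq T) (f : T -> int) :
  uniq s -> {in s &, injective f} -> \sum_(x <- s) geo (f x) <= 3.
Proof.
by move=> us fi; rewrite -(big_map f xpredT) sum_geo // map_inj_in_uniq.
Qed.

(** Cauchy-Schwarz for the weights M, summed up from
    2 z_u z_v <= z_u^2 + z_v^2. *)
Lemma weighted_sqr_sum (U : Type) (s : seq U) (M z : U -> R) :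
  (forall u, 0 <= M u) ->
  (\sum_(u <- s) M u * z u) ^+ 2 <= (\sum_(u <- s) M u) * \sum_(u <- s) M u * z u ^+ 2.
Proof.
move=> M0.
have h u v : M u * z u * (M v * z v) <= 2^-1 * (M u * (M v * z v ^+ 2)) + 2^-1 * (M v * (M u * z u ^+ 2)).
  have : 0 <= M u * M v * (z u - z v) ^+ 2 by rewrite mulr_ge0 ?sqr_ge0 ?mulr_ge0.
  by rewrite sqrrB; lra.
rewrite expr2 mulr_suml.
apply: (@le_trans _ _ (\sum_(u <- s) \sum_(v <- s) (2^-1 * (M u * (M v * z v ^+ 2)) + 2^-1 * (M v * (M u * z u ^+ 2))))).
  by apply: ler_sum => u _; rewrite mulr_sumr; apply: ler_sum => v _.
under eq_bigr do rewrite big_split /= -!mulr_sumr -mulr_suml.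
rewrite big_split /= -!mulr_sumr -mulr_suml.
by apply: le_of_eq; field.
Qed.

(** Cauchy-Schwarz in every row, then exchange of the two sums. *)
Lemma schur_test (T U : eqType) (r : seq T) (s : seq U) (M : T -> U -> R)
    (y : T -> R) (z : U -> R) (P Q : R) :
  (forall t u, 0 <= M t u) -> 0 <= P ->
  {in r, forall t, \sum_(u <- s) M t u <= P} ->
  {in s, forall u, \sum_(t <- r) M t u <= Q} ->
  {in r, forall t, 0 <= y t <= \sum_(u <- s) M t u * z u} ->
  \sum_(t <- r) y t ^+ 2 <= P * Q * \sum_(u <- s) z u ^+ 2.
Proof.
move=> M0 P0 hP hQ hy.
apply: (@le_trans _ _ (\sum_(t <- r) P * \sum_(u <- s) M t u * z u ^+ 2)).
  rewrite big_seq [leRHS]big_seq; apply: ler_sum => t tr.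
  have /andP[y0 yle] := hy t tr.
  apply: (@le_trans _ _ ((\sum_(u <- s) M t u * z u) ^+ 2)).
    by rewrite ler_pXn2r ?nnegrE // (le_trans y0).
  apply: (le_trans (weighted_sqr_sum _ _ _)) => //.
  rewrite ler_wpM2r ?hP // sumr_ge0 // => u _.
  by rewrite mulr_ge0 ?sqr_ge0.
rewrite -mulr_sumr -mulrA ler_wpM2l // exchange_big /= mulr_sumr.
rewrite big_seq [leRHS]big_seq; apply: ler_sum => u us.
by rewrite -mulr_suml ler_wpM2r ?sqr_ge0 ?hQ.
Qed.

End IntSums.

(** * q-Pochhammer products and the q-binomial theorem *)

Section Products.
Variable R : realType.
Local Notation C := R[i].

Lemma geom_sum_le (rho : R) n : 0 <= rho < 1 ->
  \sum_(j < n) rho ^+ j <= (1 - rho)^-1.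
Proof.
move=> /andP[r0 r1].
rewrite -[leRHS]mul1r ler_pdivlMr ?subr_gt0 //.
suff -> : (\sum_(j < n) rho ^+ j) * (1 - rho) = 1 - rho ^+ n.
  by rewrite gerBl exprn_ge0.
elim: n => [|n IH]; first by rewrite big_ord0 expr0 subrr mul0r.
by rewrite big_ord_recr /= mulrDl IH exprS; ring.
Qed.

(** The lower bound does not depend on the number of factors because
    1 - x >= e^{- x / (1 - kap)} for 0 <= x <= kap, and the exponents form a
    geometric series. *)
Lemma prod_1sub_lower (kap rho : R) : 0 <= kap < 1 -> 0 <= rho < 1 ->
  exists2 L, 0 < L & forall n, L <= \prod_(j < n) (1 - kap * rho ^+ j).
Proof.
move=> /andP[k0 k1] /andP[r0 r1].
exists (expR (- (kap / (1 - kap) / (1 - rho)))); first exact: expR_gt0.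
move=> n.
have hj j : expR (- (kap / (1 - kap) * rho ^+ j)) <= 1 - kap * rho ^+ j.
  set x := kap * rho ^+ j.
  have x0 : 0 <= x by rewrite mulr_ge0 // exprn_ge0.
  have xk : x <= kap by rewrite ler_piMr // exprn_ile1 // ltW.
  have x1 : 0 < 1 - x by lra.
  rewrite (_ : kap / (1 - kap) * rho ^+ j = x / (1 - kap)); last by rewrite /x mulrAC.
  apply: (@le_trans _ _ (expR (- (x / (1 - x))))).
    by rewrite ler_expR lerN2 ler_wpM2l // lef_pV2 ?posrE //; lra.
  rewrite expRN -[leRHS]invrK lef_pV2 ?posrE ?invr_gt0 ?expR_gt0 //.
  apply: le_trans (expR_ge1Dx _).
  by rewrite -[leRHS](_ : (1 - x)^-1 = _) // -[X in _ = X + _](mulfV (lt0r_neq0 x1)) -mulrDl subrK mul1r.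
apply: (@le_trans _ _ (\prod_(j < n) expR (- (kap / (1 - kap) * rho ^+ j)))).
  rewrite -expR_sum ler_expR sumrN lerN2 -mulr_sumr ler_wpM2l ?geom_sum_le ?r0 //.
  by rewrite divr_ge0 //; lra.
by apply: ler_prod => j _; rewrite expR_ge0 /=.
Qed.

Lemma prod_1add_upper (kap rho : R) n : 0 <= kap -> 0 <= rho < 1 ->
  \prod_(j < n) (1 + kap * rho ^+ j) <= expR (kap / (1 - rho)).
Proof.
move=> k0 /andP[r0 r1].
apply: (@le_trans _ _ (\prod_(j < n) expR (kap * rho ^+ j))).
  apply: ler_prod => j _; rewrite expR_ge1Dx andbT.
  by rewrite addr_ge0 // mulr_ge0 // exprn_ge0.
by rewrite -expR_sum ler_expR -mulr_sumr ler_wpM2l // geom_sum_le // r0.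
Qed.

Definition qpoch (p : C) n : C := \prod_(j < n) (1 - p ^+ j.+1).

Lemma qpochS p n : qpoch p n.+1 = qpoch p n * (1 - p ^+ n.+1).
Proof. by rewrite /qpoch big_ord_recr. Qed.

Lemma qpoch_lower (p : C) : cabs p < 1 ->
  exists2 L, 0 < L & forall n, L <= cabs (qpoch p n).
Proof.
move=> p1; have p0 := cabs_ge0 p.
have [||L L0 hL] := @prod_1sub_lower (cabs p) (cabs p); rewrite ?p0 //.
exists L => // n; apply: (le_trans (hL n)); rewrite cabs_prod; apply: ler_prod => j _.
rewrite -exprS -cabsX; apply/andP; split.
  by rewrite subr_ge0 cabsX exprn_ile1 // ltW.
by rewrite -{1}(cabs1 R); apply: cabs_distD.
Qed.

Lemma qpoch_upper (p : C) n : cabs p < 1 ->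
  cabs (qpoch p n) <= expR ((1 - cabs p)^-1).
Proof.
move=> p1; have p0 := cabs_ge0 p.
rewrite cabs_prod; apply: (le_trans _ (_ : expR (cabs p / (1 - cabs p)) <= _)); last first.
  by rewrite ler_expR ler_piMl ?ltW // invr_gt0 subr_gt0.
apply: (le_trans _ (prod_1add_upper n p0 _)); last by rewrite p0.
apply: ler_prod => j _; rewrite cabs_ge0 -exprS /= (le_trans (cabsD _ _)) //.
by rewrite cabs1 cabsN cabsX.
Qed.

(** Exponential convergence of the products replaces any discussion of their
    limit. *)
Lemma qpoch_dist (p : C) n m : cabs p < 1 ->
  cabs (qpoch p (n + m) - qpoch p n) <=
    expR ((1 - cabs p)^-1) * (1 - cabs p)^-1 * cabs p ^+ n.
Proof.
move=> p1; have p0 := cabs_ge0 p.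
set U := expR _.
apply: (@le_trans _ _ (U * cabs p ^+ n * \sum_(j < m) cabs p ^+ j)); last first.
  rewrite -mulrA [X in _ <= X]mulrAC -mulrA ler_wpM2l ?expR_ge0 // ler_wpM2l ?exprn_ge0 //.
  by rewrite geom_sum_le // p0.
elim: m => [|m IH]; first by rewrite addn0 subrr cabs0 big_ord0 mulr0.
rewrite addnS qpochS big_ord_recr /= [leRHS]mulrDr.
rewrite (_ : _ - _ = qpoch p (n + m) - qpoch p n + - (qpoch p (n + m) * p ^+ (n + m).+1)); last by ring.
apply: (le_trans (cabsD _ _)); apply: lerD => //.
rewrite cabsN cabsM cabsX -mulrA -exprD ler_pM ?exprn_ge0 ?cabs_ge0 ?qpoch_upper //.
by rewrite exprS ler_piMl ?exprn_ge0 // ltW.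
Qed.

(** Gaussian binomial coefficient, by its Pascal rule: no division is needed,
    so that the q-binomial theorem holds for every p. *)
Fixpoint gbin (p : C) (n i : nat) : C :=
  match n, i with
  | _, 0%N => 1
  | 0%N, _.+1 => 0
  | n'.+1, i'.+1 => gbin p n' i + p ^+ (n' - i') * gbin p n' i'
  end.

Lemma gbin0 p n : gbin p n 0 = 1. Proof. by case: n. Qed.

Lemma gbin_small p n i : (n < i)%N -> gbin p n i = 0.
Proof.
elim: n i => [|n IH] [|i] //= h.
by rewrite !IH ?mulr0 ?addr0 //; lia.
Qed.

(** The quotient formula for Gaussian binomials, by cross-multiplying both
    terms of the Pascal rule. *)
Lemma gbin_qpoch p n i : (i <= n)%N ->
  gbin p n i * (qpoch p i * qpoch p (n - i)) = qpoch p n.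
Proof.
elim: n i => [|n IH] [|i] //=.
- by move=> _; rewrite /qpoch big_ord0 !mul1r.
- by move=> _; rewrite subn0 mul1r /qpoch big_ord0 mul1r.
rewrite ltnS subSS => le_in.
rewrite mulrDl.
have h1 := IH i le_in.
have [e|lt_in] := eqVneq i n.
  rewrite e in h1 *.
  by rewrite gbin_small // mul0r add0r !qpochS -[in RHS]h1 subnn expr0; ring.
have {}lt_in : (i < n)%N by rewrite ltn_neqAle lt_in.
have h2 := IH i.+1 lt_in.
rewrite (_ : (n - i)%N = (n - i.+1).+1) in h1 *; last by lia.
transitivity (gbin p n i.+1 * (qpoch p i.+1 * qpoch p (n - i.+1)) * (1 - p ^+ (n - i.+1).+1)
  + p ^+ (n - i.+1).+1 * (gbin p n i * (qpoch p i * qpoch p (n - i.+1).+1)) * (1 - p ^+ i.+1)).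
  by rewrite !qpochS; ring.
rewrite h1 h2 qpochS (_ : n.+1 = (n - i.+1).+1 + i.+1)%N; last by lia.
by rewrite exprD; ring.
Qed.

Lemma qbinomial_theorem (p y : C) n :
  \prod_(j < n) (1 + y * p ^+ j) = \sum_(i < n.+1) gbin p n i * p ^+ 'C(i, 2) * y ^+ i.
Proof.
elim: n => [|n IH]; first by rewrite big_ord0 big_ord1 /= !mulr1.
rewrite big_ord_recr /= IH mulrDr mulr1.
rewrite [RHS]big_ord_recl /=.
under [in RHS]eq_bigr => i _ do rewrite /bump /= add1n 2!mulrDl.
rewrite big_split /= addrA; congr (_ + _).
  rewrite [in RHS]big_ord_recr /= gbin_small // !mul0r addr0.
  by rewrite big_ord_recl /= gbin0.
rewrite mulr_suml; apply: eq_bigr => i _.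
rewrite binS bin1 exprD exprS.
have -> : p ^+ n = p ^+ (n - i) * p ^+ i by rewrite -exprD subnK // -ltnS.
by ring.
Qed.

Lemma sum_centered (V : nmodType) n (F : int -> V) :
  \sum_(i < n.*2.+1) F (i%:Z - n%:Z) = \sum_(k <- zrange n) F k + F n.
Proof.
elim: n => [|n IH]; first by rewrite big_zrange big_ord1 !big_ord0 !add0r.
rewrite doubleS big_ord_recl big_ord_recr /= big_zrangeS.
have e (i : nat) : (bump 0 i)%:Z - n.+1%:Z = i%:Z - n%:Z by rewrite /bump; lia.
under eq_bigr => i _ do rewrite e.
rewrite IH /bump /= add1n.
rewrite (_ : (n.*2.+2)%:Z - n.+1%:Z = n.+1); last by lia.
rewrite (_ : 0%:Z - n.+1%:Z = Negz n); last by lia.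
by rewrite addrA (addrC (F (Negz n))) -!addrA.
Qed.

End Products.

(** * Two-sided series of geometric decay *)

Section ZSum.
Variable R : realType.
Local Notation C := R[i].
Local Notation half := (2^-1 : R).

Lemma half_ge0 n : 0 <= half ^+ n. Proof. by rewrite exprn_ge0 // invr_ge0. Qed.

Lemma le_of_exp_decay (x y c d r s : R) : 0 <= r < 1 -> 0 <= s < 1 ->
  (forall n, x <= y + (c * r ^+ n + d * s ^+ n)) -> x <= y.
Proof.
move=> /andP[r0 r1] /andP[s0 s1] h.
have -> : y = y + (c * 0 + d * 0) by rewrite !mulr0 !addr0.
apply: (@cvgr_to_ge _ \oo _ _ (fun n => y + (c * r ^+ n + d * s ^+ n))).
  apply: cvgD; first exact: cvg_cst.
  by apply: cvgD; apply: cvgMr; apply: cvg_expr; rewrite ger0_norm.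
exact: nearW.
Qed.

Lemma real_series_dominated (v : R^nat) (K : R) : (forall n, `|v n| <= K * half ^+ n) ->
  cvgn (series v) /\
  forall N, `|limn (series v) - \sum_(i < N) v i| <= 2 * K * half ^+ N.
Proof.
move=> h.
have K0 : 0 <= K by have := h 0%N; rewrite expr0 mulr1; apply: le_trans.
have cv : cvgn (series v).
  apply: (@normed_cvg R R); apply: (@series_le_cvg _ _ (geometric K half)) => //.
  - by move=> n /=; exact: normr_ge0.
  - by move=> n /=; exact: mulr_ge0 K0 (half_ge0 n).
  - by apply: is_cvg_geometric_series; rewrite ger0_norm ?invr_ge0 //; lra.
split => // N.
have hm m : `|series v (N + m)%N - \sum_(i < N) v i| <= 2 * K * half ^+ N * (1 - half ^+ m).
  elim: m => [|m IH]; first by rewrite addn0 /series /= big_mkord subrr normr0 expr0 subrr mulr0.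
  rewrite addnS seriesSr.
  rewrite (_ : _ - _ = series v (N + m)%N - \sum_(i < N) v i + v (N + m)%N); last by ring.
  apply: (le_trans (ler_normD _ _)); apply: (le_trans (lerD IH (h _))).
  by rewrite exprD exprS; apply: le_of_eq; field.
apply: (@cvgr_to_le _ \oo _ _ (fun m => `|series v m - \sum_(i < N) v i|)).
  apply: cvg_norm; apply: cvgB; [exact: cv | exact: cvg_cst].
exists N => // m /= Nm; rewrite -(subnKC Nm); apply: (le_trans (hm _)).
by rewrite ler_piMr ?mulr_ge0 ?half_ge0 // gerBl half_ge0.
Qed.

(** The norm of [C^o] takes its values in C; this lemma and its converse
    [cvg_cabsP] let convergence be tested with the real modulus. *)
Lemma cvg_cabs (T : Type) (F : set_system T) {FF : Filter F} (u : T -> C) (l : C) :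
  (forall e : R, 0 < e -> \forall x \near F, cabs (u x - l) <= e) ->
  (u : T -> C^o) @ F --> (l : C^o).
Proof.
move=> h; apply/cvgrPdist_le => -[e e'] /=; rewrite ltcE /= => /andP[/eqP -> e0].
apply: filterS (h e e0) => x.
by rewrite normc_def -cabsE lecE /= eqxx /= cabsB.
Qed.

Lemma cvg_cabsP (T : Type) (F : set_system T) {FF : Filter F} (u : T -> C) (l : C) :
  (u : T -> C^o) @ F --> (l : C^o) ->
  forall e : R, 0 < e -> \forall x \near F, cabs (u x - l) <= e.
Proof.
move=> /cvgrPdist_le h e e0.
have /h : 0 < (e%:C : C^o) by rewrite ltcR.
by apply: filterS => x; rewrite normc_def -cabsE lecE /= eqxx /= cabsB.
Qed.

Lemma cvg_complex (T : Type) (F : set_system T) {FF : Filter F} (u : T -> C) (l : C) :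
  (Re (u n) @[n --> F] --> Re l) ->
  (Im (u n) @[n --> F] --> Im l) ->
  (u : T -> C^o) @ F --> (l : C^o).
Proof.
move=> hr hi; apply: cvg_cabs => e e0.
have e20 : 0 < e / 2 by rewrite divr_gt0.
move/cvgrPdist_le : hr => /(_ _ e20) hr.
move/cvgrPdist_le : hi => /(_ _ e20) hi.
near=> n.
rewrite cabsB (le_trans (cabs_le_ReIm _)) // ReD ReN ImD ImN [leRHS](splitr e) lerD //.
by near: n. by near: n.
Unshelve. all: by end_near. Qed.

Lemma complex_series_dominated (v : nat -> C) (K : R) :
  (forall n, cabs (v n) <= K * half ^+ n) ->
  forall N, cabs ((limn (series (v : nat -> C^o)) : C) - \sum_(i < N) v i) <= 4 * K * half ^+ N.
Proof.
move=> h N.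
have [cr hr] := @real_series_dominated (fun n => Re (v n)) K
  (fun n => le_trans (Re_le_cabs _) (h n)).
have [ci hi] := @real_series_dominated (fun n => Im (v n)) K
  (fun n => le_trans (Im_le_cabs _) (h n)).
have -> : limn (series (v : nat -> C^o)) =
   limn (series (fun n => Re (v n))) +i* limn (series (fun n => Im (v n))).
  apply: (@cvg_lim C^o) => //.
  apply: cvg_complex => /=.
    under eq_fun do rewrite /series /= Re_sum.
    exact: cr.
  under eq_fun do rewrite /series /= Im_sum.
  exact: ci.
apply: (le_trans (cabs_le_ReIm _)); rewrite ReD ImD ReN ImN Re_sum Im_sum /=.
apply: (le_trans (lerD (hr N) (hi N))).
by rewrite -!mulrDl; apply: le_of_eq; ring.
Qed.

(** Each half of the series is approximated by its partial sum up to a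
    geometric tail. *)
Lemma zsum_approx (u : int -> C) (K : R) : (forall k, cabs (u k) <= K * geo R k) ->
  forall N, cabs (zsum u - \sum_(k <- zrange N) u k) <= 8 * K * half ^+ N.
Proof.
move=> h N; rewrite /zsum big_zrange opprD addrACA.
apply: (le_trans (cabsD _ _)).
rewrite (_ : 8 * K * _ = 4 * K * half ^+ N + 4 * K * half ^+ N); last by ring.
have K0 : 0 <= K by have := h 0; rewrite /geo expr0 mulr1; apply: le_trans; rewrite cabs_ge0.
apply: lerD; apply: complex_series_dominated => n; apply: (le_trans (h _)); rewrite ler_wpM2l //.
by rewrite /geo /= exprS ler_piMl ?half_ge0 //; lra.
Qed.

Lemma cabs_le_of_exp_decay (x y : C) (c d r s : R) : 0 <= r < 1 -> 0 <= s < 1 ->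
  (forall n, cabs (x - y) <= c * r ^+ n + d * s ^+ n) -> x = y.
Proof.
move=> hr hs h; apply/eqP; rewrite -subr_eq0 -cabs_eq0 eq_le cabs_ge0 andbT.
by apply: (le_of_exp_decay hr hs) => n; rewrite add0r.
Qed.

(** Partial sums of both series differ by two boundary terms, which tend to 0. *)
Lemma zsum_shift (u : int -> C) (K : R) : (forall k, cabs (u k) <= K * geo R k) ->
  zsum (fun k => u (k + 1)) = zsum u.
Proof.
move=> h.
have K0 : 0 <= K by have := h 0; rewrite /geo expr0 mulr1; apply: le_trans; rewrite cabs_ge0.
have h' k : cabs (u (k + 1)) <= 2 * K * geo R k.
  apply: (le_trans (h _)); rewrite [2 * K]mulrC -mulrA ler_wpM2l //.
  have e : (`|k| <= `|(k + 1)%R|.+1)%N by lia.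
  have : half ^+ `|(k + 1)%R|.+1 <= half ^+ `|k| by apply: ler_wiXn2l => //; lra.
  by rewrite exprS /geo; lra.
have hh : 0 <= half < 1 by lra.
apply: (cabs_le_of_exp_decay (c := 100 * K) (d := 0) hh hh) => n.
rewrite mul0r addr0.
have h1 := zsum_approx h n; have h2 := zsum_approx h' n.
have h3 := h n; have h4 := h (- n%:Z).
rewrite /geo (_ : `|(- n%:Z)%R|%N = n) /= in h3 h4; last by lia.
have tele := telescope_zrange n u; rewrite big_split /= sumrN in tele.
rewrite (_ : _ - _ = (zsum (fun k => u (k + 1)) - \sum_(k <- zrange n) u (k + 1))
  + (- (zsum u - \sum_(k <- zrange n) u k)) + (- (\sum_(k <- zrange n) u k - \sum_(k <- zrange n) u (k + 1)))); last by ring.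
rewrite tele.
apply: (le_trans (cabsD _ _)).
have := cabsD (u (- n%:Z)) (- u n); rewrite !cabsN.
have := mulr_ge0 K0 (half_ge0 n).
have := cabsD (zsum (fun k => u (k + 1)) - \sum_(k <- zrange n) u (k + 1)) (- (zsum u - \sum_(k <- zrange n) u k)).
rewrite cabsN; move: h1 h2 h3 h4.
lra.
Qed.

End ZSum.

(** * The theta series and its product formula *)

Section Theta.
Variable R : realType.
Local Notation C := R[i].
Local Notation half := (2^-1 : R).

Lemma expR_quadratic_le (A B t : R) : 0 < A ->
  expR (- A * t ^+ 2 + B * t) <= expR (B ^+ 2 / (4 * A)).
Proof.
move=> A0; rewrite ler_expR -subr_ge0.
rewrite (_ : _ - _ = A * (t - B / (2 * A)) ^+ 2); first by rewrite mulr_ge0 ?sqr_ge0 ?ltW.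
by field; rewrite gt_eqF.
Qed.

Lemma expRN_le_half n : expR (- n%:R) <= half ^+ n.
Proof.
have h : expR (-1) <= half.
  rewrite expRN lef_pV2 ?posrE ?expR_gt0 //.
  by apply: le_trans (expR_ge1Dx _); lra.
by rewrite -mulN1r expRM_natr lerXn2r // ?nnegrE ?expR_ge0 // invr_ge0.
Qed.

Definition gterm (a zeta : C) (k : int) : C := cexp (a * k%:~R ^+ 2 + zeta * k%:~R).

Definition theta_prod (a zeta : C) n : C :=
  \prod_(j < n) ((1 + cexp (zeta + a) * cexp (2 * a) ^+ j)
               * (1 + cexp (2 * a) ^+ j.+1 / cexp (zeta + a))).

(** This is the q-binomial theorem with 2 n factors, recentred at the middle
    index; when n grows it becomes the Jacobi triple product. *)
Lemma finite_triple_product (a zeta : C) n :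
  \sum_(i < n.*2.+1) gbin (cexp (2 * a)) n.*2 i * gterm a zeta (i%:Z - n%:Z)
  = theta_prod a zeta n.
Proof.
set p := cexp (2 * a); set x := cexp (zeta + a).
have p0 : p != 0 := cexp_neq0 _.
have x0 : x != 0 := cexp_neq0 _.
pose E := cexp (zeta * n%:R - a * n%:R ^+ 2).
have E0 : E != 0 := cexp_neq0 _.
apply: (mulfI E0).
(* The q-binomial theorem at y = x / p ^ n; the factor E collects the powers that recentre the sum at i = n. *)
transitivity (\prod_(j < n.*2) (1 + (x / p ^+ n) * p ^+ j)).
  rewrite qbinomial_theorem mulr_sumr; apply: eq_bigr => i _.
  rewrite mulrCA -mulrA; congr (_ * _).
  have -> : x / p ^+ n = cexp (zeta + a - 2 * a * n%:R) by rewrite -cexpXn -cexpN -cexpD.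
  rewrite /gterm -!cexpXn -!cexpD; congr cexp.
  rewrite rmorphB /= !pmulrn.
  have e : (('C(i, 2))%:R * 2 : C) = i%:R ^+ 2 - i%:R.
    have := mul_bin_diag i 1; rewrite bin1 => /(congr1 (fun m => m%:R : C)).
    case: (i : nat) => [|m]; first by rewrite bin0n /= => _; ring.
    by rewrite !natrM /= => h; rewrite mulrC -h -natr1; ring.
  rewrite (_ : 2 * a * _ = a * (('C(i, 2))%:R * 2)); last by ring.
  by rewrite e; ring.
rewrite -addnn big_split_ord /=.
have -> : E = \prod_(j < n) (x / p ^+ j.+1).
  rewrite /E; elim: n {E E0} => [|n IH].
    by rewrite big_ord0 mulr0 expr0n mulr0 subrr cexp0.
  rewrite big_ord_recr /= -IH -cexpXn -cexpN -!cexpD; congr cexp.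
  by rewrite -!natr1; ring.
rewrite (reindex_inj rev_ord_inj) /= -!big_split /=.
apply: eq_bigr => j _.
have -> : p ^+ (n + j) = p ^+ n * p ^+ j by rewrite exprD.
have -> : p ^+ n = p ^+ (n - j.+1) * p ^+ j.+1 by rewrite -exprD subnK.
rewrite -/p -/x !exprS; move: (p ^+ j) (p ^+ (n - j.+1)) (expf_neq0 j p0) (expf_neq0 (n - j.+1) p0) => u v u0 v0.
by field; rewrite x0 p0 u0 v0.
Qed.

(** The Gaussian binomial gbin p (2n) i is a quotient of products that are
    all exponentially close to one another when i is far from 0 and 2 n.  The
    bound is poor near the ends, where the terms of the theta series are tiny. *)
Lemma qpoch_ratio_bound (p : C) : cabs p < 1 -> exists2 K, 0 <= K & forall n i, (i <= n.*2)%N ->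
  cabs (qpoch p n ^+ 2 / qpoch p n.*2 * gbin p n.*2 i - 1)
    <= K * cabs p ^+ (n - `|i%:Z - n%:Z|).
Proof.
move=> p1; have p0 := cabs_ge0 p.
have [L L0 hL] := qpoch_lower p1.
have hU n := qpoch_upper n p1.
set U := expR _ in hU.
have U0 : 0 < U by exact: expR_gt0.
have q0 n : qpoch p n != 0 by rewrite -cabs_gt0 (lt_le_trans L0).
pose c := U * (1 - cabs p)^-1.
have c0 : 0 <= c by rewrite mulr_ge0 ?ltW // invr_gt0 subr_gt0.
exists (L^-1 ^+ 2 * (U * (c + c))).
  apply: mulr_ge0; first by rewrite exprn_ge0 // invr_ge0 ltW.
  by apply: mulr_ge0; [exact: ltW | exact: addr_ge0].
have key n m : (m <= n)%N ->
    cabs (qpoch p n ^+ 2 - qpoch p (n - m) * qpoch p (n + m)) <= U * (c + c) * cabs p ^+ (n - m).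
  move=> mn.
  rewrite (_ : _ - _ = qpoch p n * (qpoch p (n - m + m) - qpoch p (n - m))
     + qpoch p (n - m) * - (qpoch p (n + m) - qpoch p n)); last by rewrite subnK //; ring.
  apply: (le_trans (cabsD _ _)); rewrite !cabsM cabsN mulrDr mulrDl.
  have d1 := qpoch_dist (n - m) m p1.
  have d2 := qpoch_dist n m p1.
  rewrite -!mulrA; apply: lerD; apply: ler_pM; rewrite ?cabs_ge0 ?hU //.
    by rewrite mulrA.
  rewrite mulrA; apply: (le_trans d2); rewrite -/U -/c ler_wpM2l //.
  by apply: ler_wiXn2l => //; [exact: ltW | exact: leq_subr].
move=> n i ile.
have g := gbin_qpoch p ile.
have [f1 f2] : (qpoch p i != 0) /\ (qpoch p (n.*2 - i) != 0) by [].
have -> : qpoch p n ^+ 2 / qpoch p n.*2 * gbin p n.*2 i - 1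
   = (qpoch p n ^+ 2 - qpoch p i * qpoch p (n.*2 - i)) / (qpoch p i * qpoch p (n.*2 - i)).
  have f3 := q0 n.*2; rewrite -g in f3 *.
  have f4 : gbin p n.*2 i != 0 by apply: contraNneq f3 => ->; rewrite mul0r.
  by field; rewrite f1 f2 f4.
rewrite cabsM cabsV cabsM mulrC -mulrA.
apply: ler_pM; rewrite ?invr_ge0 ?mulr_ge0 ?cabs_ge0 //.
  by rewrite exprVn lef_pV2 ?posrE ?mulr_gt0 ?exprn_gt0 ?cabs_gt0 // expr2 ler_pM // ltW.
have [le_in|lt_ni] := leqP i n.
  have := key n (n - i)%N (leq_subr _ _).
  rewrite (_ : (n - (n - i))%N = i); last by lia.
  rewrite (_ : (n + (n - i))%N = (n.*2 - i)%N); last by lia.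
  by rewrite (_ : (n - `|i%:Z - n%:Z|)%N = i) //; lia.
have := key n (i - n)%N; rewrite (_ : (i - n <= n)%N); last by lia.
move=> /(_ isT).
rewrite (_ : (n - (i - n))%N = (n.*2 - i)%N); last by lia.
rewrite (_ : (n + (i - n))%N = i); last by lia.
rewrite (_ : (n - `|i%:Z - n%:Z|)%N = (n.*2 - i)%N); last by lia.
by rewrite [qpoch p (_ - _) * _]mulrC.
Qed.

Lemma cabs_gterm (a zeta : C) k :
  cabs (gterm a zeta k) = expR (Re a * k%:~R ^+ 2 + Re zeta * k%:~R).
Proof.
rewrite cabs_cexp; congr expR; rewrite ReD -!(rmorph_int (real_complex R)) -rmorphXn.
by rewrite !ReM /= !mulr0 !subr0.
Qed.

(** A Gaussian beats every geometric sequence: D is free, so that the factor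
    e^{-D |k|} can compensate the loss in [qpoch_ratio_bound]. *)
Lemma gterm_dominated (a : C) (B D : R) : Re a < 0 ->
  exists2 K, 0 < K & forall zeta k, `|Re zeta| <= B ->
    cabs (gterm a zeta k) <= K * geo R k * expR (- D) ^+ `|k|.
Proof.
move=> a0; set A := - Re a; have A0 : 0 < A by rewrite oppr_gt0.
exists (expR ((B + D + 1) ^+ 2 / (4 * A))); first exact: expR_gt0.
move=> zeta k hz.
rewrite cabs_gterm /geo.
set m := `|k|%N.
have km : `|k%:~R : R| = m%:R by rewrite /m -intr_norm natr_absz.
have k2 : (k%:~R : R) ^+ 2 = m%:R ^+ 2.
  by rewrite -km real_normK ?num_real.
apply: (@le_trans _ _ (expR (- A * m%:R ^+ 2 + (B + D + 1) * m%:R) * expR (- m%:R) * expR (- D) ^+ m)).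
  rewrite -expRM_natr -!expRD ler_expR k2 /A opprK.
  have : Re zeta * k%:~R <= B * m%:R.
    by apply: (le_trans (ler_norm _)); rewrite normrM km ler_wpM2r.
  by lra.
rewrite ler_wpM2r ?exprn_ge0 ?expR_ge0 //.
by apply: ler_pM; [exact: expR_ge0 | exact: expR_ge0 | exact: expR_quadratic_le | exact: expRN_le_half].
Qed.

Definition theta (a zeta : C) : C := zsum (gterm a zeta).

(** In the strip |x| and 1 / |x| are at most e^A, where A = - Re a and
    x = e^{zeta + a}, while |p| = e^{-2A}; so all factors but 1 + x differ from 1
    by at most e^{-A} |p|^j, and their product is bounded above and below. *)
Lemma theta_prod_bounds (a : C) : Re a < 0 ->
  exists L U : R, [/\ 0 < L, 0 < U & forall zeta n, `|Re (zeta + a)| <= - Re a ->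
    L * cabs (1 + cexp (zeta + a)) <= cabs (theta_prod a zeta n.+1) <= U * cabs (1 + cexp (zeta + a))].
Proof.
move=> a0; set A := - Re a; have A0 : 0 < A by rewrite oppr_gt0.
pose kap := expR (- A); pose rho := expR (- (2 * A)).
have kap01 : 0 <= kap < 1 by rewrite expR_ge0 expR_lt1; lra.
have rho01 : 0 <= rho < 1 by rewrite expR_ge0 expR_lt1; lra.
have [L L0 hL] := prod_1sub_lower kap01 rho01.
have kap0 : 0 <= kap by case/andP: kap01.
have hU n := prod_1add_upper n kap0 rho01.
set U := expR _ in hU; have U0 : 0 < U by exact: expR_gt0.
exists (L * L), (U * U); split; rewrite ?mulr_gt0 // => zeta n hz.
set x := cexp (zeta + a); set p := cexp (2 * a).
have rp : cabs p = rho.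
  by rewrite cabs_cexp /rho /A -(rmorph_nat (real_complex R)) ReM /= mul0r subr0 mulrN opprK.
have x1 : cabs x <= expR A by rewrite cabs_cexp ler_expR (le_trans (ler_norm _)).
have x2 : (cabs x)^-1 <= expR A.
  by rewrite cabs_cexp -expRN ler_expR (le_trans (ler_norm _)) // normrN.
have e1 j : expR A * rho ^+ j.+1 = kap * rho ^+ j.
  by rewrite exprS mulrA /rho /kap -expRD; congr (expR _ * _); ring.
rewrite /theta_prod -/p -/x big_split /= big_ord_recl /= expr0 mulr1.
set P1 := \prod_(i < n) _; set P2 := \prod_(i < n.+1) _.
have b1 j : cabs (x * p ^+ j.+1) <= kap * rho ^+ j.
  by rewrite cabsM cabsX rp -e1 ler_wpM2r ?exprn_ge0 //; case/andP: rho01.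
have b2 j : cabs (p ^+ j.+1 / x) <= kap * rho ^+ j.
  by rewrite mulrC cabsM cabsV cabsX rp -e1 ler_wpM2r ?exprn_ge0 //; case/andP: rho01.
have pos j : 0 <= 1 - kap * rho ^+ j.
  rewrite subr_ge0; case/andP: kap01 => _ /ltW h1; case/andP: rho01 => h2 /ltW h3.
  by apply: mulr_ile1 => //; [exact: exprn_ge0 | exact: exprn_ile1].
have b (y : C) (e : R) : cabs y <= e -> (1 - e <= cabs (1 + y)) && (cabs (1 + y) <= 1 + e).
  move=> ye; apply/andP; split.
    have := cabs_distD 1 (- y); rewrite cabsN cabs1 opprK; lra.
  by apply: (le_trans (cabsD _ _)); rewrite cabs1 lerD2l.
have q1 : L <= cabs P1 <= U.
  rewrite cabs_prod; apply/andP; split; [apply: le_trans (hL n) _|apply: le_trans (hU n)];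
  by apply: ler_prod => j _; rewrite ?pos ?cabs_ge0 /bump /= ?add1n; case/andP: (b _ _ (b1 j)).
have q2 : L <= cabs P2 <= U.
  rewrite cabs_prod; apply/andP; split; [apply: le_trans (hL n.+1) _|apply: le_trans (hU n.+1)];
  by apply: ler_prod => j _; rewrite ?pos ?cabs_ge0 /=; case/andP: (b _ _ (b2 j)).
rewrite !cabsM; case/andP: q1 => q11 q12; case/andP: q2 => q21 q22.
rewrite -mulrA [cabs (1 + x) * _]mulrC.
by apply/andP; split; apply: ler_wpM2r; rewrite ?cabs_ge0 //; apply: ler_pM => //;
  rewrite ?cabs_ge0 // ltW.
Qed.

Lemma absz_centered_le n i : (i <= n.*2)%N -> (`|i%:Z - n%:Z| <= n)%N.
Proof. by lia. Qed.

(** The bounds of the finite products pass to theta, up to the constant of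
    the triple product, since the error is exponentially small in n. *)
Lemma theta_bounds (a : C) : Re a < 0 ->
  exists L U : R, [/\ 0 < L, 0 < U & forall zeta, `|Re (zeta + a)| <= - Re a ->
    L * cabs (1 + cexp (zeta + a)) <= cabs (theta a zeta) <= U * cabs (1 + cexp (zeta + a))].
Proof.
move=> a0; set A := - Re a; have A0 : 0 < A by rewrite oppr_gt0.
have [L [U [L0 U0 hP]]] := theta_prod_bounds a0.
set p := cexp (2 * a).
have rp : cabs p = expR (- (2 * A)).
  by rewrite cabs_cexp /A -(rmorph_nat (real_complex R)) ReM /= mul0r subr0 mulrN opprK.
have p1 : cabs p < 1 by rewrite rp expR_lt1; lra.
have p0 := cabs_ge0 p.
have [Lq Lq0 hLq] := qpoch_lower p1.
have hUq n := qpoch_upper n p1.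
set Uq := expR _ in hUq; have Uq0 : 0 < Uq by exact: expR_gt0.
have [K1 K10 hK1] := qpoch_ratio_bound p1.
(* The strip gives |Re zeta| <= 2 A, and the rate D = 2 A makes e^{-D |k|} equal to |p|^|k|. *)
have [K K0 hK] := gterm_dominated (2 * A) (2 * A) a0.
exists (Lq ^+ 2 / Uq * L), (Uq ^+ 2 / Lq * U).
split; rewrite ?mulr_gt0 ?invr_gt0 ?exprn_gt0 // => zeta hz.
have hz2 : `|Re zeta| <= 2 * A.
  by move: hz; rewrite ReD !ler_norml /A => /andP[]; lra.
have ht k := hK zeta k hz2.
rewrite -rp in ht.
have ht' k : cabs (gterm a zeta k) <= K * geo R k.
  apply: (le_trans (ht k)); apply: ler_piMr; first by rewrite mulr_ge0 ?geo_ge0 // ltW.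
  by rewrite exprn_ile1 // ltW.
pose W n := qpoch p n ^+ 2 / qpoch p n.*2.
have hW n : Lq ^+ 2 / Uq <= cabs (W n) <= Uq ^+ 2 / Lq.
  have l2 := lt_le_trans Lq0 (hLq n.*2).
  have Lq1 := ltW Lq0; have Uq1 := ltW Uq0.
  rewrite /W cabsM cabsV cabsX !expr2; apply/andP; split; apply: ler_pM;
   rewrite ?mulr_ge0 ?invr_ge0 ?cabs_ge0 //; try (by apply: ler_pM; rewrite ?cabs_ge0);
   by rewrite lef_pV2 ?posrE.
(* The error splits into a tail of the theta series and the defect of the weights W n * gbin p n.*2 i from 1. *)
have main n : cabs (theta a zeta - W n * theta_prod a zeta n) <= 9 * K * half ^+ n + 3 * K * K1 * cabs p ^+ n.
  rewrite -finite_triple_product -/p mulr_sumr.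
  under [in X in cabs (_ - X)]eq_bigr => i _ do rewrite mulrA.
  have z1 := zsum_approx ht' n.
  rewrite -/(theta a zeta) in z1.
  pose G (i : nat) := gterm a zeta (i%:Z - n%:Z).
  have -> : theta a zeta - \sum_(i < n.*2.+1) W n * gbin p n.*2 i * gterm a zeta (i%:Z - n%:Z)
    = theta a zeta - \sum_(k <- zrange n) gterm a zeta k + - gterm a zeta n
      + - \sum_(i < n.*2.+1) (W n * gbin p n.*2 i - 1) * G i.
    have -> : \sum_(i < n.*2.+1) (W n * gbin p n.*2 i - 1) * G i =
        \sum_(i < n.*2.+1) W n * gbin p n.*2 i * G i - \sum_(i < n.*2.+1) G i.
      by rewrite -sumrB; apply: eq_bigr => i _; rewrite mulrBl mul1r.
    by rewrite (sum_centered n (gterm a zeta)) /G; ring.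
  apply: (le_trans (cabsD _ _)); apply: lerD.
    apply: (le_trans (cabsD _ _)); rewrite cabsN.
    apply: (le_trans (lerD z1 (ht' _))); rewrite /geo /=.
    by apply: le_of_eq; ring.
  rewrite cabsN; apply: (le_trans (cabs_sum _ _ _)).
  apply: (@le_trans _ _ (\sum_(i < n.*2.+1) K * K1 * cabs p ^+ n * geo R (i%:Z - n%:Z))).
    apply: ler_sum => i _; rewrite cabsM.
    have ile : (i <= n.*2)%N by rewrite -ltnS.
    apply: (le_trans (ler_pM (cabs_ge0 _) (cabs_ge0 _) (hK1 n i ile) (ht _))).
    have -> : cabs p ^+ n = cabs p ^+ (n - `|i%:Z - n%:Z|) * cabs p ^+ `|i%:Z - n%:Z|.
      by rewrite -exprD subnK // absz_centered_le.
    by apply: le_of_eq; ring.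
  rewrite -mulr_sumr mulrC (_ : 3 * K * K1 * _ = 3 * (K * K1 * cabs p ^+ n)); last by ring.
  apply: ler_wpM2r; first by rewrite mulr_ge0 ?exprn_ge0 // mulr_ge0 // ltW.
  apply: sum_geo_inj; first exact: index_enum_uniq.
  by move=> i j _ _ /addIr[] /val_inj.
have half01 : 0 <= half < 1 by lra.
have p01 : 0 <= cabs p < 1 by rewrite p0.
set X := cabs (1 + _).
have X0 : 0 <= X := cabs_ge0 _.
have hWP n : Lq ^+ 2 / Uq * L * X <= cabs (W n.+1 * theta_prod a zeta n.+1) <= Uq ^+ 2 / Lq * U * X.
  have /andP[w1 w2] := hW n.+1; have /andP[v1 v2] := hP zeta n hz.
  rewrite cabsM -(mulrA (Lq ^+ 2 / Uq)) -(mulrA (Uq ^+ 2 / Lq)).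
  have r1 : 0 <= Lq ^+ 2 / Uq by rewrite divr_ge0 ?exprn_ge0 // ltW.
  by apply/andP; split; apply: ler_pM => //; rewrite ?cabs_ge0 // mulr_ge0 // ltW.
apply/andP; split.
  apply: (le_of_exp_decay (c := 9 * K * half) (d := 3 * K * K1 * cabs p) half01 p01) => n.
  have /andP[w1 w2] := hWP n; apply: (le_trans w1).
  have h := main n.+1; rewrite !exprS !mulrA in h.
  rewrite -lerBlDl; apply: le_trans h; rewrite cabsB; exact: cabs_distD.
apply: (le_of_exp_decay (c := 9 * K * half) (d := 3 * K * K1 * cabs p) half01 p01) => n.
have /andP[w1 w2] := hWP n; rewrite -lerBlDl.
have h := main n.+1; rewrite !exprS !mulrA in h; apply: le_trans h.
by apply: le_trans (cabs_distD _ _); rewrite lerD2l lerN2.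
Qed.

End Theta.

(** * The exponential function near 1 *)

Section Circle.
Variable R : realType.
Local Notation C := R[i].

Lemma sin_MVT (x : R) : 0 <= x -> exists2 c, 0 <= c <= x & sin x = cos c * x.
Proof.
move=> x0.
have [|c] := @MVT_segment R sin cos 0 x x0.
  by apply: continuous_subspaceT => y; exact: continuous_sin.
rewrite in_itv /= sin0 !subr0 => h1 h2; by exists c.
Qed.

Lemma sin_le_norm (x : R) : `|sin x| <= `|x|.
Proof.
wlog x0 : x / 0 <= x.
  move=> h; have [/h //|/ltW x0] := leP 0 x.
  by rewrite -normrN -sinN -[leRHS]normrN h // oppr_ge0.
have [c _ ->] := sin_MVT x0.
by rewrite normrM ler_piMl // cos_max.
Qed.

Lemma sin_ge_half (x : R) : 0 <= x <= pi / 2 -> x / 2 <= sin x.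
Proof.
move=> /andP[x0 x1].
have y0 : 0 <= x / 2 by rewrite divr_ge0.
have [c /andP[c0 cx] e] := sin_MVT y0.
have cosy : 0 <= cos (x / 2).
  by apply: cos_ge0_pihalf; have := pi_gt0 R; lra.
have cosc : cos (x / 2) <= cos c.
  have pi0 := pi_gt0 R.
  rewrite leNgt ltr_cos ?in_itv //=; first by rewrite -leNgt.
    by apply/andP; split; lra.
  by apply/andP; split; lra.
have cos2 : 2^-1 <= cos (x / 2) ^+ 2.
  have : 0 <= cos x by apply: cos_ge0_pihalf; have := pi_gt0 R; lra.
  rewrite {1}(_ : x = (x / 2) *+ 2); last by rewrite mulr2n; field.
  by rewrite cos_mulr2n mulr2n; lra.
rewrite [in leRHS](_ : x = (x / 2) *+ 2); last by rewrite mulr2n; field.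
rewrite sin_mulr2n e -[X in _ <= X]mulr_natl.
have uv := ler_wpM2l cosy cosc.
have : 2^-1 * (x / 2) <= cos (x / 2) * cos c * (x / 2).
  by apply: ler_wpM2r => //; lra.
lra.
Qed.

Lemma cabs_expi_sub1 (x : R) : cabs (expi x - 1) = 2 * `|sin (pi * x)|.
Proof.
apply: (@pexpIrn _ 2) => //; rewrite ?nnegrE ?cabs_ge0 ?mulr_ge0 //.
rewrite sqr_cabs exprMn real_normK ?num_real //.
rewrite /expi /cexp /= expR0 !mul1r !mul0r subr0 !addr0.
rewrite -mulrA mulr_natl cos_mulr2n sin_mulr2n -[cos _ ^+ 2 *+ 2]mulr_natl -[(_ * _) *+ 2]mulr_natl.
have := cos2Dsin2 (pi * x); set u := cos _; set v := sin _ => h.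
have -> : u ^+ 2 = 1 - v ^+ 2 by lra.
rewrite subr0 !exprMn.
have -> : u ^+ 2 = 1 - v ^+ 2 by lra.
by ring.
Qed.

Lemma chord_le (x : R) : cabs (expi x - 1) <= 2 * pi * `|x|.
Proof.
rewrite cabs_expi_sub1 -mulrA ler_wpM2l // (le_trans (sin_le_norm _)) //.
by rewrite normrM ger0_norm ?pi_ge0.
Qed.

(** The chord is at least half of its arc 2 pi |x|, because sin y >= y / 2 on
    [0, pi / 2]. *)
Lemma chord_ge (x : R) : `|x| <= 2^-1 -> pi * `|x| <= cabs (expi x - 1).
Proof.
move=> hx; rewrite cabs_expi_sub1.
have pi0 := pi_gt0 R.
have h : pi * `|x| / 2 <= sin (pi * `|x|).
  apply: sin_ge_half; rewrite mulr_ge0 ?pi_ge0 //=.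
  by have := ler_wpM2l (ltW pi0) hx; lra.
have : `|sin (pi * x)| = `|sin (pi * `|x|)|.
  by case: (ger0P x) => // _; rewrite mulrN sinN normrN.
move=> ->; have := ler_norm (sin (pi * `|x|)); lra.
Qed.

Lemma expR_sub1_bounds (s : R) : `|s| <= 1 ->
  expR (-1) * `|s| <= `|expR s - 1| <= expR 1 * `|s|.
Proof.
move=> hs; have [s0|s0] := ger0P s.
  have h1 := expR_ge1Dx s; have h2 := expR_ge1Dx (- s).
  have h3 : expR s * expR (- s) = 1 by rewrite expRxMexpNx_1.
  have h4 : expR s <= expR 1 by rewrite ler_expR; move: hs; rewrite ger0_norm.
  have h5 : expR (-1) <= 1 :> R by rewrite expR_le1; lra.
  have h6 := expR_gt0 s.
  rewrite ger0_norm; last by lra.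
  have k1 : 0 <= (1 - expR (-1)) * s by rewrite mulr_ge0 // subr_ge0.
  have k2 : 0 <= expR s * (expR (- s) - 1 + s) by rewrite mulr_ge0 ?expR_ge0 //; lra.
  have k3 : 0 <= (expR 1 - expR s) * s by rewrite mulr_ge0 // subr_ge0.
  by apply/andP; split; lra.
have h1 := expR_ge1Dx s; have h2 := expR_ge1Dx (- s).
have h3 : expR s * expR (- s) = 1 by rewrite expRxMexpNx_1.
have h4 : expR (-1) <= expR s by rewrite ler_expR; move: hs; rewrite ltr0_norm //; lra.
have h5 : 1 <= expR 1 :> R by have := expR_ge1Dx (1 : R); lra.
have h6 := expR_gt0 s.
have h7 : expR s <= 1 by rewrite expR_le1 ltW.
rewrite ler0_norm; last by lra.
have k1 : 0 <= (expR 1 - 1) * - s by rewrite mulr_ge0 ?subr_ge0 // oppr_ge0 ltW.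
have k2 : 0 <= expR s * (expR (- s) - 1 + s) by rewrite mulr_ge0 ?expR_ge0 //; lra.
have k3 : 0 <= (expR s - expR (-1)) * - s by rewrite mulr_ge0 ?subr_ge0 // oppr_ge0 ltW.
by apply/andP; split; lra.
Qed.

Lemma cexp_polar (s t : R) : cexp (s +i* t) = (expR s)%:C * expi (t / (2 * pi)).
Proof.
rewrite /expi /cexp /= expR0 mul1r (_ : 2 * pi * (t / (2 * pi)) = t) //.
by rewrite mulrC divfK // mulf_neq0 ?pnatr_eq0 // gt_eqF // pi_gt0.
Qed.

(** Separates the modulus and the argument of e^w in 1 - e^w. *)
Lemma cabs_1sub_polar (r : R) (u : C) : cabs u = 1 ->
  cabs (1 - r%:C * u) ^+ 2 = (r - 1) ^+ 2 + r * cabs (u - 1) ^+ 2.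
Proof.
move=> u1; have : cabs u ^+ 2 = 1 by rewrite u1 expr1n.
rewrite !sqr_cabs; case: u {u1} => x y /= h.
rewrite !mul0r !subr0 !addr0 sub0r !sqrrN exprMn.
by rewrite (_ : y ^+ 2 = 1 - x ^+ 2); [ring | lra].
Qed.

Lemma cexp_sub1_bounds (w : C) : `|Re w| <= 1 -> `|Im w| <= pi ->
  expR (-1) / 2 * cabs w <= cabs (1 - cexp w) <= expR 1 * cabs w.
Proof.
case: w => s t /= hs ht.
have pi0 := pi_gt0 R.
set u := expi (t / (2 * pi)).
have ew : cexp (s +i* t) = (expR s)%:C * u by exact: cexp_polar.
have tpi : `|t / (2 * pi)| = `|t| / (2 * pi).
  by rewrite normrM normfV (ger0_norm (_ : 0 <= 2 * pi)) // mulr_ge0 // ltW.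
have [u1 u2] : `|t| / 2 <= cabs (u - 1) /\ cabs (u - 1) <= `|t|.
  have c1 := @chord_ge (t / (2 * pi)); have c2 := chord_le (t / (2 * pi)).
  rewrite tpi in c1 c2; split.
    apply: le_trans (c1 _).
      by apply: le_of_eq; move: pi0; move: (@pi R) => P P0; field; rewrite gt_eqF.
    by rewrite ler_pdivrMr ?mulr_gt0 //; lra.
  apply: (le_trans c2).
  by apply: le_of_eq; move: pi0; move: (@pi R) => P P0; field; rewrite gt_eqF.
have key : cabs (1 - cexp (s +i* t)) ^+ 2 = (expR s - 1) ^+ 2 + expR s * cabs (u - 1) ^+ 2.
  by rewrite ew cabs_1sub_polar // cabs_expi.
have /andP[e1 e2] := expR_sub1_bounds hs.
have h6 := expR_gt0 s.
have c0 := expR_gt0 (-1 : R).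
have c1 : expR (-1) <= 1 :> R by rewrite expR_le1; lra.
have d1 : 1 <= expR 1 :> R by have := expR_ge1Dx (1 : R); lra.
have hs1 : expR (-1) <= expR s by rewrite ler_expR; move: hs; rewrite ler_norml => /andP[].
have hs2 : expR s <= expR 1 by rewrite ler_expR; move: hs; rewrite ler_norml => /andP[].
have sq (x y : R) : 0 <= x -> x <= y -> x ^+ 2 <= y ^+ 2 by move=> ? ?; rewrite lerXn2r ?nnegrE //; lra.
have es : `|expR s - 1| ^+ 2 = (expR s - 1) ^+ 2 by rewrite real_normK ?num_real.
have ss : `|s| ^+ 2 = s ^+ 2 by rewrite real_normK ?num_real.
have tt : `|t| ^+ 2 = t ^+ 2 by rewrite real_normK ?num_real.
have a1 := sq _ _ (mulr_ge0 (ltW c0) (normr_ge0 s)) e1.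
have a2 := sq _ _ (normr_ge0 _) e2.
have a3 : (`|t| / 2) ^+ 2 <= cabs (u - 1) ^+ 2 by apply: sq => //; rewrite divr_ge0.
have a4 : cabs (u - 1) ^+ 2 <= `|t| ^+ 2 by apply: sq => //; rewrite cabs_ge0.
rewrite exprMn ss es in a1; rewrite exprMn es ss in a2; rewrite tt in a4.
rewrite expr_div_n tt in a3.
have cw : cabs (s +i* t) ^+ 2 = s ^+ 2 + t ^+ 2 by rewrite sqr_cabs.
apply/andP; split.
  rewrite -(@ler_pXn2r _ 2) ?nnegrE ?cabs_ge0 ?mulr_ge0 ?invr_ge0 ?expR_ge0 ?cabs_ge0 //.
  rewrite key exprMn cw.
  have b1 : expR (-1) ^+ 2 * t ^+ 2 / 4 <= expR s * cabs (u - 1) ^+ 2.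
    apply: (@le_trans _ _ (expR (-1) * (t ^+ 2 / 2 ^+ 2))).
      have := sqr_ge0 t; nra.
    by apply: ler_pM => //; rewrite ?expR_ge0 // divr_ge0 // sqr_ge0.
  have b2 : 0 <= expR (-1) ^+ 2 * s ^+ 2 by rewrite mulr_ge0 ?sqr_ge0.
  rewrite expr_div_n; move: a1 b1 b2.
  move: (expR (-1) ^+ 2) (expR s * _) ((expR s - 1) ^+ 2) (s ^+ 2) (t ^+ 2) => x1 x2 x3 x4 x5.
  lra.
rewrite -(@ler_pXn2r _ 2) ?nnegrE ?cabs_ge0 //; last by rewrite mulr_ge0 ?cabs_ge0 // expR_ge0.
rewrite key exprMn cw mulrDr lerD //.
apply: ler_pM => //; rewrite ?expR_ge0 ?sqr_ge0 //.
rewrite (le_trans hs2) // expr2; nra.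
Qed.

End Circle.

(** * The zeros of the Zak transform of a Gaussian *)

Section Zak.
Variable R : realType.
Local Notation C := R[i].
Local Notation half := (2^-1 : R).

Lemma zsum_mul (z : C) (u : int -> C) (K : R) :
  (forall k, cabs (u k) <= K * geo R k) -> zsum (fun k => z * u k) = z * zsum u.
Proof.
move=> hu.
have hzu k : cabs (z * u k) <= cabs z * K * geo R k.
  by rewrite cabsM -mulrA ler_wpM2l ?cabs_ge0.
have hh : 0 <= half < 1 by lra.
apply: (cabs_le_of_exp_decay (c := 8 * (cabs z * K)) (d := cabs z * (8 * K)) hh hh) => n.
have h1 := zsum_approx hzu n; have h2 := zsum_approx hu n.
rewrite (_ : _ - _ = (zsum (fun k => z * u k) - \sum_(k <- zrange n) z * u k)
   + - (z * (zsum u - \sum_(k <- zrange n) u k))); last by rewrite -mulr_sumr; ring.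
apply: (le_trans (cabsD _ _)); rewrite cabsN cabsM lerD // -!mulrA ler_wpM2l ?cabs_ge0 //.
by rewrite mulrA.
Qed.

(** The exponent for which the k-th term of the Zak transform is
    g(t) e^{a k^2 + zeta k}. *)
Definition zak_zeta (a b : C) (q : R * R) : C :=
  - (2 * a * q.1%:C) - b + 'i * (2 * pi * q.2)%:C.

Lemma zak_term (a b c : C) (q : R * R) k :
  gauss a b c (q.1 - k%:~R) * expi (k%:~R * q.2) =
  gauss a b c q.1 * gterm a (zak_zeta a b q) k.
Proof.
rewrite /extended_gaussian expiE /gterm -!cexpD; congr cexp.
rewrite /zak_zeta !(rmorphB, rmorphM) /= !rmorph_int /=.
by ring.
Qed.

Lemma gterm_geo (a zeta : C) : Re a < 0 ->
  exists K, forall k, cabs (gterm a zeta k) <= K * geo R k.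
Proof.
move=> a0; have [K K0 hK] := gterm_dominated `|Re zeta| 0 a0.
exists K => k; apply: (le_trans (hK _ _ (lexx _))).
by rewrite oppr0 expR0 expr1n mulr1.
Qed.

Lemma zak_theta (a b c : C) (q : R * R) : Re a < 0 ->
  zak (gauss a b c) q = gauss a b c q.1 * theta a (zak_zeta a b q).
Proof.
move=> a0; have [K hK] := gterm_geo (zak_zeta a b q) a0.
rewrite /zak /theta -(zsum_mul _ hK); congr zsum; apply/funext => k; exact: zak_term.
Qed.

Lemma zak_term_geo (a b c : C) (q : R * R) : Re a < 0 ->
  exists K, forall k, cabs (gauss a b c (q.1 - k%:~R) * expi (k%:~R * q.2)) <= K * geo R k.
Proof.
move=> a0; have [K hK] := gterm_geo (zak_zeta a b q) a0.
exists (cabs (gauss a b c q.1) * K) => k.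
by rewrite zak_term cabsM -mulrA ler_wpM2l ?cabs_ge0.
Qed.

(** Quasi-periodicity: shifting t by 1 shifts the index of summation. *)
Lemma zak_shift1 (a b c : C) t w : Re a < 0 ->
  zak (gauss a b c) (t + 1, w) = expi w * zak (gauss a b c) (t, w).
Proof.
move=> a0; have [K hK] := zak_term_geo b c (t, w) a0.
have [K' hK'] := zak_term_geo b c (t + 1, w) a0.
rewrite /zak -(zsum_mul _ hK) -(zsum_shift hK') /=.
congr zsum; apply/funext => k; rewrite rmorphD /= mulrDl mul1r expiD.
by rewrite opprD addrACA [1 - _]subrr addr0; ring.
Qed.

Lemma cabs_zak_shift (a b c : C) t w (m : int) : Re a < 0 ->
  cabs (zak (gauss a b c) (t + m%:~R, w)) = cabs (zak (gauss a b c) (t, w)).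
Proof.
move=> a0.
have h s (n : nat) : cabs (zak (gauss a b c) (s + n%:R, w)) = cabs (zak (gauss a b c) (s, w)).
  elim: n => [|n IH]; first by rewrite addr0.
  by rewrite -natr1 addrA zak_shift1 // cabsM cabs_expi mul1r.
case: m => n; first exact: h.
by rewrite -(h _ n.+1) NegzE mulrNz subrK.
Qed.

Lemma zak_periodic (g : R -> C) t w (m : int) : zak g (t, w + m%:~R) = zak g (t, w).
Proof.
rewrite /zak; congr zsum; apply/funext => k /=.
by rewrite mulrDr expiD -intrM expi_int mulr1.
Qed.

(** With [zero_w], the coordinates of the point where zak_zeta + a = i pi,
    that is where the factor 1 + x of the triple product vanishes. *)
Definition zero_t (a b : C) : R := 2^-1 - Re b / (2 * Re a).
Definition zero_w (a b : C) : R :=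
  2^-1 + (2 * Im a * zero_t a b + Im b - Im a) / (2 * pi).

(** The exponent zak_zeta + a - i pi, written from the point
    (zero_t, zero_w) where it vanishes; then 1 + x = 1 - e^zak_dev. *)
Definition zak_dev (a b : C) (q : R * R) : C :=
  - (2 * a * (q.1 - zero_t a b)%:C) + 'i * (2 * pi * (q.2 - zero_w a b))%:C.

Lemma Re_zak_dev (a b : C) q : Re (zak_dev a b q) = - (2 * Re a * (q.1 - zero_t a b)).
Proof.
by rewrite /zak_dev -(rmorph_nat (real_complex R)) !(ReD, ReN, ReM, ImM) /=; ring.
Qed.

Lemma Im_zak_dev (a b : C) q : Im (zak_dev a b q) =
  - (2 * Im a * (q.1 - zero_t a b)) + 2 * pi * (q.2 - zero_w a b).
Proof.
by rewrite /zak_dev -(rmorph_nat (real_complex R)) !(ImD, ImN, ReM, ImM) /=; ring.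
Qed.

Lemma zak_zeta_dev (a b : C) q : Re a < 0 ->
  zak_zeta a b q + a = zak_dev a b q + 'i * pi%:C.
Proof.
move=> a0; have pi0 := pi_gt0 R.
apply: complex_eqP.
  rewrite [in RHS]ReD Re_zak_dev /zak_zeta -(rmorph_nat (real_complex R)) !(ReD, ReN, ReM, ImM) /= /zero_t.
  by field; rewrite lt_eqF.
rewrite [in RHS]ImD Im_zak_dev /zak_zeta -(rmorph_nat (real_complex R)) !(ImD, ImN, ReM, ImM) /= /zero_w.
by move: pi0; move: (@pi R) => P P0; field; rewrite gt_eqF.
Qed.

Lemma zak_bounds (a b c : C) : Re a < 0 ->
  exists L U : R, [/\ 0 < L, 0 < U & forall q, `|q.1 - zero_t a b| <= 2^-1 ->
    L * (cabs (gauss a b c q.1) * cabs (1 - cexp (zak_dev a b q)))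
    <= cabs (zak (gauss a b c) q)
    <= U * (cabs (gauss a b c q.1) * cabs (1 - cexp (zak_dev a b q)))].
Proof.
move=> a0; have [L [U [L0 U0 h]]] := theta_bounds a0.
exists L, U; split=> // q hq.
have e : cexp (zak_zeta a b q + a) = - cexp (zak_dev a b q).
  rewrite zak_zeta_dev // cexpD (_ : cexp ('i * pi%:C) = -1) ?mulrN1 //.
  rewrite /cexp ReM ImM /= !(mul0r, mul1r, mulr0, oppr0, addr0, add0r) expR0 cospi sinpi mul1r.
  by apply: complex_eqP => /=; rewrite ?oppr0.
have := h (zak_zeta a b q); rewrite e zak_theta // cabsM.
rewrite zak_zeta_dev // ReD Re_zak_dev ReM /= !(mul0r, mul1r, mulr0, oppr0, addr0).
move=> /(_ _)/andP[|h1 h2].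
  rewrite normrN !normrM ger0_norm // ltr0_norm //.
  by nra.
by rewrite !(mulrCA _ (cabs (gauss a b c _))) !ler_wpM2l ?cabs_ge0.
Qed.

Lemma frac_eq (x y : R) (k : int) : 0 <= x < 1 -> 0 <= y < 1 -> x - y = k%:~R -> x = y.
Proof.
move=> /andP[x0 x1] /andP[y0 y1] e.
have h1 : (k < 1)%R by rewrite -(ltr_int R) -e; lra.
have h2 : (-1 < k)%R by rewrite -(ltr_int R) -e; lra.
have k0 : k = 0 by lia.
by move: e; rewrite k0 => /eqP; rewrite subr_eq0 => /eqP.
Qed.

(** Reduction of (zero_t, zero_w) modulo the periods of the modulus of Zg. *)
Definition zak_zero (a b : C) : R * R :=
  (zero_t a b - (Num.floor (zero_t a b))%:~R, zero_w a b - (Num.floor (zero_w a b))%:~R).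

Lemma frac01 (x : R) : 0 <= x - (Num.floor x)%:~R < 1.
Proof. by rewrite subr_ge0 floor_le /= ltrBlDl -[1]/(1%:~R) -intrD floorD1_gt. Qed.

Lemma cabs_zak_zero_shift (a b c : C) (dt dw : R) : Re a < 0 ->
  cabs (zak (gauss a b c) ((zak_zero a b).1 + dt, (zak_zero a b).2 + dw)) =
  cabs (zak (gauss a b c) (zero_t a b + dt, zero_w a b + dw)).
Proof.
move=> a0; rewrite -(cabs_zak_shift b c _ _ (Num.floor (zero_t a b)) a0) -(zak_periodic _ _ _ (Num.floor (zero_w a b))).
have e (x f d : R) : x - f + d + f = x + d by ring.
by rewrite /zak_zero /= !e.
Qed.

Lemma zak_zeroP (a b c : C) : Re a < 0 -> zak (gauss a b c) (zak_zero a b) = 0.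
Proof.
move=> a0; apply/eqP; rewrite -cabs_eq0.
have := cabs_zak_zero_shift b c 0 0 a0; rewrite !addr0 -surjective_pairing => ->.
have [L [U [L0 U0 h]]] := zak_bounds b c a0.
have := h (zero_t a b, zero_w a b); rewrite /= subrr normr0 => /(_ _)/andP[//|_].
rewrite (_ : zak_dev _ _ _ = 0); last first.
  by apply: complex_eqP; rewrite ?Re_zak_dev ?Im_zak_dev /= !subrr !mulr0 ?oppr0 ?addr0.
by rewrite cexp0 subrr cabs0 !mulr0 => h1; rewrite eq_le h1 cabs_ge0.
Qed.

Lemma cexp_eq1 (w : C) : cexp w = 1 -> Re w = 0 /\ exists k : int, Im w = 2 * pi * k%:~R.
Proof.
move=> h.
have h1 : Re w = 0.
  have := cabs_cexp w; rewrite h cabs1 => /esym/eqP; rewrite -[X in _ == X]expR0.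
  by move=> /eqP/expR_inj.
split=> //.
have pi0 := pi_gt0 R.
have [|k hk] := @expi_eq1 R (Im w / (2 * pi)).
  rewrite -[RHS]h; congr cexp; apply: complex_eqP; rewrite /= ?h1 //.
  by move: pi0; move: (@pi R) => P P0; field; rewrite gt_eqF.
by exists k; rewrite -hk; move: pi0; move: (@pi R) => P P0; field; rewrite gt_eqF.
Qed.

(** After an integer shift of t into the band where [zak_bounds] applies, a
    zero is a solution of e^zak_dev = 1: the real part of zak_dev determines t
    and its imaginary part determines w modulo 1. *)
Lemma zak_zero_unique (a b c : C) (q : R * R) : Re a < 0 ->
  unit_square q -> zak (gauss a b c) q = 0 -> q = zak_zero a b.
Proof.
move=> a0; case: q => t w [/= ht hw] hz; have pi0 := pi_gt0 R.
have [L [U [L0 U0 h]]] := zak_bounds b c a0.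
(* t - m is the translate of t within 1/2 of zero_t. *)
pose m := Num.floor (t - zero_t a b + 2^-1).
have hm : `|t - m%:~R - zero_t a b| <= 2^-1.
  have := frac01 (t - zero_t a b + 2^-1); rewrite -/m ler_norml => /andP[? ?].
  by apply/andP; split; lra.
have := h (t - m%:~R, w) hm => /andP[+ _].
have -> : cabs (zak (gauss a b c) (t - m%:~R, w)) = 0.
  by rewrite -mulrNz cabs_zak_shift // hz cabs0.
rewrite pmulr_rle0 // cabs_cexp pmulr_rle0 ?expR_gt0 // => h0.
have {h0} /eqP : cabs (1 - cexp (zak_dev a b (t - m%:~R, w))) == 0 by rewrite eq_le h0 cabs_ge0.
move/eqP; rewrite cabs_eq0 subr_eq0 => /eqP/esym/cexp_eq1[].
rewrite Re_zak_dev /= => /eqP; rewrite oppr_eq0 mulf_eq0 mulf_eq0 pnatr_eq0 /= lt_eqF //=.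
rewrite subr_eq0 => /eqP et [k]; rewrite Im_zak_dev /= et subrr mulr0 oppr0 add0r => ew.
have {}ew : w - zero_w a b = k%:~R.
  by apply: (mulfI (lt0r_neq0 (mulr_gt0 (ltr0n _ 2) pi0))).
congr pair.
  apply: (@frac_eq _ _ (m + Num.floor (zero_t a b))) => //; first exact: frac01.
  by rewrite intrD -et; ring.
apply: (@frac_eq _ _ (k + Num.floor (zero_w a b))) => //; first exact: frac01.
by rewrite intrD -ew; ring.
Qed.

End Zak.

(** * Continuity of the Zak transform and simplicity of its zero *)

Section ZakZero.
Variable R : realType.
Local Notation C := R[i].
Local Notation half := (2^-1 : R).

Lemma cabs_gaussian (a b c : C) (x : R) : cabs (gauss a b c x) =
  expR (Re a * x ^+ 2 + Re b * x + Re c).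
Proof.
rewrite cabs_cexp; congr expR; rewrite 2!ReD -rmorphXn !ReM /=.
by rewrite !mulr0 !subr0.
Qed.

Lemma gaussian_bounded (a b c : C) : Re a < 0 ->
  exists2 G, 0 < G & forall x, cabs (gauss a b c x) <= G.
Proof.
move=> a0; exists (expR (Re b ^+ 2 / (4 * - Re a)) * expR (Re c)).
  by rewrite mulr_gt0 ?expR_gt0.
move=> x; rewrite cabs_gaussian expRD ler_wpM2r ?expR_ge0 //.
by rewrite -{1}[Re a]opprK expR_quadratic_le // oppr_gt0.
Qed.

Lemma continuous_zak_term (a b c : C) (k : int) :
  continuous ((fun q : R * R => gauss a b c (q.1 - k%:~R) * expi (k%:~R * q.2)) : R * R -> C^o).
Proof.
move=> q.
pose X (q : R * R) : R := q.1 - k%:~R.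
have cX : {for q, continuous X} by apply: cvgB; [exact: cvg_fst | exact: cvg_cst].
pose E (q : R * R) : R := Re a * (X q * X q) + Re b * X q + Re c.
pose H (q : R * R) : R := Im a * (X q * X q) + Im b * X q + Im c + 2 * pi * (k%:~R * q.2).
have cP (u v : R) : {for q, continuous (fun q => u * (X q * X q) + v * X q)}.
  apply: cvgD; last by apply: cvgMr.
  by apply: cvgMr; apply: cvgM.
have cE : {for q, continuous E} by apply: cvgD; [exact: cP | exact: cvg_cst].
have cH : {for q, continuous H}.
  apply: cvgD; first by apply: cvgD; [exact: cP | exact: cvg_cst].
  by apply: cvgMr; apply: cvgMr; exact: cvg_snd.
have e q' : gauss a b c (q'.1 - k%:~R) * expi (k%:~R * q'.2) = cexp (E q' +i* H q').
  rewrite /extended_gaussian expiE -cexpD; congr cexp.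
  rewrite /E /H -/(X q') -rmorphXn; move: (X q') => x.
  by apply: complex_eqP; rewrite !(ReD, ImD, ReM, ImM) /=; ring.
rewrite (_ : (fun q => _) = (fun q => cexp (E q +i* H q))); last exact/funext.
apply: cvg_complex.
  rewrite (_ : (fun q => _) = (fun q => expR (E q) * cos (H q))).
    rewrite (_ : Re _ = expR (E q) * cos (H q)).
      apply: cvgM; first by apply: continuous_comp => //; exact: continuous_expR.
      by apply: continuous_comp => //; exact: continuous_cos.
    by rewrite /cexp ReM /= mul0r subr0.
  by apply/funext => z; rewrite /cexp ReM /= mul0r subr0.
rewrite (_ : (fun q => _) = (fun q => expR (E q) * sin (H q))).
  rewrite (_ : Im _ = expR (E q) * sin (H q)).
    apply: cvgM; first by apply: continuous_comp => //; exact: continuous_expR.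
    by apply: continuous_comp => //; exact: continuous_sin.
  by rewrite /cexp ImM /= mul0r addr0.
by apply/funext => z; rewrite /cexp ImM /= mul0r addr0.
Qed.

(** Uniform convergence: the terms with |t' - t| <= 1 have a common geometric
    majorant. *)
Lemma continuous_zak (a b c : C) : Re a < 0 ->
  continuous (zak (gauss a b c) : R * R -> C^o).
Proof.
move=> a0 q; apply: cvg_cabs => e e0.
have [G G0 hG] := gaussian_bounded b c a0.
have [K K0 hK] := gterm_dominated (`|Re (zak_zeta a b q)| + 2 * `|Re a|) 0 a0.
pose u (q : R * R) k := gauss a b c (q.1 - k%:~R) * expi (k%:~R * q.2).
have hu q' : `|q'.1 - q.1| <= 1 -> forall k, cabs (u q' k) <= G * K * geo R k.
  move=> hq k; rewrite /u zak_term cabsM -mulrA ler_pM ?cabs_ge0 //.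
  have := hK (zak_zeta a b q') k; rewrite oppr0 expR0 expr1n mulr1; apply.
  rewrite (_ : Re (zak_zeta a b q') = Re (zak_zeta a b q) + - (2 * Re a * (q'.1 - q.1))).
    apply: (le_trans (ler_normD _ _)); rewrite lerD2l normrN 2!normrM (ger0_norm (_ : 0 <= 2)) // ler_piMr // mulr_ge0 //.
  by rewrite /zak_zeta -(rmorph_nat (real_complex R)) !(ReD, ReN, ReM, ImM) /=; ring.
have [N hN] : exists N, 16 * (G * K) * half ^+ N <= e / 2.
  have : (16 * (G * K)) * half ^+ n @[n --> \oo] --> 16 * (G * K) * 0.
    by apply: cvgMr; apply: cvg_expr; rewrite ger0_norm ?invr_ge0; lra.
  rewrite mulr0 => /cvgrPdist_le/(_ (e / 2)); rewrite divr_gt0 // => /(_ isT)[N _ /(_ N (leqnn N))].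
  by rewrite sub0r normrN => h; exists N; exact: le_trans (ler_norm _) h.
have cS (s : seq int) (d : R) : 0 < d ->
    \forall q' \near q, cabs (\sum_(k <- s) u q' k - \sum_(k <- s) u q k) <= d.
  elim: s d => [|k s IH] d d0.
    by apply: (nearW (nbhs_filter q)) => q'; rewrite !big_nil subrr cabs0 ltW.
  have d20 : 0 < d / 2 by rewrite divr_gt0.
  have h := @cvg_cabsP R (R * R)%type (nbhs q) (nbhs_filter q) _ _ (@continuous_zak_term a b c k q) _ d20.
  apply: (filterS2 (nbhs_filter q) _ h (IH _ d20)) => q' h1 h2.
  rewrite !big_cons opprD addrACA (le_trans (cabsD _ _)) // [leRHS]splitr.
  exact: lerD h1 h2.
have e20 : 0 < e / 2 by rewrite divr_gt0.
have cS' := cS (zrange N) _ e20.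
have n1 : \forall q' \near q, `|q'.1 - q.1| <= 1.
  have : (fun q' : R * R => q'.1) @ q --> q.1 by exact: cvg_fst.
  move=> /cvgrPdist_le/(_ 1 ltr01); apply: filterS => q'.
  by rewrite distrC.
apply: (filterS2 (nbhs_filter q) _ cS' n1) => q' h1 hq.
have z1 := zsum_approx (hu q' hq) N.
have hqq : `|q.1 - q.1| <= 1 by rewrite subrr normr0.
have z2 := zsum_approx (hu q hqq) N.
rewrite -!/(zak (gauss a b c) _) in z1 z2.
rewrite (_ : _ - _ = (zak (gauss a b c) q' - \sum_(k <- zrange N) u q' k) +
  ((\sum_(k <- zrange N) u q' k - \sum_(k <- zrange N) u q k)
   + - (zak (gauss a b c) q - \sum_(k <- zrange N) u q k))); last by ring.
apply: (le_trans (cabsD _ _)).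
have := cabsD (\sum_(k <- zrange N) u q' k - \sum_(k <- zrange N) u q k)
   (- (zak (gauss a b c) q - \sum_(k <- zrange N) u q k)).
rewrite cabsN; lra.
Qed.

(** zak_dev is an invertible real-linear map of (dt, dw): its real part only
    depends on dt, which makes the inverse explicit. *)
Lemma zak_dev_bounds (a b : C) (dt dw : R) : Re a < 0 ->
  let w := zak_dev a b (zero_t a b + dt, zero_w a b + dw) in
  let n := Num.sqrt (dt ^+ 2 + dw ^+ 2) in
  let A := - Re a in
  n <= ((2 * A)^-1 + (1 + `|Im a| / A) / (2 * pi)) * cabs w /\
  cabs w <= (2 * A + 2 * `|Im a| + 2 * pi) * n.
Proof.
move=> a0 w n A.
have A0 : 0 < A by rewrite oppr_gt0.
have pi0 := pi_gt0 R.
have ew1 : Re w = 2 * A * dt by rewrite Re_zak_dev /= /A; ring.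
have ew2 : Im w = - (2 * Im a * dt) + 2 * pi * dw.
  rewrite Im_zak_dev /=; congr (- (_ * _) + _ * _).
    by move: (zero_t a b) => z; ring.
  by move: (zero_w a b) => z; ring.
have r1 := Re_le_cabs w; have r2 := Im_le_cabs w; have r3 := cabs_le_ReIm w.
rewrite ew1 normrM (ger0_norm (_ : 0 <= 2 * A)) in r1 r3; last by lra.
have n1 : `|dt| <= n by have := Re_le_cabs (dt +i* dw); rewrite cabsE.
have n2 : `|dw| <= n by have := Im_le_cabs (dt +i* dw); rewrite cabsE.
have n3 : n <= `|dt| + `|dw| by have := cabs_le_ReIm (dt +i* dw); rewrite cabsE.
have h1 : `|dt| <= (2 * A)^-1 * cabs w by rewrite mulrC ler_pdivlMr 1?mulrC; lra.
have h2 : `|dw| <= (1 + `|Im a| / A) / (2 * pi) * cabs w.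
  rewrite mulrAC ler_pdivlMr ?mulr_gt0 // mulrC.
  have e : 2 * pi * dw = Im w + 2 * Im a * dt by rewrite ew2; ring.
  have -> : 2 * pi * `|dw| = `|2 * pi * dw| by rewrite normrM (ger0_norm (_ : 0 <= 2 * pi)) // mulr_ge0 // ltW.
  rewrite e; apply: (le_trans (ler_normD _ _)); rewrite [leRHS]mulrDl mul1r lerD //.
  have := ler_wpM2l (normr_ge0 (Im a)) h1.
  by rewrite 2!normrM (ger0_norm (_ : 0 <= 2)) // invfM; lra.
split; first by rewrite [leRHS]mulrDl; lra.
apply: (le_trans r3).
have r4 : `|Im w| <= 2 * `|Im a| * `|dt| + 2 * pi * `|dw|.
  rewrite ew2; apply: (le_trans (ler_normD _ _)); rewrite normrN !normrM.
  by rewrite (ger0_norm (_ : 0 <= 2)) // (ger0_norm (ltW pi0)).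
have s1 := ler_wpM2l (ltW A0) n1; have s2 := ler_wpM2l (ltW pi0) n2.
have s3 := ler_wpM2l (normr_ge0 (Im a)) n1.
lra.
Qed.

(** Near the zero Zg is comparable with 1 - e^zak_dev, hence with zak_dev,
    hence with the distance to the zero. *)
Lemma zak_simple_zero (a b c : C) : Re a < 0 ->
  simple_zero (zak (gauss a b c)) (zak_zero a b).
Proof.
move=> a0; split; first exact: zak_zeroP.
set A := - Re a; have A0 : 0 < A by rewrite oppr_gt0.
have pi0 := pi_gt0 R; have pi2 := pi_ge2 R.
have [L [U [L0 U0 hLU]]] := zak_bounds b c a0.
have [G2 G20 hG2] := gaussian_bounded b c a0.
pose T := `|zero_t a b| + 1.
pose G1 := expR (- (A * T ^+ 2 + `|Re b| * T + `|Re c|)).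
have hG1 dt : `|dt| <= 1 -> G1 <= cabs (gauss a b c (zero_t a b + dt)).
  move=> hdt; rewrite cabs_gaussian ler_expR.
  set x := zero_t a b + dt.
  have hx : `|x| <= T by apply: (le_trans (ler_normD _ _)); rewrite lerD2l.
  have T0 : 0 <= T by rewrite addr_ge0.
  have h1 : x ^+ 2 <= T ^+ 2 by rewrite -[x ^+ 2]real_normK ?num_real // lerXn2r // nnegrE.
  have h2 := ler_wpM2l (ltW A0) h1.
  have h3 : - (Re b * x) <= `|Re b| * T.
    by apply: (le_trans (ler_norm _)); rewrite normrN normrM ler_wpM2l.
  have h4 : - Re c <= `|Re c| by rewrite -normrN ler_norm.
  rewrite (_ : Re a = - A); last by rewrite opprK.
  move: h2 h3 h4; move: (x ^+ 2) (T ^+ 2) => X2 T2; lra.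
pose D := 4 + 2 * A + 2 * `|Im a|.
have D0 : 0 < D by rewrite /D ltr_wpDr ?mulr_ge0 // addr_gt0 // mulr_gt0.
(* A radius for which |Re w| <= 1, |Im w| <= pi and |dt| <= 1/2 all hold. *)
pose r := D^-1.
have r0 : 0 < r by rewrite invr_gt0.
pose M := (2 * A)^-1 + (1 + `|Im a| / A) / (2 * pi).
have M0 : 0 < M.
  apply: addr_gt0; first by rewrite invr_gt0 mulr_gt0.
  apply: divr_gt0; last by rewrite mulr_gt0.
  by apply: ltr_wpDr => //; rewrite divr_ge0 // ltW.
pose N := 2 * A + 2 * `|Im a| + 2 * pi.
exists [set q | `|q.1 - (zak_zero a b).1| <= r /\ `|q.2 - (zak_zero a b).2| <= r].
exists (L * (G1 * (expR (-1) / 2 / M))), (U * (G2 * (expR 1 * N))).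
split.
- have h1 : \forall q' \near (zak_zero a b), `|q'.1 - (zak_zero a b).1| <= r.
    have : (fun q' : R * R => q'.1) @ zak_zero a b --> (zak_zero a b).1 by exact: cvg_fst.
    by move=> /cvgrPdist_le/(_ r r0); apply: filterS => q'; rewrite distrC.
  have h2 : \forall q' \near (zak_zero a b), `|q'.2 - (zak_zero a b).2| <= r.
    have : (fun q' : R * R => q'.2) @ zak_zero a b --> (zak_zero a b).2 by exact: cvg_snd.
    by move=> /cvgrPdist_le/(_ r r0); apply: filterS => q'; rewrite distrC.
  by apply: (filterS2 (nbhs_filter _) _ h1 h2).
- exact/continuous_subspaceT/continuous_zak.
- by rewrite !mulr_gt0 ?invr_gt0 ?expR_gt0.
move=> q [hq1 hq2] qp.
set dt := q.1 - (zak_zero a b).1 in hq1 *.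
set dw := q.2 - (zak_zero a b).2 in hq2 *.
have -> : cabs (zak (gauss a b c) q) =
          cabs (zak (gauss a b c) (zero_t a b + dt, zero_w a b + dw)).
  rewrite -cabs_zak_zero_shift // /dt /dw; congr (cabs (zak _ _)).
  by rewrite addrC subrK addrC subrK -surjective_pairing.
set n := Num.sqrt _.
have n0 : 0 < n.
  rewrite sqrtr_gt0 lt_neqAle addr_ge0 ?sqr_ge0 // andbT eq_sym paddr_eq0 ?sqr_ge0 //.
  rewrite !sqrf_eq0 !subr_eq0; apply: contraNN qp => /andP[/eqP e1 /eqP e2].
  by rewrite [q]surjective_pairing e1 e2 -surjective_pairing.
rewrite ler_pdivlMr // ler_pdivrMr //.
set w := zak_dev a b (zero_t a b + dt, zero_w a b + dw).
have [w1 w2] : n <= M * cabs w /\ cabs w <= N * n by exact: zak_dev_bounds.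
have rD : r * D = 1 by rewrite /r mulVf // gt_eqF.
have rA : 0 <= r * A by rewrite mulr_ge0 ?ltW.
have rI : 0 <= r * `|Im a| by rewrite mulr_ge0 // ltW.
have rDe : 4 * r + 2 * (r * A) + 2 * (r * `|Im a|) = 1.
  have h (x y z : R) : 4 * x + 2 * (x * y) + 2 * (x * z) = x * (4 + 2 * y + 2 * z) by ring.
  by rewrite h.
have c1 : `|Re w| <= 1.
  rewrite Re_zak_dev /= (_ : _ - _ = dt); last by move: (zero_t a b) => z; ring.
  rewrite normrN !normrM (ger0_norm (_ : 0 <= 2)) // ltr0_norm // -/A.
  have := ler_wpM2l (ltW A0) hq1; lra.
have c2 : `|Im w| <= pi.
  rewrite Im_zak_dev /= (_ : zero_t a b + dt - _ = dt); last by move: (zero_t a b) => z; ring.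
  rewrite (_ : zero_w a b + dw - _ = dw); last by move: (zero_w a b) => z; ring.
  apply: (le_trans (ler_normD _ _)); rewrite normrN !normrM (ger0_norm (_ : 0 <= 2)) // (ger0_norm (ltW pi0)).
  have := ler_wpM2l (normr_ge0 (Im a)) hq1; have := ler_wpM2l (ltW pi0) hq2.
  have h4 : 4 * r <= 1 by lra.
  have := ler_wpM2l (ltW pi0) h4.
  lra.
have /andP[b1 b2] := cexp_sub1_bounds c1 c2.
have hdt : `|dt| <= 1 by lra.
have /= := hLU (zero_t a b + dt, zero_w a b + dw); rewrite -/w.
rewrite (_ : zero_t a b + dt - _ = dt); last by move: (zero_t a b) => z; ring.
move=> /(_ _)/andP[|f1 f2]; first by lra.
apply/andP; split.
  apply: le_trans f1; rewrite -(mulrA L); apply: ler_wpM2l; first exact: ltW.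
  rewrite -(mulrA G1).
  apply: ler_pM; rewrite ?expR_ge0 ?hG1 //.
    by rewrite mulr_ge0 ?divr_ge0 ?expR_ge0 // ltW.
  apply: le_trans b1; rewrite -(mulrA (expR (-1) / 2)) ler_wpM2l ?divr_ge0 ?expR_ge0 //.
  by rewrite mulrC ler_pdivrMr // mulrC.
apply: (le_trans f2); rewrite -(mulrA U); apply: ler_wpM2l; first exact: ltW.
rewrite -(mulrA G2).
apply: ler_pM; rewrite ?cabs_ge0 ?hG2 //.
by apply: (le_trans b2); rewrite -(mulrA (expR 1)) ler_wpM2l ?expR_ge0.
Qed.

Lemma zak_zero_b0 (a : C) : zak_zero a 0 = (2^-1, 2^-1).
Proof.
have f : Num.floor (2^-1 : R) = 0.
  by apply/eqP; rewrite floor_eq /=; apply/andP; split; lra.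
have pi0 := pi_gt0 R.
rewrite /zak_zero (_ : zero_w a 0 = 2^-1) /zero_w /zero_t /=.
  by rewrite mul0r subr0 f !subr0.
rewrite mul0r subr0 addr0 mulrAC mulfV ?pnatr_eq0 // mul1r subrr mul0r addr0 //.
Qed.

End ZakZero.

(** * The dual polynomial and its coefficients *)

Section Sampling.
Variable R : realType.
Local Notation C := R[i].

(** The zeros are the p^s with 0 < |s| <= n, whereas the value at 1 is
    qpoch p n ^+ 2, which stays away from 0.  The factors have the form
    c0 + c1 X expected by [coef_norm_linear]. *)
Definition dual_poly (p : C) n : {poly C} :=
  \prod_(j < n) ((1%:P + (- p ^+ j.+1) *: 'X) * ((- p ^+ j.+1)%:P + 1 *: 'X)).

Lemma horner_dual_poly p n x :
  (dual_poly p n).[x] = \prod_(j < n) ((1 - p ^+ j.+1 * x) * (x - p ^+ j.+1)).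
Proof.
rewrite /dual_poly horner_prod; apply: eq_bigr => j _.
by rewrite hornerM !hornerD !hornerZ !hornerC !hornerX mul1r mulNr [- _ + x]addrC.
Qed.

Lemma size_linear_le (c0 c1 : C) : (size (c0%:P + c1 *: 'X)%R <= 2)%N.
Proof.
rewrite (leq_trans (size_polyD _ _)) // geq_max (leq_trans (size_polyC_leq1 _)) //=.
by rewrite (leq_trans (size_scale_leq _ _)) // size_polyX.
Qed.

Lemma size_dual_poly p n : (size (dual_poly p n) <= n.*2.+1)%N.
Proof.
elim: n => [|n IH]; first by rewrite /dual_poly big_ord0 size_poly1.
rewrite /dual_poly big_ord_recr /= -/(dual_poly p n).
have h (P Q : {poly C}) m k : (size P <= m.+1 -> size Q <= k.+1 -> size (P * Q)%R <= (m + k).+1)%N.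
  by move=> hP hQ; apply: (leq_trans (size_polyMleq _ _)); lia.
have h2 := h _ _ _ _ (size_linear_le 1 (- p ^+ n.+1)) (size_linear_le (- p ^+ n.+1) 1).
by have := h _ _ _ _ IH h2; rewrite doubleS addn2.
Qed.

(** The sum of |coefficients| r^i is submultiplicative; here for a linear
    factor. *)
Lemma coef_norm_linear (c0 c1 : C) (P : {poly C}) (r B : R) : 0 <= r ->
  (forall m, \sum_(i < m) cabs P`_i * r ^+ i <= B) ->
  forall m, \sum_(i < m) cabs ((c0%:P + c1 *: 'X) * P)`_i * r ^+ i
    <= (cabs c0 + cabs c1 * r) * B.
Proof.
move=> r0 hB m.
have B0 : 0 <= B by have := hB 0%N; rewrite big_ord0.
case: m => [|m].
  by rewrite big_ord0 mulr_ge0 // addr_ge0 ?mulr_ge0 ?cabs_ge0.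
apply: (@le_trans _ _ (\sum_(i < m.+1) cabs c0 * (cabs P`_i * r ^+ i)
    + \sum_(i < m.+1) (if i == 0%N :> nat then 0 else cabs c1 * r * (cabs P`_i.-1 * r ^+ i.-1)))).
  rewrite -big_split /=; apply: ler_sum => i _.
  rewrite mulrDl coefD coefCM -scalerAl coefZ coefXM.
  case: (i : nat) => [|k] /=.
    by rewrite mulr0 addr0 cabsM mulrA addr0.
  apply: (le_trans (ler_wpM2r _ (cabsD _ _))); first exact: exprn_ge0.
  by rewrite !cabsM mulrDl exprS; apply: le_of_eq; ring.
rewrite mulrDl; apply: lerD.
  by rewrite -mulr_sumr ler_wpM2l ?cabs_ge0.
rewrite big_ord_recl /= add0r.
under eq_bigr => i _ do rewrite /bump /= ?add1n /=.
rewrite -mulr_sumr; apply: ler_wpM2l; first by rewrite mulr_ge0 ?cabs_ge0.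
exact: hB.
Qed.

Lemma dual_poly_coef_norm (p : C) n (r : R) : 0 <= r -> forall i,
  cabs (dual_poly p n)`_i * r ^+ i <=
  \prod_(j < n) ((1 + cabs p ^+ j.+1 * r) * (cabs p ^+ j.+1 + r)).
Proof.
move=> r0 i.
suff h m : \sum_(i < m) cabs (dual_poly p n)`_i * r ^+ i <=
    \prod_(j < n) ((1 + cabs p ^+ j.+1 * r) * (cabs p ^+ j.+1 + r)).
  have := h i.+1; rewrite big_ord_recr /=; apply: le_trans; rewrite lerDr.
  by apply: sumr_ge0 => k _; rewrite mulr_ge0 ?cabs_ge0 ?exprn_ge0.
elim: n m => [|n IH] m.
  rewrite /dual_poly !big_ord0.
  case: m => [|m]; first by rewrite big_ord0.
  rewrite big_ord_recl /= coef1 /= cabs1 mulr1 big1 ?addr0 // => k _.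
  by rewrite coef1 /= cabs0 mul0r.
rewrite /dual_poly big_ord_recr /= -/(dual_poly p n) mulrC -mulrA.
have e1 := coef_norm_linear (- p ^+ n.+1) 1 r0 IH.
have e2 := coef_norm_linear 1 (- p ^+ n.+1) r0 e1.
apply: (le_trans (e2 m)).
rewrite cabsN cabsX cabs1 mul1r [leRHS]big_ord_recr /=; apply: le_of_eq; ring.
Qed.

(** Increasing k by one drops a last factor and adds a first one,
    1 + rho^(-k) <= 2 rho^(-k). *)
Lemma shifted_prod_le (rho : R) k n : 0 < rho -> rho <= 1 ->
  \prod_(j < n) (1 + rho ^+ j.+1 / rho ^+ k) <=
  2 ^+ k / rho ^+ 'C(k, 2) * \prod_(j < n) (1 + rho ^+ j.+1).
Proof.
move=> r0 r1.
have pos m j : 0 < rho ^+ m / rho ^+ j by rewrite divr_gt0 // exprn_gt0.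
have pos1 m j : 0 <= 1 + rho ^+ m / rho ^+ j by rewrite addr_ge0 // ltW.
elim: k => [|k IH].
  rewrite bin0n !expr0 divr1 mul1r; apply: le_of_eq.
  by apply: eq_bigr => j _; rewrite divr1.
apply: (@le_trans _ _ (2 / rho ^+ k * \prod_(j < n) (1 + rho ^+ j.+1 / rho ^+ k))); last first.
  rewrite exprS binS bin1 exprD.
  apply: (le_trans (ler_wpM2l _ IH)); first by rewrite divr_ge0 // exprn_ge0 // ltW.
  by rewrite mulrA invfM; apply: le_of_eq; ring.
have hk : 1 <= rho ^- k by rewrite invf_ge1 ?exprn_gt0 // exprn_ile1 // ltW.
have P0 m : 0 <= \prod_(j < m) (1 + rho ^+ j.+1 / rho ^+ k) by apply: prodr_ge0 => j _.
case: n {IH} => [|n]; first by rewrite !big_ord0 mulr1; lra.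
rewrite big_ord_recl /=.
have -> : \prod_(i < n) (1 + rho ^+ (bump 0 i).+1 / rho ^+ k.+1) = \prod_(i < n) (1 + rho ^+ i.+1 / rho ^+ k).
  by apply: eq_bigr => i _; rewrite /bump /= add1n exprS [in X in _ / X]exprS -mulf_div divff ?mul1r // gt_eqF.
rewrite big_ord_recr /= [X in 1 + X](_ : _ = rho ^- k); last first.
  by rewrite expr1 exprS invfM mulrA divff ?mul1r // gt_eqF.
have := P0 n; set P := \prod_(i < n) _ => hP.
have h1 : 1 + rho ^- k <= 2 / rho ^+ k by lra.
have h2 : 0 <= 2 / rho ^+ k by lra.
apply: (le_trans (ler_wpM2r hP h1)).
by rewrite ler_wpM2l // ler_peMr // lerDl ltW.
Qed.

Lemma subz_absz_le i n : (i <= n)%N -> n = (i + `|i%:Z - n%:Z|)%N.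
Proof. by lia. Qed.

Lemma subz_absz_gt i n : (n < i)%N -> i = (n + `|i%:Z - n%:Z|)%N.
Proof. by lia. Qed.

(** A bound on the weighted sum of the coefficients bounds each of them, for
    every weight r.  At distance k from the middle degree the best choice is
    r = rho^k or r = rho^(-k), according to the side. *)
Lemma dual_poly_coef_bound (p : C) n i : p != 0 -> cabs p < 1 -> (i <= n.*2)%N ->
  cabs (dual_poly p n)`_i <=
   expR (cabs p / (1 - cabs p)) ^+ 2 * 2 ^+ `|i%:Z - n%:Z| * cabs p ^+ (`|i%:Z - n%:Z| ^ 2) / cabs p ^+ 'C(`|i%:Z - n%:Z|, 2).
Proof.
move=> pn0 p1 ile; set rho := cabs p in p1 *.
have r0 : 0 < rho by rewrite cabs_gt0.
have r0' := ltW r0; have r1' := ltW p1.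
set k := `|_|%N; set E := expR _.
have hE : \prod_(j < n) (1 + rho ^+ j.+1) <= E.
  have := @prod_1add_upper R rho rho n r0'; rewrite r0' p1 => /(_ isT).
  by under eq_bigr do rewrite -exprS.
have hE2 : \prod_(j < n) (1 + rho ^+ j.+1 * rho ^+ k) <= E.
  apply: le_trans hE; apply: ler_prod => j _; rewrite addr_ge0 ?mulr_ge0 ?exprn_ge0 //=.
  by rewrite lerD2l ler_piMr ?exprn_ge0 // exprn_ile1.
have hE3 := shifted_prod_le k n r0 r1'.
have prod0 : 0 <= \prod_(j < n) (1 + rho ^+ j.+1 * rho ^+ k).
  by apply: prodr_ge0 => j _; rewrite addr_ge0 // mulr_ge0 // exprn_ge0.
have prod0' : 0 <= \prod_(j < n) (1 + rho ^+ j.+1 / rho ^+ k).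
  by apply: prodr_ge0 => j _; rewrite addr_ge0 // divr_ge0 // exprn_ge0.
have E0 : 0 <= E by exact: expR_ge0.
have c0 : 0 <= 2 ^+ k / rho ^+ 'C(k, 2) by rewrite divr_ge0 // exprn_ge0.
have main : (\prod_(j < n) (1 + rho ^+ j.+1 / rho ^+ k)) * (\prod_(j < n) (1 + rho ^+ j.+1 * rho ^+ k))
    <= 2 ^+ k / rho ^+ 'C(k, 2) * (E * E).
  apply: (le_trans (ler_pM prod0' prod0 hE3 hE2)).
  by rewrite -!mulrA ler_wpM2l ?exprn_ge0 // ler_wpM2l ?invr_ge0 ?exprn_ge0 // ler_wpM2r.
have rk0 : rho ^+ k != 0 by rewrite expf_neq0 // gt_eqF.
have goal (X : R) : X <= rho ^+ (k ^ 2) * ((\prod_(j < n) (1 + rho ^+ j.+1 / rho ^+ k)) * (\prod_(j < n) (1 + rho ^+ j.+1 * rho ^+ k))) ->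
    X <= E ^+ 2 * 2 ^+ k * rho ^+ (k ^ 2) / rho ^+ 'C(k, 2).
  move=> h; apply: (le_trans h); apply: (le_trans (ler_wpM2l _ main)); first exact: exprn_ge0.
  by apply: le_of_eq; rewrite expr2; ring.
apply: goal.
rewrite -big_split /=.
have [le_in|lt_ni] := leqP i n.
  have ek : n = (i + k)%N by exact: subz_absz_le.
  have := @dual_poly_coef_norm p n (rho ^+ k) (exprn_ge0 _ r0') i.
  rewrite -ler_pdivlMr ?exprn_gt0 // => h; apply: (le_trans h).
  rewrite -/rho ler_pdivrMr ?exprn_gt0 //.
  have -> : \prod_(j < n) ((1 + rho ^+ j.+1 * rho ^+ k) * (rho ^+ j.+1 + rho ^+ k)) =
    rho ^+ k ^+ n * \prod_(i0 < n) ((1 + rho ^+ i0.+1 / rho ^+ k) * (1 + rho ^+ i0.+1 * rho ^+ k)).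
    rewrite -[X in _ ^+ X * _](card_ord n) -prodr_const -big_split /=.
    by apply: eq_bigr => j _; field.
  have -> : rho ^+ k ^+ n = rho ^+ k ^+ i * rho ^+ (k ^ 2) by rewrite {1}ek exprD -mulnn exprM.
  by apply: le_of_eq; ring.
have ek : i = (n + k)%N by exact: subz_absz_gt.
have := @dual_poly_coef_norm p n (rho ^- k) _ i; rewrite invr_ge0 exprn_ge0 // => /(_ isT).
rewrite -ler_pdivlMr ?exprn_gt0 ?invr_gt0 ?exprn_gt0 // => h; apply: (le_trans h).
rewrite -/rho ler_pdivrMr ?exprn_gt0 ?invr_gt0 ?exprn_gt0 //.
have -> : \prod_(j < n) ((1 + rho ^+ j.+1 * rho ^- k) * (rho ^+ j.+1 + rho ^- k)) =
    rho ^- k ^+ n * \prod_(i0 < n) ((1 + rho ^+ i0.+1 / rho ^+ k) * (1 + rho ^+ i0.+1 * rho ^+ k)).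
  rewrite -[X in _ ^+ X * _](card_ord n) -prodr_const -big_split /=.
  by apply: eq_bigr => j _; field.
have -> : rho ^- k ^+ i = rho ^- k ^+ n * (rho ^+ (k ^ 2))^-1.
  by rewrite {1}ek exprD -mulnn exprM (exprVn (rho ^+ k) k).
have rk20 : rho ^+ (k ^ 2) != 0 by rewrite expf_neq0 // gt_eqF.
apply: le_of_eq; move: rk20; move: (rho ^+ (k ^ 2)) => z z0.
by move: (rho ^- k ^+ n) (\prod_(_ < _) _) => x y; field.
Qed.

End Sampling.

(** * Sampling inequalities for Gaussians *)

Section SamplingInequalities.
Variable R : realType.
Local Notation C := R[i].

(** Written with a floor, the decay of g along a lattice of any mesh becomes
    a sum of values of geo at distinct integers ([sum_geo_inj]). *)
Lemma gaussian_floor_bound (a b c : C) (mu : R) : Re a < 0 -> 0 < mu ->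
  exists2 K, 0 < K & forall u, cabs (gauss a b c u) <= K * geo R (Num.floor (u / mu)).
Proof.
move=> a0 mu0; set A := - Re a; have A0 : 0 < A by rewrite oppr_gt0.
exists (expR ((`|Re b| + mu^-1) ^+ 2 / (4 * A)) * expR (1 + Re c)).
  by rewrite mulr_gt0 ?expR_gt0.
move=> u; rewrite cabs_gaussian.
set k := Num.floor _.
have ku : `|k|%N%:R <= `|u| / mu + 1.
  have fl := floor_itv (u / mu); rewrite -/k intrD in fl.
  have e : `|u| / mu = `|u / mu| by rewrite normrM normfV (ger0_norm (ltW mu0)).
  rewrite natr_absz intr_norm e ler_norml; case/andP: fl => f1 f2.
  have n1 := ler_norm (u / mu); have n2 := ler_norm (- (u / mu)); rewrite normrN in n2.
  by apply/andP; split; lra.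
apply: (@le_trans _ _ (expR (- A * `|u| ^+ 2 + (`|Re b| + mu^-1) * `|u|) * expR (1 + Re c) * expR (- `|k|%N%:R))).
  rewrite -!expRD ler_expR real_normK ?num_real //.
  have h : Re b * u <= `|Re b| * `|u| by rewrite -normrM ler_norm.
  rewrite /A opprK; lra.
apply: ler_pM; rewrite ?mulr_ge0 ?expR_ge0 //; last exact: expRN_le_half.
by rewrite ler_wpM2r ?expR_ge0 // expR_quadratic_le.
Qed.

Lemma floor_addz (x : R) (k : int) : Num.floor (x + k%:~R) = Num.floor x + k.
Proof. by rewrite floorDrz ?intrKfloor // intr_int. Qed.

(** Schur's test for the matrix g(x + lam l - alpha k): its rows and its
    columns are sums of Gaussian values along lattices. *)
Lemma sampling_upper (a b c : C) (alpha lam : R) :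
  Re a < 0 -> 0 < alpha -> 0 < lam ->
  exists2 B, 0 < B & forall (x : R) (r s : seq int) (d : int -> C), uniq r -> uniq s ->
   \sum_(k <- s) cabs (\sum_(l <- r) d l * gauss a b c (x + lam * l%:~R - alpha * k%:~R)) ^+ 2
   <= B * \sum_(l <- r) cabs (d l) ^+ 2.
Proof.
move=> a0 al0 la0.
have [K1 K10 h1] := gaussian_floor_bound b c a0 la0.
have [K2 K20 h2] := gaussian_floor_bound b c a0 al0.
exists ((K1 * 3) * (K2 * 3)); first by rewrite !mulr_gt0.
move=> x r s d ur us.
apply: (@schur_test R _ _ s r (fun k l => cabs (gauss a b c (x + lam * l%:~R - alpha * k%:~R)))
  (fun k => cabs (\sum_(l <- r) d l * gauss a b c (x + lam * l%:~R - alpha * k%:~R))) (fun l => cabs (d l))).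
- by move=> k l; exact: cabs_ge0.
- by rewrite mulr_ge0 // ltW.
- move=> k _.
  apply: (@le_trans _ _ (\sum_(l <- r) K1 * geo R (Num.floor ((x - alpha * k%:~R) / lam) + l))).
    apply: ler_sum => l _; apply: (le_trans (h1 _)); rewrite -floor_addz.
    rewrite (_ : (x - alpha * k%:~R) / lam + l%:~R = (x + lam * l%:~R - alpha * k%:~R) / lam) //.
    by field; rewrite gt_eqF.
  rewrite -mulr_sumr; apply: ler_wpM2l; first exact: ltW.
  by apply: sum_geo_inj => // i j _ _ /addrI.
- move=> l _.
  apply: (@le_trans _ _ (\sum_(k <- s) K2 * geo R (Num.floor ((x + lam * l%:~R) / alpha) + - k))).
    apply: ler_sum => k _; apply: (le_trans (h2 _)); rewrite -floor_addz.
    rewrite (_ : (x + lam * l%:~R) / alpha + (- k)%:~R = (x + lam * l%:~R - alpha * k%:~R) / alpha) //.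
    by rewrite mulrNz; field; rewrite gt_eqF.
  rewrite -mulr_sumr; apply: ler_wpM2l; first exact: ltW.
  by apply: sum_geo_inj => // i j _ _ /addrI/oppr_inj.
move=> k _; rewrite cabs_ge0 /=; apply: (le_trans (cabs_sum _ _ _)).
by apply: ler_sum => l _; rewrite cabsM mulrC.
Qed.

Lemma absz_recentered_le (q : int) n j : (j < n.*2.+1)%N -> (`|(q + j%:Z - n%:Z - q)%R| <= n)%N.
Proof. by lia. Qed.

Section Dual.
Variables (a b c : C) (alpha lam : R).
Hypotheses (a0 : Re a < 0) (al0 : 0 < alpha) (al_la : alpha < lam).
Local Notation g := (gauss a b c).
Local Notation p := (cexp (2 * a * (alpha * lam)%:C)).
Let A := - Re a.

Local Lemma A0 : 0 < A. Proof. by rewrite oppr_gt0. Qed.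
Local Lemma la0 : 0 < lam. Proof. exact: lt_trans al0 al_la. Qed.

Local Lemma cabs_p : cabs p = expR (- (2 * A * (alpha * lam))).
Proof.
rewrite cabs_cexp; congr expR.
by rewrite -(rmorph_nat (real_complex R)) !(ReM, ImM) /= /A; ring.
Qed.

Local Lemma p_lt1 : cabs p < 1.
Proof. by rewrite cabs_p expR_lt1 oppr_lt0 !mulr_gt0 ?A0 ?la0. Qed.

Lemma dual_poly_node n (s : int) : (`|s| <= n)%N ->
  (dual_poly p n).[cexp (- (2 * a * (alpha * lam)%:C) * s%:~R)] =
  if s == 0 then qpoch p n ^+ 2 else 0.
Proof.
rewrite horner_dual_poly => sn.
case: s sn => [[|m]|m] sn.
- rewrite mulr0 cexp0 /= /qpoch expr2 -big_split /=.
  by apply: eq_bigr => j _; rewrite mulr1.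
- rewrite /= (bigD1 (Ordinal sn)) //= [X in X * _](_ : _ = 0) ?mul0r //.
  by rewrite -cexpXn -cexpD mulNr addrN cexp0 subrr mul0r.
rewrite /= (bigD1 (Ordinal sn)) //= [X in X * _](_ : _ = 0) ?mul0r //.
by rewrite -cexpXn NegzE mulrNz mulNr mulrN opprK subrr mulr0.
Qed.

(** The property of Gaussians behind the lower bound: the quotient is
    geometric in i, with ratio depending on s only. *)
Lemma gaussian_ratio u (s : int) i : g (u - alpha * i%:R + lam * s%:~R) =
  g (u - alpha * i%:R) * (cexp (a * (2 * u * (lam * s%:~R) + (lam * s%:~R) ^+ 2)%:C + b * (lam * s%:~R)%:C)
   * cexp (- (2 * a * (alpha * lam)%:C) * s%:~R) ^+ i).
Proof.
rewrite -cexpXn /extended_gaussian -!cexpD; congr cexp.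
rewrite !(rmorphD, rmorphB, rmorphM, rmorphXn) /= ?rmorph_int ?rmorph_nat.
by ring.
Qed.

(** By [gaussian_ratio] the sum is a multiple of the value of the dual
    polynomial at p^(-s). *)
Lemma dual_identity n u (s : int) : (`|s| <= n)%N ->
  \sum_(i < n.*2.+1) (dual_poly p n)`_i / g (u - alpha * i%:R) * g (u - alpha * i%:R + lam * s%:~R)
  = if s == 0 then qpoch p n ^+ 2 else 0.
Proof.
move=> sn; set E := cexp (a * (2 * u * (lam * s%:~R) + (lam * s%:~R) ^+ 2)%:C + b * (lam * s%:~R)%:C).
transitivity (E * (dual_poly p n).[cexp (- (2 * a * (alpha * lam)%:C) * s%:~R)]).
  rewrite (horner_coef_wide _ (size_dual_poly p n)) mulr_sumr; apply: eq_bigr => i _.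
  by rewrite gaussian_ratio -/E [LHS]mulrA divfK ?cexp_neq0 // mulrCA.
rewrite dual_poly_node //; case: eqP => [s0|_]; last by rewrite mulr0.
rewrite /E s0 mulr0 expr0n /= mulr0 addr0 !mulr0.
by rewrite addr0 cexp0 mul1r.
Qed.

(** The coefficients decrease like e^{- A alpha lam k^2} and 1 / |g| grows at
    most like e^{A alpha^2 k^2}: what remains is the Gaussian of rate
    A alpha (lam - alpha) > 0. *)
Lemma dual_weight_bound : exists2 K, 0 < K & forall n i v, (i <= n.*2)%N ->
  `|v| <= alpha * (`|i%:Z - n%:Z|%:R + 1) ->
  cabs ((dual_poly p n)`_i / g v) <= K * geo R (i%:Z - n%:Z).
Proof.
pose E := expR (cabs p / (1 - cabs p)) ^+ 2.
(* D and F collect the linear and constant terms of the exponent, D with one more unit for the factor e^{-k}. *)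
pose eps := A * alpha * (lam - alpha).
have eps0 : 0 < eps by rewrite !mulr_gt0 ?A0 // subr_gt0.
pose D := 2 + 2 * A * alpha ^+ 2 + `|Re b| * alpha.
pose F := A * alpha ^+ 2 + `|Re b| * alpha + `|Re c|.
exists (E * expR F * expR (D ^+ 2 / (4 * eps))).
  by rewrite !mulr_gt0 ?exprn_gt0 ?expR_gt0.
move=> n i v ile hv.
have hc := dual_poly_coef_bound (cexp_neq0 _) p_lt1 ile.
have E0 : 0 <= E by rewrite exprn_ge0 ?expR_ge0.
rewrite /geo; set k := `|i%:Z - n%:Z|%N in hv hc *.
rewrite cabsM cabsV.
have hg : (cabs (g v))^-1 <= expR (A * (alpha * (k%:R + 1)) ^+ 2 + `|Re b| * (alpha * (k%:R + 1)) + `|Re c|).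
  rewrite cabs_gaussian -expRN ler_expR.
  have v0 := normr_ge0 v.
  have h1 : v ^+ 2 <= (alpha * (k%:R + 1)) ^+ 2.
    by rewrite -[v ^+ 2]real_normK ?num_real // lerXn2r // nnegrE (le_trans v0).
  have h2 := ler_wpM2l (ltW A0) h1.
  have h3 : - (Re b * v) <= `|Re b| * (alpha * (k%:R + 1)).
    by apply: (le_trans (ler_norm _)); rewrite normrN normrM ler_wpM2l.
  have h4 : - Re c <= `|Re c| by rewrite -normrN ler_norm.
  rewrite (_ : Re a = - A); last by rewrite /A opprK.
  move: h2 h3 h4; move: (v ^+ 2) => X2; lra.
have e2 : 2 ^+ k <= expR (k%:R : R).
  rewrite -[k%:R]mulr1 expRM_natl lerXn2r // ?nnegrE ?expR_ge0 //.
  by have := expR_ge1Dx (1 : R); lra.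
have ep : cabs p ^+ (k ^ 2) / cabs p ^+ 'C(k, 2) <= expR (- (A * (alpha * lam) * k%:R ^+ 2)).
  rewrite cabs_p -!expRM_natl -expRN -expRD ler_expR natrX.
  have : ('C(k, 2)%:R * 2 : R) <= k%:R ^+ 2.
    rewrite -natrM -natrX ler_nat mulnC -mul_bin_diag bin1 -mulnn leq_mul2l.
    by rewrite leq_pred orbT.
  have : 0 < A * (alpha * lam) by rewrite !mulr_gt0 ?A0 ?la0.
  rewrite -(mulrA 2).
  move: (A * (alpha * lam)) (k%:R ^+ 2) ('C(k, 2)%:R) => y z t y0 ht.
  have := ler_wpM2l (ltW y0) ht; lra.
apply: (@le_trans _ _ (E * expR k%:R * expR (- (A * (alpha * lam) * k%:R ^+ 2)) *
  expR (A * (alpha * (k%:R + 1)) ^+ 2 + `|Re b| * (alpha * (k%:R + 1)) + `|Re c|))).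
  apply: ler_pM => //; rewrite ?cabs_ge0 ?invr_ge0 ?cabs_ge0 //.
  apply: (le_trans hc); rewrite -/E -[leLHS]mulrA.
  apply: ler_pM => //; last exact: ler_wpM2l.
    by rewrite mulr_ge0 // exprn_ge0.
  by rewrite divr_ge0 // exprn_ge0 // cabs_ge0.
rewrite -!(mulrA E); apply: ler_wpM2l => //; rewrite -!(mulrA (expR F)).
apply: (@le_trans _ _ (expR F * (expR (- eps * k%:R ^+ 2 + D * k%:R) * expR (- k%:R)))).
  rewrite -!expRD ler_expR /F /eps /D; apply: le_of_eq.
  by move: A `|Re b| `|Re c| => X Y Z; ring.
apply: ler_wpM2l; first exact: expR_ge0.
by apply: ler_pM; [exact: expR_ge0|exact: expR_ge0|exact: expR_quadratic_le|exact: expRN_le_half].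
Qed.

Local Notation k0 x m := (Num.floor ((x + lam * m%:~R) / alpha)).

(** The points x + lam m are more than alpha apart, hence lie in different
    cells of the lattice of mesh alpha. *)
Lemma floor_step_inj x : injective (fun m : int => k0 x m).
Proof.
have h (m m' : int) : (m < m')%R -> (k0 x m < k0 x m')%R.
  move=> mm.
  have : (k0 x m + 1 <= k0 x m')%R.
    rewrite -floor_addz le_floor //.
    have h1 : m%:~R + 1 <= m'%:~R :> R by move: mm; rewrite -lezD1 -(ler_int R) intrD.
    have h2 : lam * (m%:~R + 1) <= lam * m'%:~R by rewrite ler_pM2l ?la0.
    have -> : (x + lam * m%:~R) / alpha + 1%:~R = (x + lam * m%:~R + alpha) / alpha.
      by rewrite [RHS]mulrDl divff ?gt_eqF.
    rewrite ler_pM2r ?invr_gt0 //. have h3 := al_la. by move: h2; rewrite mulrDr mulr1; move: (lam * m%:~R) (lam * m'%:~R) => M M'; lra.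
  lia.
move=> m m' e; by case: (ltgtP m m') => // /h; rewrite e ltxx.
Qed.

(** Applying the weights of [dual_identity] around the cell of x + lam m
    recovers qpoch p n ^+ 2 * d m.  Schur's test then applies to the matrix of
    weights; its column sums are bounded because the cells are distinct.
    The integer n bounds the diameter of r, and the constant is free of it. *)
Lemma sampling_lower : exists2 B, 0 < B &
  forall (x : R) (r s : seq int) (d : int -> C) n, uniq r -> uniq s ->
  {in r &, forall l m : int, (`|l - m| <= n)%N} ->
  {in r, forall m k : int, (`|k - k0 x m| <= n)%N -> k \in s} ->
  \sum_(l <- r) cabs (d l) ^+ 2 <=
  B * \sum_(k <- s) cabs (\sum_(l <- r) d l * g (x + lam * l%:~R - alpha * k%:~R)) ^+ 2.
Proof.
have [K K0' hK] := dual_weight_bound.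
have [L L0 hL] := qpoch_lower p_lt1.
pose K' := K / L ^+ 2.
have K'0 : 0 < K' by rewrite divr_gt0 ?exprn_gt0.
exists (K' * 3 * (K' * 3)); first by apply: mulr_gt0; apply: mulr_gt0.
move=> x r s d n ur us hr hs.
set psi := fun k : int => \sum_(l <- r) d l * g (x + lam * l%:~R - alpha * k%:~R).
apply: (@schur_test R _ _ r s (fun m k => K' * geo R (k - k0 x m)) (fun l => cabs (d l)) (fun k => cabs (psi k))).
- by move=> m k; rewrite mulr_ge0 ?geo_ge0 // ltW.
- by rewrite mulr_ge0 // ltW.
- move=> m _; rewrite -mulr_sumr ler_wpM2l ?(ltW K'0) //.
  by apply: sum_geo_inj => // i j _ _ /addIr.
- move=> k _; rewrite -mulr_sumr ler_wpM2l ?(ltW K'0) //.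
  by apply: sum_geo_inj => // i j _ _ /addrI/oppr_inj/floor_step_inj.
move=> m mr; rewrite cabs_ge0 /=.
set q := k0 x m.
(* Then u - alpha i runs over the sampling points of index q - n, ..., q + n relative to x + lam m. *)
pose u := x + lam * m%:~R - alpha * (q%:~R - n%:R).
pose kk (i : nat) : int := q + i%:Z - n%:Z.
have eu i : u - alpha * i%:R = x + lam * m%:~R - alpha * (kk i)%:~R.
  by rewrite /u /kk !intrD mulrNz; ring.
have key : \sum_(i < n.*2.+1) (dual_poly p n)`_i / g (u - alpha * i%:R) * psi (kk i) = qpoch p n ^+ 2 * d m.
  transitivity (\sum_(l <- r) d l * (if l - m == 0 then qpoch p n ^+ 2 else 0)).
    under eq_bigr => i _ do rewrite mulr_sumr.
    rewrite exchange_big /= big_seq [RHS]big_seq; apply: eq_bigr => l lr.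
    rewrite -(dual_identity u (hr l m lr mr)) mulr_sumr; apply: eq_bigr => i _.
    rewrite mulrCA; congr (_ * (_ * g _)).
    by rewrite eu intrD mulrNz; ring.
  rewrite (bigD1_seq m) //= subrr eqxx big1 ?addr0 1?mulrC // => l lm.
  by rewrite subr_eq0 (negbTE lm) mulr0.
have L2 : L ^+ 2 <= cabs (qpoch p n ^+ 2).
  by rewrite cabsX lerXn2r ?nnegrE ?(ltW L0) ?cabs_ge0.
have h1 : L ^+ 2 * cabs (d m) <= \sum_(i < n.*2.+1) K * geo R (kk i - q) * cabs (psi (kk i)).
  apply: (@le_trans _ _ (cabs (qpoch p n ^+ 2 * d m))).
    by rewrite cabsM ler_wpM2r ?cabs_ge0.
  rewrite -key; apply: (le_trans (cabs_sum _ _ _)); apply: ler_sum => i _.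
  rewrite cabsM ler_wpM2r ?cabs_ge0 //.
  have -> : kk i - q = i%:Z - n%:Z by rewrite /kk; ring.
  apply: hK; first by rewrite -ltnS.
  have fl := floor_itv ((x + lam * m%:~R) / alpha); rewrite -/q intrD in fl.
  have fl1 : q%:~R * alpha <= x + lam * m%:~R < (q%:~R + 1) * alpha.
    by rewrite -ler_pdivlMr // -ltr_pdivrMr.
  have -> : u - alpha * i%:R = (x + lam * m%:~R - q%:~R * alpha) + - (alpha * (i%:Z - n%:Z)%:~R).
    by rewrite /u intrD mulrNz; ring.
  apply: (le_trans (ler_normD _ _)); rewrite normrN normrM (ger0_norm (ltW al0)).
  rewrite natr_absz intr_norm [leRHS]mulrDr mulr1 [leRHS]addrC lerD2r.
  by case/andP: fl1 => f1 f2; rewrite ger0_norm; lra.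
rewrite -(ler_pM2l (exprn_gt0 2 L0)); apply: (le_trans h1).
rewrite -(big_mkord xpredT (fun i => K * geo R (kk i - q) * cabs (psi (kk i)))).
rewrite -(big_map kk xpredT (fun k => K * geo R (k - q) * cabs (psi k))).
rewrite mulr_sumr.
have ef k : L ^+ 2 * (K' * geo R (k - q) * cabs (psi k)) = K * geo R (k - q) * cabs (psi k).
  rewrite /K'; move: (exprn_gt0 2 L0); move: (L ^+ 2) (geo R _) (cabs _) => X Y Z X0.
  by field; rewrite gt_eqF.
under [leRHS]eq_bigr => k _ do rewrite ef.
apply: ler_sum_sub => //.
- rewrite map_inj_uniq ?iota_uniq // => i j; rewrite /kk => /addIr/addrI[]//.
- move=> k /mapP[j].
  rewrite mem_index_iota => /andP[_ hi] ->.
  apply: (hs m mr); rewrite -/q /kk; exact: absz_recentered_le.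
- by move=> k; rewrite mulr_ge0 ?cabs_ge0 // mulr_ge0 ?geo_ge0 // ltW.
Qed.

End Dual.
End SamplingInequalities.

Local Notation "z ^*" := (conjc z) : ring_scope.

(** * Integrals of complex-valued functions *)

Section ComplexIntegral.
Variable R : realType.
Local Notation C := R[i].
Local Notation mu := (@lebesgue_measure R).

Definition cmeas (F : R -> C) : Prop :=
  measurable_fun [set: R] (fun x => Re (F x)) /\
  measurable_fun [set: R] (fun x => Im (F x)).

Definition bmeas (F : R -> C) : Prop :=
  cmeas F /\ exists K, forall x, cabs (F x) <= K.

Definition cint (D : set R) (F : R -> C) : C :=
  (\int[mu]_(x in D) Re (F x)) +i* (\int[mu]_(x in D) Im (F x)).

Lemma cmeasD F G : cmeas F -> cmeas G -> cmeas (fun x => F x + G x).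
Proof.
move=> [f1 f2] [g1 g2]; split.
  by under eq_fun do rewrite ReD; exact: measurable_funD.
by under eq_fun do rewrite ImD; exact: measurable_funD.
Qed.

Lemma cmeasM F G : cmeas F -> cmeas G -> cmeas (fun x => F x * G x).
Proof.
move=> [f1 f2] [g1 g2]; split.
  under eq_fun do rewrite ReM.
  by apply: measurable_funB; exact: measurable_funM.
under eq_fun do rewrite ImM.
by apply: measurable_funD; exact: measurable_funM.
Qed.

Lemma cmeasJ F : cmeas F -> cmeas (fun x => (F x)^*).
Proof.
move=> [f1 f2]; split; first by under eq_fun do rewrite ReJ.
under eq_fun do rewrite ImJ.
exact: (measurable_funN f2).
Qed.

Lemma cmeas_cst z : cmeas (fun=> z).
Proof. by split; exact: measurable_cst. Qed.

Lemma measurable_invr : measurable_fun [set: R] (@GRing.inv R).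
Proof.
rewrite -(setvU [set (0 : R)]); apply/measurable_funU => //.
  by apply: measurableC.
split; last exact: measurable_fun_set1.
apply: open_continuous_measurable_fun.
  by apply: closed_openC; apply: compact_closed; [exact: Rhausdorff | exact: compact_set1].
move=> x; rewrite inE /= => /eqP x0; exact: inv_continuous.
Qed.

Lemma measurable_cabs2 F : cmeas F -> measurable_fun [set: R] (fun x => cabs (F x) ^+ 2).
Proof.
move=> [f1 f2]; under eq_fun do rewrite sqr_cabs.
by apply: measurable_funD; exact: measurable_funX.
Qed.

Lemma cmeasV F : cmeas F -> cmeas (fun x => (F x)^-1).
Proof.
move=> mF; have [f1 f2] := mF.
have m : measurable_fun [set: R] (fun x => (cabs (F x) ^+ 2)^-1).
  by apply: measurableT_comp; [exact: measurable_invr | exact: measurable_cabs2].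
have e z : z^-1 = ((cabs z ^+ 2)^-1)%:C * z^* :> C.
  rewrite sqr_cabs; case: z => x y.
  by apply: complex_eqP; rewrite ?ReM ?ImM /=; ring.
split; under eq_fun do rewrite e ?ReM ?ImM /= ?mul0r ?subr0 ?addr0 ?ReJ ?ImJ.
  exact: measurable_funM.
apply: measurable_funM => //; exact: (measurable_funN f2).
Qed.

Lemma bmeasD F G : bmeas F -> bmeas G -> bmeas (fun x => F x + G x).
Proof.
move=> [f [K hK]] [g [L hL]]; split; first exact: cmeasD.
by exists (K + L) => x; rewrite (le_trans (cabsD _ _)) // lerD.
Qed.

Lemma bmeasM F G : bmeas F -> bmeas G -> bmeas (fun x => F x * G x).
Proof.
move=> [f [K hK]] [g [L hL]]; split; first exact: cmeasM.
by exists (K * L) => x; rewrite cabsM ler_pM ?cabs_ge0.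
Qed.

Lemma bmeasJ F : bmeas F -> bmeas (fun x => (F x)^*).
Proof.
move=> [f [K hK]]; split; first exact: cmeasJ.
by exists K => x; rewrite cabsJ.
Qed.

Lemma bmeas_cst z : bmeas (fun=> z).
Proof. by split; [exact: cmeas_cst | exists (cabs z)]. Qed.

Lemma bmeas_sum (I : Type) (s : seq I) (F : I -> R -> C) :
  (forall i, bmeas (F i)) -> bmeas (fun x => \sum_(i <- s) F i x).
Proof.
move=> h; elim: s => [|i s IH].
  by under eq_fun do rewrite big_nil; exact: bmeas_cst.
by under eq_fun do rewrite big_cons; exact: bmeasD.
Qed.

Lemma integrable_bounded_itv (f : R -> R) (K u v : R) :
  measurable_fun [set: R] f -> (forall x, `|f x| <= K) ->
  mu.-integrable `[u, v] (EFin \o f).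
Proof.
move=> mf hK; apply: measurable_bounded_integrable => //.
- by rewrite /= lebesgue_measure_itv /=; case: ifP => // _; rewrite -EFinB ltry.
- exact: measurable_funTS.
- exists K; split; first exact: num_real.
  by move=> y Ky x _; rewrite /= (le_trans (hK x)) // ltW.
Qed.

Lemma bmeas_Re F u v : bmeas F -> mu.-integrable `[u, v] (EFin \o (fun x => Re (F x))).
Proof.
move=> [[f1 f2] [K hK]]; apply: (@integrable_bounded_itv _ K) => // x.
exact: le_trans (Re_le_cabs _) (hK x).
Qed.

Lemma bmeas_Im F u v : bmeas F -> mu.-integrable `[u, v] (EFin \o (fun x => Im (F x))).
Proof.
move=> [[f1 f2] [K hK]]; apply: (@integrable_bounded_itv _ K) => // x.
exact: le_trans (Im_le_cabs _) (hK x).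
Qed.

Section Itv.
Variables u v : R.
Local Notation D := (`[u, v]%classic : set R).

Lemma cintD F G : bmeas F -> bmeas G ->
  cint D (fun x => F x + G x) = cint D F + cint D G.
Proof.
move=> f g; apply: complex_eqP; rewrite /= ?ReD ?ImD /=.
  under eq_Rintegral do rewrite ReD.
  by rewrite RintegralD //; exact: bmeas_Re.
under eq_Rintegral do rewrite ImD.
by rewrite RintegralD //; exact: bmeas_Im.
Qed.

Lemma integrable_Zl (r : R) (f : R -> R) : mu.-integrable D (EFin \o f) ->
  mu.-integrable D (EFin \o (fun x => r * f x)).
Proof. by move=> h; have := @integrableZl _ _ _ mu D (measurable_itv _) r _ h; apply: eq_integrable. Qed.

Lemma cintZ z F : bmeas F -> cint D (fun x => z * F x) = z * cint D F.
Proof.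
move=> f; apply: complex_eqP; rewrite ?ReM ?ImM /=.
  under eq_Rintegral do rewrite ReM.
  by rewrite RintegralB ?RintegralZl //; try apply: integrable_Zl; (exact: bmeas_Re || exact: bmeas_Im).
under eq_Rintegral do rewrite ImM.
by rewrite RintegralD ?RintegralZl //; try apply: integrable_Zl; (exact: bmeas_Re || exact: bmeas_Im).
Qed.

Lemma cintJ F : bmeas F -> cint D (fun x => (F x)^*) = (cint D F)^*.
Proof.
move=> f; apply: complex_eqP; rewrite ?ReJ ?ImJ /=.
  by under eq_Rintegral do rewrite ReJ.
under eq_Rintegral do rewrite ImJ -mulN1r.
by rewrite RintegralZl ?mulN1r //; exact: bmeas_Im.
Qed.

Lemma cint0 : cint D (fun=> 0) = 0.
Proof. by apply: complex_eqP; rewrite /= Rintegral_cst // mul0r. Qed.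

Lemma cint_sum (I : Type) (s : seq I) (F : I -> R -> C) :
  (forall i, bmeas (F i)) -> cint D (fun x => \sum_(i <- s) F i x) = \sum_(i <- s) cint D (F i).
Proof.
move=> h; elim: s => [|i s IH].
  by rewrite big_nil -[RHS]cint0; congr (cint _ _); apply/funext => x; rewrite big_nil.
rewrite big_cons -IH -cintD //; last exact: bmeas_sum.
by congr (cint _ _); apply/funext => x; rewrite big_cons.
Qed.

Lemma cint_cst z : u <= v -> cint D (fun=> z) = z * (v - u)%:C.
Proof.
move=> uv; have e r : \int[mu]_(x in D) r = r * (v - u).
  rewrite Rintegral_cst //= lebesgue_measure_itv /=; congr (_ * _).
  by move: uv; rewrite le_eqVlt lte_fin => /predU1P[->|->//]; rewrite ltxx subrr.
by apply: complex_eqP; rewrite /= e ?ReM ?ImM /= !mulr0 ?subr0 ?add0r.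
Qed.

Lemma cabs_cint_le F K : bmeas F -> u <= v -> (forall x, D x -> cabs (F x) <= K) ->
  cabs (cint D F) <= 2 * K * (v - u).
Proof.
move=> f uv h.
have e r : \int[mu]_(x in D) r = r * (v - u).
  rewrite Rintegral_cst //= lebesgue_measure_itv /=; congr (_ * _).
  by move: uv; rewrite le_eqVlt lte_fin => /predU1P[->|->//]; rewrite ltxx subrr.
have bd (G : R -> R) : mu.-integrable D (EFin \o G) -> (forall x, D x -> `|G x| <= K) ->
    `|\int[mu]_(x in D) G x| <= K * (v - u).
  move=> iG hG; apply: (le_trans (le_normr_Rintegral _ iG)) => //.
  rewrite -e; apply: le_Rintegral => //.
    by have := integrable_norm iG.
  by have := @integrable_bounded_itv (fun=> K) `|K| u v; apply; [exact: measurable_cst|].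
apply: (le_trans (cabs_le_ReIm _)) => /=.
rewrite (_ : 2 * K * (v - u) = K * (v - u) + K * (v - u)); last by ring.
apply: lerD; apply: bd.
- exact: bmeas_Re.
- by move=> x Dx; exact: le_trans (Re_le_cabs _) (h x Dx).
- exact: bmeas_Im.
- by move=> x Dx; exact: le_trans (Im_le_cabs _) (h x Dx).
Qed.

Lemma eq_cint F G : (forall x, D x -> F x = G x) -> cint D F = cint D G.
Proof.
by move=> h; apply: complex_eqP => /=; apply: eq_Rintegral => x; rewrite inE => /h ->.
Qed.

Lemma Re_cint_ge0 F : 0 <= Re (cint D (fun x => F x * (F x)^*)).
Proof.
apply: Rintegral_ge0 => x _; rewrite ReM ReJ ImJ mulrN opprK -!expr2.
by rewrite addr_ge0 ?sqr_ge0.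
Qed.

End Itv.

Definition clipschitz (L : R) (F : R -> C) : Prop := forall x y, cabs (F x - F y) <= L * `|x - y|.

Lemma clipschitz_ge0 (F : R -> C) (L : R) : clipschitz L F -> 0 <= L.
Proof. by move=> h; have := h 1 0; rewrite subr0 normr1 mulr1; apply: le_trans; exact: cabs_ge0. Qed.

Lemma lip_continuous (f : R -> R) (L : R) : (forall x y, `|f x - f y| <= L * `|x - y|) -> continuous f.
Proof.
move=> h x; apply/cvgrPdist_le => e e0.
have L0 : 0 < `|L| + 1 by rewrite ltr_wpDl.
near=> y.
apply: (le_trans (h x y)); apply: (@le_trans _ _ ((`|L| + 1) * `|x - y|)).
  by rewrite ler_wpM2r // (le_trans (ler_norm _)) // lerDl.
rewrite mulrC -ler_pdivlMr //; near: y.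
have : (fun y : R => y) @ x --> x by exact: cvg_id.
by move/cvgrPdist_le; apply; rewrite divr_gt0.
Unshelve. all: by end_near. Qed.

Lemma clipschitz_Re L F : clipschitz L F -> continuous (fun x => Re (F x)).
Proof.
move=> h; apply: (@lip_continuous _ L) => x y.
by rewrite -ReN -ReD (le_trans (Re_le_cabs _)).
Qed.

Lemma clipschitz_Im L F : clipschitz L F -> continuous (fun x => Im (F x)).
Proof.
move=> h; apply: (@lip_continuous _ L) => x y.
by rewrite -ImN -ImD (le_trans (Im_le_cabs _)).
Qed.

Lemma clipschitz_cmeas L F : clipschitz L F -> cmeas F.
Proof.
move=> h; split; apply: continuous_measurable_fun; [exact: clipschitz_Re h|exact: clipschitz_Im h].
Qed.

End ComplexIntegral.

(** * Fourier series of Lipschitz functions on the circle *)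

Section Fourier.
Variable R : realType.
Local Notation C := R[i].
Local Notation mu := (@lebesgue_measure R).
Variable beta : R.
Hypothesis beta0 : 0 < beta.
Local Notation D := (`[0, beta^-1]%classic : set R).

Definition fexp (j : int) (x : R) : C := expi (beta * j%:~R * x).

Lemma fexp0 x : fexp 0 x = 1.
Proof. by rewrite /fexp mulr0 mul0r expi0. Qed.

Lemma fexpD j k x : fexp (j + k) x = fexp j x * fexp k x.
Proof. by rewrite /fexp intrD mulrDr mulrDl expiD. Qed.

Lemma fexpJ j x : (fexp j x)^* = fexp (- j) x.
Proof. by rewrite /fexp -expiN mulrNz mulrN mulNr. Qed.

Lemma cabs_fexp j x : cabs (fexp j x) = 1.
Proof. exact: cabs_expi. Qed.

Lemma expi_lip (x y : R) : cabs (expi x - expi y) <= 2 * pi * `|x - y|.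
Proof.
have -> : expi x - expi y = expi y * (expi (x - y) - 1).
  by rewrite mulrBr mulr1 -expiD [y + _]addrC subrK.
by rewrite cabsM cabs_expi mul1r chord_le.
Qed.

Lemma fexp_lip j : clipschitz (2 * pi * (beta * `|j%:~R|)) (fexp j).
Proof.
move=> x y; apply: (le_trans (expi_lip _ _)).
by rewrite -mulrBr normrM normrM (gtr0_norm beta0) !mulrA.
Qed.

Lemma bmeas_fexp j : bmeas (fexp j).
Proof.
split; first exact: clipschitz_cmeas (@fexp_lip j).
by exists 1 => x; rewrite cabs_fexp.
Qed.

Lemma Rintegral_FTC2 (f F : R -> R) (u v : R) : u < v ->
  continuous f -> (forall x : R, is_derive x 1 F (f x)) ->
  \int[mu]_(x in `[u, v]) f x = F v - F u.
Proof.
move=> uv cf dF; rewrite /Rintegral (@continuous_FTC2 _ _ F) //.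
- exact: continuous_subspaceT.
- have cF : continuous F.
    by move=> x; apply/differentiable_continuous/derivable1_diffP; have := dF x; case.
  split.
  + by move=> x _; have := dF x; case.
  + by apply: cvg_at_right_filter; exact: cF.
  + by apply: cvg_at_left_filter; exact: cF.
- by move=> x _; rewrite derive1E; apply: derive_val.
Qed.

Lemma cint_fexp j : cint D (fexp j) = if j == 0 then (beta^-1)%:C else 0.
Proof.
have b0 : 0 < beta^-1 by rewrite invr_gt0.
case: eqP => [->|/eqP j0].
  rewrite (@eq_cint _ _ _ _ (fun=> 1)); last by move=> x _; rewrite fexp0.
  by rewrite cint_cst ?ltW // subr0 mul1r.
have pi0 := pi_gt0 R.
set w := 2 * pi * (beta * j%:~R).
have w0 : w != 0.
  by rewrite !mulf_neq0 ?pnatr_eq0 ?intr_eq0 // gt_eqF.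
have wb : w * beta^-1 = 2 * pi * j%:~R.
  by rewrite /w -!mulrA mulrCA [j%:~R * _]mulrC mulVKf ?gt_eqF // mulrCA.
have [c1 s1] : cos (w * beta^-1) = 1 /\ sin (w * beta^-1) = 0.
  have := expi_int R j; rewrite /expi wb /cexp /= expR0 => /eqP.
  by rewrite eq_complex /= !mul1r !mul0r subr0 addr0 => /andP[/eqP -> /eqP ->].
have ej x : fexp j x = cos (w * x) +i* sin (w * x).
  rewrite /fexp /expi /cexp /= expR0 (_ : 2 * pi * (beta * j%:~R * x) = w * x); last by rewrite /w !mulrA.
  by apply: complex_eqP; rewrite ?ReM ?ImM /= !mul1r !mul0r ?subr0 ?addr0.
have d1 (x : R) : is_derive x 1 (fun y : R => w * y) w.
  by have := @is_deriveZ R _ _ (id : R -> R) w x 1 1 _; rewrite /GRing.scale /= mulr1; apply.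
have cw : continuous (fun y : R => w * y) by move=> x; exact: mulrl_continuous.
apply: complex_eqP => /=.
  rewrite (_ : (fun x => Re (fexp j x)) = (fun x => cos (w * x))); last first.
    by apply/funext => x; rewrite ej.
  have dF (x : R) : is_derive x 1 (fun x => w^-1 * sin (w * x)) (cos (w * x)).
    have d2 := @is_derive1_comp R sin _ x _ _ (is_derive_sin _) (d1 x).
    apply: (is_derive_eq (@is_deriveZ R _ _ _ w^-1 x 1 _ d2)).
    by rewrite /GRing.scale /= mulrCA mulVf // mulr1.
  have cc : continuous (fun x : R => cos (w * x)).
    by move=> x; apply: continuous_comp; [exact: cw | exact: continuous_cos].
  by rewrite (Rintegral_FTC2 b0 cc dF) s1 !mulr0 sin0 mulr0 subrr.
rewrite (_ : (fun x => Im (fexp j x)) = (fun x => sin (w * x))); last first.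
  by apply/funext => x; rewrite ej.
have dF (x : R) : is_derive x 1 (fun x => - w^-1 * cos (w * x)) (sin (w * x)).
  have d2 := @is_derive1_comp R cos _ x _ _ (is_derive_cos _) (d1 x).
  apply: (is_derive_eq (@is_deriveZ R _ _ _ (- w^-1) x 1 _ d2)).
  by rewrite /GRing.scale /= mulNr mulNr mulrN opprK mulrCA mulVf // mulr1.
have cs : continuous (fun x : R => sin (w * x)).
  by move=> x; apply: continuous_comp; [exact: cw | exact: continuous_sin].
by rewrite (Rintegral_FTC2 b0 cs dF) c1 mulr0 cos0 subrr.
Qed.

Definition fcoef (h : R -> C) (j : int) : C := cint D (fun x => h x * (fexp j x)^*).

Lemma bmeas_fcoef h j : bmeas h -> bmeas (fun x => h x * (fexp j x)^*).
Proof. by move=> bh; apply: bmeasM => //; apply: bmeasJ; exact: bmeas_fexp. Qed.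

Lemma orthogonality j k : cint D (fun x => fexp j x * (fexp k x)^*) = if j == k then (beta^-1)%:C else 0.
Proof.
rewrite (@eq_cint _ _ _ _ (fexp (j - k))); last by move=> x _; cbv beta; rewrite fexpJ fexpD.
by rewrite cint_fexp subr_eq0.
Qed.

(** Expand the integral of |h - beta S|^2 >= 0, where S is the partial
    Fourier sum; the normalisation is that of [orthogonality]. *)
Lemma bessel (h : R -> C) (s : seq int) : bmeas h -> uniq s ->
  \sum_(j <- s) cabs (fcoef h j) ^+ 2 <= beta^-1 * Re (cint D (fun x => h x * (h x)^*)).
Proof.
move=> bh us.
pose S x := \sum_(j <- s) fcoef h j * fexp j x.
have bt j : bmeas (fun x => fcoef h j * fexp j x) by apply: bmeasM; [exact: bmeas_cst|exact: bmeas_fexp].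
have bS : bmeas S by exact: bmeas_sum.
set sig := \sum_(j <- s) _.
have nrm z : z * z^* = (cabs z ^+ 2)%:C :> C.
  by rewrite sqr_cabs; apply: complex_eqP; rewrite ?ReM ?ImM ReJ ImJ /=; ring.
have hS : cint D (fun x => h x * (S x)^*) = sig%:C.
  transitivity (cint D (fun x => \sum_(j <- s) (fcoef h j)^* * (h x * (fexp j x)^*))).
    apply: eq_cint => x _; rewrite /S rmorph_sum mulr_sumr; apply: eq_bigr => j _.
    by rewrite rmorphM mulrCA.
  rewrite cint_sum; last by move=> j; apply: bmeasM; [exact: bmeas_cst|exact: bmeas_fcoef].
  rewrite /sig rmorph_sum; apply: eq_bigr => j _.
  by rewrite cintZ ?nrm; [rewrite mulrC nrm|exact: bmeas_fcoef].
have Sh : cint D (fun x => S x * (h x)^*) = sig%:C.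
  transitivity ((cint D (fun x => h x * (S x)^*))^*); last by rewrite hS conjc_real.
  rewrite -cintJ; last by apply: bmeasM => //; exact: bmeasJ.
  by apply: eq_cint => x _; rewrite rmorphM /= conjcK mulrC.
have Sj j : j \in s -> cint D (fun x => S x * (fexp j x)^*) = (beta^-1)%:C * fcoef h j.
  move=> js; transitivity (cint D (fun x => \sum_(i <- s) fcoef h i * (fexp i x * (fexp j x)^*))).
    by apply: eq_cint => x _; rewrite /S mulr_suml; apply: eq_bigr => i _; rewrite mulrA.
  have bij i : bmeas (fun x => fexp i x * (fexp j x)^*) by apply: bmeas_fcoef; exact: bmeas_fexp.
  rewrite cint_sum; last by move=> i; apply: bmeasM; [exact: bmeas_cst|exact: bij].
  rewrite (bigD1_seq j) // big1 => [|i /negbTE ij]; last first.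
    by rewrite cintZ // orthogonality ij mulr0.
  by rewrite cintZ // orthogonality eqxx mulrC; exact: addr0.
have SS : cint D (fun x => S x * (S x)^*) = (beta^-1 * sig)%:C.
  transitivity (cint D (fun x => \sum_(j <- s) (fcoef h j)^* * (S x * (fexp j x)^*))).
    apply: eq_cint => x _; rewrite {2}/S rmorph_sum mulr_sumr; apply: eq_bigr => j _.
    by rewrite rmorphM mulrCA.
  rewrite cint_sum; last by move=> j; apply: bmeasM; [exact: bmeas_cst|exact: bmeas_fcoef].
  rewrite rmorphM /sig rmorph_sum mulr_sumr big_seq [RHS]big_seq; apply: eq_bigr => j js.
  rewrite cintZ; last exact: bmeas_fcoef.
  by rewrite Sj // mulrCA [conjc _ * _]mulrC nrm.
pose P x := h x + - (beta%:C * S x).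
have := @Re_cint_ge0 _ 0 beta^-1 P.
have -> : cint D (fun x => P x * (P x)^*) = cint D (fun x => h x * (h x)^*) - (beta * sig)%:C.
  have eJ (y z : C) : conjc (y + - (beta%:C * z)) = conjc y - beta%:C * conjc z.
    by case: y z => [y1 y2] [z1 z2]; apply: complex_eqP => /=; ring.
  have bJ F G : bmeas F -> bmeas G -> bmeas (fun x => F x * (G x)^*).
    by move=> bF bG; apply: bmeasM => //; exact: bmeasJ.
  have bz (z : C) F : bmeas F -> bmeas (fun x => z * F x).
    by move=> bF; apply: bmeasM => //; exact: bmeas_cst.
  transitivity (cint D (fun x => (h x * (h x)^* + (- beta%:C) * (h x * (S x)^*)) +
     ((- beta%:C) * (S x * (h x)^*) + (beta ^+ 2)%:C * (S x * (S x)^*)))).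
    apply: eq_cint => x _; rewrite /P eJ rmorphXn.
    by move: (h x) (S x) (conjc (h x)) (conjc (S x)) => y z y' z'; ring.
  rewrite !cintD ?cintZ ?hS ?Sh ?SS; try by [exact: bJ | apply: bz; exact: bJ | apply: bmeasD; [exact: bJ | apply: bz; exact: bJ]].
  - rewrite -!rmorphN -!rmorphM -addrA -!rmorphD; congr (_ + _%:C).
    by field; rewrite gt_eqF.
  - by apply: bmeasD; apply: bz; exact: bJ.
rewrite ReD ReN /= subr_ge0 => hle.
by rewrite ler_pdivlMl.
Qed.

Lemma riemann_lebesgue (h : R -> C) (e : R) : bmeas h -> 0 < e ->
  exists N0, forall N, (N0 <= N)%N -> cabs (fcoef h (Posz N)) <= e /\ cabs (fcoef h (Negz N)) <= e.
Proof.
move=> bh e0.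
pose u N := cabs (fcoef h (Posz N)) ^+ 2 + cabs (fcoef h (Negz N)) ^+ 2.
have u0 N : 0 <= u N by rewrite addr_ge0 ?sqr_ge0.
have su N : series u N = \sum_(j <- zrange N) cabs (fcoef h j) ^+ 2.
  by rewrite /series /= big_mkord big_split /= big_zrange.
have cu : cvgn (series u).
  apply: nondecreasing_is_cvgn; first by apply: nondecreasing_series => n _ _; exact: u0.
  exists (beta^-1 * Re (cint D (fun x => h x * (h x)^*))) => _ [N _ <-].
  by rewrite su; apply: bessel => //; exact: zrange_uniq.
have := cvg_series_cvg_0 cu => /cvgrPdist_le /(_ (e ^+ 2) (exprn_gt0 2 e0))[N0 _ hN0].
exists N0 => N hN; have := hN0 N hN; rewrite sub0r normrN ger0_norm // => hu.
have sq z : cabs z ^+ 2 <= e ^+ 2 -> cabs z <= e.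
  by rewrite ler_pXn2r ?nnegrE ?cabs_ge0 // ltW.
split; apply: sq; apply: le_trans hu; first by rewrite lerDl sqr_ge0.
by rewrite lerDr sqr_ge0.
Qed.

Section Chordal.
Variables (phi : R -> C) (L : R).
Hypotheses (L0 : 0 <= L)
  (phiL : forall x y, cabs (phi y - phi x) <= L * cabs (fexp 1 y - fexp 1 x)).

Lemma chordal_clipschitz : clipschitz (L * (2 * pi * (beta * `|1%:~R|))) phi.
Proof.
move=> x y; apply: (le_trans (phiL y x)); rewrite -(mulrA L) ler_wpM2l //.
exact: fexp_lip.
Qed.

(** Chernoff's quotient: phi(y) - phi(x) divided by e(y) - e(x), with
    e = fexp 1.  It is bounded by L, and multiplication by
    e(y) - e(x) is a difference operator on Fourier coefficients, so the Fourier
    sum of phi at x telescopes. *)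
Definition chernoff_quot x (y : R) : C := (phi y - phi x) / (fexp 1 y - fexp 1 x).

Lemma chernoff_quotE x y : phi y = phi x + (fexp 1 y - fexp 1 x) * chernoff_quot x y.
Proof.
rewrite /chernoff_quot; have [e|ne] := eqVneq (fexp 1 y - fexp 1 x) 0.
  have := phiL x y; rewrite e cabs0 mulr0 => h.
  have /eqP : cabs (phi y - phi x) == 0 by rewrite eq_le h cabs_ge0.
  by move/eqP; rewrite cabs_eq0 subr_eq0 => /eqP ->; rewrite mul0r addr0.
by rewrite mulrC divfK // addrC subrK.
Qed.

Lemma cabs_chernoff_quot x y : cabs (chernoff_quot x y) <= L.
Proof.
rewrite /chernoff_quot cabsM cabsV.
have [e|ne] := eqVneq (fexp 1 y - fexp 1 x) 0.
  by rewrite e cabs0 invr0 mulr0.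
by rewrite ler_pdivrMr ?cabs_gt0 // phiL.
Qed.

Lemma bmeas_chernoff_quot x : bmeas (chernoff_quot x).
Proof.
split; last by exists L => y; exact: cabs_chernoff_quot.
apply: cmeasM.
  by apply: cmeasD; [exact: clipschitz_cmeas chordal_clipschitz | exact: cmeas_cst].
apply: cmeasV; apply: cmeasD; [exact: clipschitz_cmeas (@fexp_lip 1)|exact: cmeas_cst].
Qed.

Lemma fcoef_chernoff x j : fcoef phi j =
  phi x * (if j == 0 then (beta^-1)%:C else 0)
  + (fcoef (chernoff_quot x) (j - 1) - fexp 1 x * fcoef (chernoff_quot x) j).
Proof.
have bq := bmeas_chernoff_quot x.
transitivity (cint D (fun y => phi x * (fexp (- j) y) +
  (chernoff_quot x y * (fexp (j - 1) y)^* + (- fexp 1 x) * (chernoff_quot x y * (fexp j y)^*)))).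
  apply: eq_cint => y _; rewrite (chernoff_quotE x y) !fexpJ opprB [1 - j]addrC fexpD.
  by move: (chernoff_quot x y) (fexp (- j) y) (fexp 1 y) (fexp 1 x) => q f1 f2 f3; ring.
have b1 : bmeas (fun y => phi x * fexp (- j) y) by apply: bmeasM; [exact: bmeas_cst|exact: bmeas_fexp].
have b2 : bmeas (fun y => chernoff_quot x y * (fexp (j - 1) y)^*) by exact: bmeas_fcoef.
have b3 : bmeas (fun y => (- fexp 1 x) * (chernoff_quot x y * (fexp j y)^*)).
  by apply: bmeasM; [exact: bmeas_cst|exact: bmeas_fcoef].
rewrite cintD //; last exact: bmeasD.
rewrite cintD // cintZ; last exact: bmeas_fexp.
rewrite cintZ; last exact: bmeas_fcoef.
by rewrite cint_fexp oppr_eq0 mulNr.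
Qed.

Definition fsum N x : C := \sum_(j <- zrange N) fcoef phi j * fexp j x.

(** Only the two end terms of the telescoping sum remain; they tend to 0 by
    [riemann_lebesgue] and are bounded uniformly in x. *)
Lemma fsumE N x : (0 < N)%N -> fsum N x = (beta^-1)%:C * phi x +
  (fexp (- N%:Z) x * fcoef (chernoff_quot x) (- N%:Z - 1) - fexp N x * fcoef (chernoff_quot x) (N%:Z - 1)).
Proof.
move=> N0; rewrite -(telescope_zrange N (fun j => fexp j x * fcoef (chernoff_quot x) (j - 1))).
rewrite /fsum.
transitivity (\sum_(j <- zrange N) ((if j == 0 then (beta^-1)%:C * phi x else 0) +
   (fexp j x * fcoef (chernoff_quot x) (j - 1) - fexp (j + 1) x * fcoef (chernoff_quot x) (j + 1 - 1)))).
  apply: eq_bigr => j _; rewrite (fcoef_chernoff x j) fexpD addrK.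
  case: eqP => [->|_]; last by rewrite mulr0 add0r; ring.
  by rewrite fexp0; ring.
rewrite big_split /=; congr (_ + _).
rewrite -big_mkcond /= big_const_seq (eq_count (a2 := pred1 0)) //.
rewrite count_uniq_mem ?zrange_uniq // (_ : 0 \in zrange N) /= ?addr0 //.
by rewrite mem_zrange; lia.
Qed.

Lemma fsum_bound N x : (0 < N)%N -> cabs (fsum N x) <= beta^-1 * cabs (phi x) + 4 * L * beta^-1.
Proof.
move=> N0; rewrite fsumE //.
have b0 : 0 < beta^-1 by rewrite invr_gt0.
have bc j : cabs (fexp j x * fcoef (chernoff_quot x) (j - 1)) <= 2 * L * beta^-1.
  rewrite cabsM cabs_fexp mul1r /fcoef.
  have := @cabs_cint_le R 0 beta^-1 (fun y => chernoff_quot x y * (fexp (j - 1) y)^*) L.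
  rewrite subr0; apply; [exact: bmeas_fcoef (bmeas_chernoff_quot x)|exact: ltW|].
  by move=> y _; rewrite cabsM cabsJ cabs_fexp mulr1 cabs_chernoff_quot.
apply: (le_trans (cabsD _ _)); apply: lerD.
  by rewrite cabsM cabs_real ger0_norm // ltW.
apply: (le_trans (cabsD _ _)); rewrite cabsN.
have := bc (- N%:Z); have := bc N; lra.
Qed.

Lemma fsum_cvg x (e : R) : 0 < e ->
  exists N0, forall N, (N0 <= N)%N -> cabs (fsum N x - (beta^-1)%:C * phi x) <= e.
Proof.
move=> e0; have e20 : 0 < e / 2 by rewrite divr_gt0.
have [N0 h] := riemann_lebesgue (bmeas_chernoff_quot x) e20.
exists N0.+1 => -[//|N] hN; rewrite fsumE // addrC addKr.
have [h1 h2] := h N hN.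
apply: (le_trans (cabsD _ _)); rewrite cabsN [leRHS]splitr !(cabsM (fexp _ _)) !cabs_fexp !mul1r.
rewrite (_ : - N.+1%:Z - 1 = Negz N.+1); last by lia.
rewrite (_ : N.+1%:Z - 1 = N); last by lia.
exact: lerD (h N.+1 (leqW hN)).2 h1.
Qed.

(** The Fourier sums converge to phi / beta pointwise and boundedly, so one may
    integrate them against the conjugate of phi. *)
Lemma parseval (K : R) : (forall x, cabs (phi x) <= K) ->
  (\sum_(j <- zrange N) cabs (fcoef phi j) ^+ 2) @[N --> \oo] --> beta^-1 * \int[mu]_(x in D) (cabs (phi x) ^+ 2).
Proof.
move=> hK.
have b0 : 0 < beta^-1 by rewrite invr_gt0.
have bphi : bmeas phi by split; [exact: clipschitz_cmeas chordal_clipschitz | exists K].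
have bfs N : bmeas (fsum N).
  by apply: bmeas_sum => j; apply: bmeasM; [exact: bmeas_cst|exact: bmeas_fexp].
have bfp N : bmeas (fun x => fsum N x * (phi x)^*) by apply: bmeasM => //; exact: bmeasJ.
have K00 : 0 <= K by apply: le_trans (hK 0); exact: cabs_ge0.
pose M := (beta^-1 * K + 4 * L * beta^-1) * K.
have intE N : \sum_(j <- zrange N) cabs (fcoef phi j) ^+ 2 =
    \int[mu]_(x in D) Re (fsum N x * (phi x)^*).
  rewrite -[RHS]/(Re (cint D (fun x => fsum N x * (phi x)^*))).
  have -> : cint D (fun x => fsum N x * (phi x)^*) = \sum_(j <- zrange N) (cabs (fcoef phi j) ^+ 2)%:C.
    transitivity (cint D (fun x => \sum_(j <- zrange N) fcoef phi j * ((phi x * (fexp j x)^*)^*))).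
      apply: eq_cint => x _; rewrite /fsum mulr_suml; apply: eq_bigr => j _.
      by rewrite conjcM conjcK -mulrA [fexp _ _ * _]mulrC.
    have bJ j : bmeas (fun x => (phi x * (fexp j x)^*)^*) by apply: bmeasJ; exact: bmeas_fcoef.
    rewrite cint_sum; last by move=> j; apply: bmeasM; [exact: bmeas_cst|exact: bJ].
    apply: eq_bigr => j _; rewrite cintZ // cintJ; last exact: bmeas_fcoef.
    rewrite -/(fcoef phi j) sqr_cabs; case: (fcoef phi j) => x y.
    by apply: complex_eqP => /=; ring.
  by rewrite Re_sum.
have DCT := @dominated_convergence _ _ R mu D (measurable_itv _)
  (fun n x => (Re (fsum n.+1 x * (phi x)^*))%:E)
  (fun x => (beta^-1 * cabs (phi x) ^+ 2)%:E) (fun=> M%:E).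
have [||||| _ _ hc] := DCT.
- by move=> n; apply/measurable_EFinP; apply: measurable_funTS; case: (bfp n.+1) => -[].
- apply/measurable_EFinP; apply: measurable_funTS; apply: measurable_funM; first exact: measurable_cst.
  exact: measurable_cabs2 bphi.1.
- apply: aeW => x _; apply: cvg_EFin; first exact: nearW.
  apply/cvgrPdist_le => e e0.
  have K1 : 0 < K + 1 by rewrite ltr_wpDl.
  have [N0 hN0] := fsum_cvg x (divr_gt0 e0 K1).
  exists N0 => // n /= hn; have := hN0 n.+1 (leqW hn) => h1.
  rewrite distrC (_ : _ - _ = Re ((fsum n.+1 x - (beta^-1)%:C * phi x) * (phi x)^*)); last first.
    by rewrite sqr_cabs; case: (phi x) (fsum _ _) => [y1 y2] [z1 z2] /=; ring.
  apply: (le_trans (Re_le_cabs _)); rewrite cabsM cabsJ.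
  apply: (@le_trans _ _ (e / (K + 1) * K)); first by apply: ler_pM; rewrite ?cabs_ge0.
  by rewrite mulrAC ler_pdivrMr // ler_wpM2l ?(ltW e0) // lerDl.
- have := @integrable_bounded_itv R (fun=> M) `|M| 0 beta^-1; apply; first exact: measurable_cst.
  by [].
- apply: aeW => x n _; rewrite lee_fin; apply: (le_trans (Re_le_cabs _)); rewrite cabsM cabsJ.
  apply: ler_pM; rewrite ?cabs_ge0 ?hK //.
  by apply: (le_trans (fsum_bound _ _)) => //; rewrite lerD2r ler_wpM2l // ltW.
have bp2 : bmeas (fun x => (cabs (phi x) ^+ 2)%:C).
  have := bmeasM bphi (bmeasJ bphi); congr bmeas; apply/funext => x.
  by rewrite sqr_cabs; case: (phi x) => y z; apply: complex_eqP => /=; ring.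
have i2 := bmeas_Re 0 beta^-1 bp2.
rewrite -RintegralZl //.
have i3 : mu.-integrable D (EFin \o (fun x => beta^-1 * cabs (phi x) ^+ 2)) by exact: integrable_Zl.
rewrite -(cvg_shiftS (fun N => \sum_(j <- zrange N) _)).
under eq_fun do rewrite intE.
apply: fine_cvg; rewrite fineK; first exact: hc.
exact: integrable_fin_num.
Qed.

End Chordal.
End Fourier.

(** * Parseval over one period; Lipschitz estimates *)

Section DenseClass.
Variable R : realType.
Local Notation C := R[i].
Local Notation mu := (@lebesgue_measure R).

Section Fold.
Variables (beta : R) (beta0 : 0 < beta) (phi : R -> C) (L : R).
Hypotheses (phiL : clipschitz L phi)
  (phiP : forall x, 0 <= x <= beta^-1 -> phi (x + beta^-1) = phi x).
Local Notation D := (`[0, beta^-1]%classic : set R).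

(** Points of the period that are far apart are close on the circle across the
    ends 0 and 1 / beta, where phi takes the same value. *)
Lemma chordal_lip x y : 0 <= x <= beta^-1 -> 0 <= y <= beta^-1 ->
  cabs (phi y - phi x) <= L / (pi * beta) * cabs (fexp beta 1 y - fexp beta 1 x).
Proof.
wlog xy : x y / x <= y.
  move=> h hx hy; have [xy|/ltW yx] := leP x y; first exact: h.
  by rewrite cabsB [cabs (fexp _ _ _ - _)]cabsB; exact: h.
move=> hx hy.
have pi0 := pi_gt0 R.
have L0 : 0 <= L := clipschitz_ge0 phiL.
have main u d : `|beta * d| <= 2^-1 -> cabs (phi (u + d) - phi u) <= L / (pi * beta) * cabs (expi (beta * d) - 1).
  move=> hd; apply: (le_trans (phiL _ _)); rewrite addrC addKr.
  have c := chord_ge hd; rewrite normrM (gtr0_norm beta0) in c.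
  rewrite -mulrA; apply: ler_wpM2l => //.
  by rewrite mulrC ler_pdivlMr ?mulr_gt0 // mulrC -mulrA.
have -> : cabs (fexp beta 1 y - fexp beta 1 x) = cabs (expi (beta * (y - x)) - 1).
  rewrite -[RHS]mul1r -(cabs_fexp beta 1 x) -cabsM mulrBr mulr1; congr (cabs (_ - _)).
  by rewrite /fexp mulr1 -expiD; congr expi; ring.
have bb : beta * beta^-1 = 1 by rewrite mulfV // gt_eqF.
(* Beyond half a period the short way from x to y starts from x + 1 / beta. *)
have [small|big] := leP (beta * (y - x)) 2^-1.
  have := main x (y - x); rewrite [x + _]addrC subrK; apply.
  by rewrite ger0_norm // mulr_ge0 ?subr_ge0 // ltW.
have := main (x + beta^-1) (y - x - beta^-1).
rewrite phiP // (_ : x + beta^-1 + (y - x - beta^-1) = y); last by ring.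
have -> : expi (beta * (y - x - beta^-1)) = expi (beta * (y - x)).
  by rewrite mulrBr bb expiD expiN expi1 conjc1 mulr1.
apply.
have : beta * (y - x) <= 1.
  rewrite -bb ler_pM2l //; case/andP: hx => ? _; case/andP: hy => _ ?; lra.
move=> le1; rewrite [beta * (y - x - _)]mulrBr bb ler_norml; apply/andP; split; lra.
Qed.

Definition fold (x : R) : R := x - beta^-1 * (Num.floor (beta * x))%:~R.

Lemma fold_itv x : 0 <= fold x <= beta^-1.
Proof.
have bb : beta * beta^-1 = 1 by rewrite mulfV // gt_eqF.
have := floor_itv (beta * x); rewrite intrD => /andP[f1 f2].
have e : fold x = beta^-1 * (beta * x - (Num.floor (beta * x))%:~R).
  by rewrite /fold mulrBr mulKf // gt_eqF.
have b0 : 0 < beta^-1 by rewrite invr_gt0.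
rewrite e; apply/andP; split; first by rewrite mulr_ge0 ?(ltW b0) // subr_ge0.
by rewrite -[leRHS]mulr1 ler_pM2l //; lra.
Qed.

Lemma fexp_fold x : fexp beta 1 (fold x) = fexp beta 1 x.
Proof.
rewrite /fexp /fold mulr1 mulrBr mulVKf ?gt_eqF // expiD -mulrNz expi_int mulr1 //.
Qed.

(** The functions of interest are sums of finitely many translates and are
    periodic on [0, 1 / beta] only, so Parseval's identity is applied to the
    periodic extension of phi from this interval. *)
Lemma parseval_fold :
  (\sum_(j <- zrange N) cabs (fcoef beta phi j) ^+ 2) @[N --> \oo] --> beta^-1 * \int[mu]_(x in D) (cabs (phi x) ^+ 2).
Proof.
pose psi x := phi (fold x).
have lip x y : cabs (psi y - psi x) <= L / (pi * beta) * cabs (fexp beta 1 y - fexp beta 1 x).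
  by rewrite -(fexp_fold y) -(fexp_fold x); apply: chordal_lip; exact: fold_itv.
have L0 : 0 <= L := clipschitz_ge0 phiL.
have LL0 : 0 <= L / (pi * beta) by rewrite divr_ge0 // mulr_ge0 ?pi_ge0 // ltW.
have b0 : 0 < beta^-1 by rewrite invr_gt0.
have psiP x : psi (x + beta^-1) = psi x.
  rewrite /psi /fold mulrDr mulfV ?gt_eqF // (floor_addz _ 1) intrD.
  by congr phi; ring.
have psiD x : D x -> psi x = phi x.
  rewrite /= in_itv /= => /andP[x0 x1].
  have [xb|xb] := ltP x beta^-1.
    rewrite /psi /fold (_ : Num.floor _ = 0) ?mulr0 ?subr0 //.
    apply/eqP; rewrite floor_eq /= mulr_ge0 ?(ltW beta0) //=.
    by rewrite -(mulfV (lt0r_neq0 beta0)) ltr_pM2l.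
  have -> : x = 0 + beta^-1 by rewrite add0r; apply/eqP; rewrite eq_le x1.
  rewrite psiP phiP ?lexx ?(ltW b0) // /psi /fold mulr0 floor0 mulr0 subr0 //.
have psiK x : cabs (psi x) <= cabs (phi 0) + L * beta^-1.
  have := cabsD (phi 0) (psi x - phi 0); rewrite [phi 0 + _]addrC subrK => h; apply: (le_trans h).
  rewrite lerD2l; apply: (le_trans (phiL _ _)); rewrite subr0 ler_wpM2l //.
  by have /andP[h1 h2] := fold_itv x; rewrite ger0_norm.
have := parseval beta0 LL0 lip psiK.
rewrite (_ : (fun N => _) = (fun N => \sum_(j <- zrange N) cabs (fcoef beta phi j) ^+ 2)); last first.
  apply/funext => N; apply: eq_bigr => j _; congr (cabs _ ^+ 2).
  by apply: eq_cint => x /psiD ->.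
have -> : \int[mu]_(x in D) (cabs (psi x) ^+ 2) = \int[mu]_(x in D) (cabs (phi x) ^+ 2).
  by apply: eq_Rintegral => x; rewrite inE => /psiD ->.
by [].
Qed.

End Fold.

(** A Lipschitz bound for the exponential that is valid for all w. *)
Lemma cexp_sub1_le (w : C) : cabs (cexp w - 1) <= 2 * cabs w * (1 + cabs (cexp w)).
Proof.
rewrite cabs_cexp; case: w => s t /=.
have r1 := Re_le_cabs (s +i* t); have r2 := Im_le_cabs (s +i* t); rewrite /= in r1 r2.
set u := expi (t / (2 * pi)).
have pi0 := pi_gt0 R.
have ew : cexp (s +i* t) = (expR s)%:C * u by exact: cexp_polar.
have -> : cexp (s +i* t) - 1 = (expR s - 1)%:C + (expR s)%:C * (u - 1).
  by rewrite ew rmorphB /=; ring.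
apply: (le_trans (cabsD _ _)); rewrite cabsM !cabs_real (ger0_norm (expR_ge0 s)).
have u1 : cabs (u - 1) <= `|t|.
  have := chord_le (t / (2 * pi)).
  rewrite normrM normfV (ger0_norm (_ : 0 <= 2 * pi)); last by rewrite mulr_ge0 ?pi_ge0.
  by rewrite [2 * pi * _]mulrC divfK // mulf_neq0 ?pnatr_eq0 // gt_eqF.
have e1 : `|expR s - 1| <= `|s| * (1 + expR s).
  have h1 := expR_ge1Dx s; have h2 := expR_ge1Dx (- s).
  have h3 : expR s * expR (- s) = 1 by rewrite expRxMexpNx_1.
  have k2 : 0 <= expR s * (expR (- s) - 1 + s) by rewrite mulr_ge0 ?expR_ge0 //; lra.
  have e0 := expR_gt0 s.
  have [s0|s0] := leP 0 s.
    rewrite (ger0_norm s0) ger0_norm; lra.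
  have k3 : 0 <= - s * expR s by rewrite mulr_ge0 ?expR_ge0 //; lra.
  have k4 : expR s <= 1 by rewrite expR_le1 ltW.
  rewrite (ltr0_norm s0) ler0_norm; lra.
have e0 := expR_gt0 s.
have s1 := ler_wpM2r (_ : 0 <= 1 + expR s) r1; have s2 := ler_wpM2l (ltW e0) u1.
have s3 := ler_wpM2l (ltW e0) r2; have c0 := cabs_ge0 (s +i* t).
have := s1 (addr_ge0 ler01 (ltW e0)); lra.
Qed.

(** g(x) - g(y) = g(y) (e^w - 1) with w = O(|x - y| (1 + |x| + |y|)), and the
    factor in |x| + |y| is absorbed by the decay of g when |x - y| < 1. *)
Lemma gaussian_lip (a b c : C) : Re a < 0 ->
  exists L, clipschitz L (gauss a b c).
Proof.
move=> a0; have [G G0 hG] := gaussian_bounded b c a0.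
have [G' G'0 hG'] : exists2 G', 0 < G' & forall x, `|x| * cabs (gauss a b c x) <= G'.
  set A := - Re a; have A0 : 0 < A by rewrite oppr_gt0.
  exists (expR ((`|Re b| + 1) ^+ 2 / (4 * A)) * expR (Re c)).
    by rewrite mulr_gt0 ?expR_gt0.
  move=> x; rewrite cabs_gaussian.
  have h1 : `|x| <= expR `|x| by apply: le_trans (expR_ge1Dx _); rewrite lerDr.
  apply: (le_trans (ler_wpM2r (expR_ge0 _) h1)).
  apply: (@le_trans _ _ (expR (- A * `|x| ^+ 2 + (`|Re b| + 1) * `|x|) * expR (Re c))).
    rewrite -!expRD ler_expR real_normK ?num_real // /A opprK.
    have := ler_norm (Re b * x); rewrite normrM; lra.
  by rewrite ler_wpM2r ?expR_ge0 // expR_quadratic_le.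
pose N := cabs a * (4 * G' + 2 * G) + cabs b * (2 * G).
exists (2 * N + 2 * G) => x y.
set g := gauss a b c.
have N0 : 0 <= N by rewrite addr_ge0 // mulr_ge0 ?cabs_ge0 //; lra.
have d0 := normr_ge0 (x - y).
have [far|near] := leP 1 `|x - y|.
  apply: (le_trans (cabsD _ _)); rewrite cabsN.
  have := hG x; have := hG y; rewrite -/g.
  have : (2 * N + 2 * G) * 1 <= (2 * N + 2 * G) * `|x - y| by rewrite ler_wpM2l //; lra.
  lra.
pose w : C := (x - y)%:C * (a * (x + y)%:C + b).
have gx : g x = g y * cexp w.
  rewrite /g /extended_gaussian -cexpD; congr cexp; rewrite /w rmorphB rmorphD /=; ring.
have -> : g x - g y = g y * (cexp w - 1) by rewrite gx; ring.
have cw : cabs w <= `|x - y| * (cabs a * (`|x| + `|y|) + cabs b).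
  rewrite cabsM cabs_real ler_wpM2l // (le_trans (cabsD _ _)) // lerD2r cabsM cabs_real.
  by rewrite ler_wpM2l ?cabs_ge0 // ler_normD.
rewrite cabsM; apply: (le_trans (ler_wpM2l (cabs_ge0 _) (cexp_sub1_le w))).
rewrite (_ : cabs (g y) * (2 * cabs w * (1 + cabs (cexp w))) = 2 * cabs w * (cabs (g y) + cabs (g y) * cabs (cexp w))); last by ring.
rewrite -cabsM -gx.
have gy0 := cabs_ge0 (g y); have gx0 := cabs_ge0 (g x).
have yx : `|y| <= `|x| + 1 by have := ler_normB x (x - y); rewrite (_ : x - (x - y) = y); [lra | ring].
have xy : `|x| <= `|y| + 1 by have := ler_normD y (x - y); rewrite (_ : y + (x - y) = x); [lra | ring].
have key : (cabs a * (`|x| + `|y|) + cabs b) * (cabs (g y) + cabs (g x)) <= N.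
  have q1 : (`|x| + `|y|) * (cabs (g y) + cabs (g x)) <= 4 * G' + 2 * G.
    have p1 := ler_wpM2r gy0 xy; have p2 := ler_wpM2r gx0 yx.
    have := hG' x; have := hG' y; have := hG x; have := hG y; rewrite -/g; lra.
  have q2 : cabs (g y) + cabs (g x) <= 2 * G by have := hG x; have := hG y; rewrite -/g; lra.
  rewrite mulrDl; apply: lerD; last by rewrite ler_wpM2l ?cabs_ge0.
  by rewrite -mulrA ler_wpM2l ?cabs_ge0.
have := ler_wpM2l d0 key.
have := ler_wpM2r (addr_ge0 gy0 gx0) cw.
have := mulr_ge0 (ltW G0) d0.
lra.
Qed.

Lemma clipschitzJ L (F : R -> C) : clipschitz L F -> clipschitz L (fun x => (F x)^*).
Proof.
move=> h x y; rewrite (_ : _ - _ = (F x - F y)^*) ?cabsJ //.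
by case: (F x) (F y) => [x1 x2] [y1 y2]; apply: complex_eqP => /=; ring.
Qed.

Lemma clipschitz_shift L (F : R -> C) s : clipschitz L F -> clipschitz L (fun x => F (x + s)).
Proof. by move=> h x y; apply: (le_trans (h _ _)); rewrite (_ : x + s - (y + s) = x - y) //; ring. Qed.

Lemma clipschitzM L L' K K' (F G : R -> C) : clipschitz L F -> clipschitz L' G ->
  (forall x, cabs (F x) <= K) -> (forall x, cabs (G x) <= K') ->
  clipschitz (K * L' + K' * L) (fun x => F x * G x).
Proof.
move=> hF hG kF kG x y.
rewrite (_ : _ - _ = F x * (G x - G y) + G y * (F x - F y)); last by ring.
apply: (le_trans (cabsD _ _)); rewrite !cabsM mulrDl -!mulrA.
by apply: lerD; apply: ler_pM; rewrite ?cabs_ge0 // ?hF ?hG.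
Qed.

Lemma clipschitz_sum (I : Type) (s : seq I) L (F : I -> R -> C) : (forall i, clipschitz L (F i)) ->
  clipschitz ((size s)%:R * L) (fun x => \sum_(i <- s) F i x).
Proof.
move=> h x y; elim: s => [|i s IH]; first by rewrite !big_nil subrr cabs0 !mul0r.
rewrite !big_cons opprD addrACA; apply: (le_trans (cabsD _ _)).
apply: (le_trans (lerD (h i x y) IH)); rewrite /= -natr1.
by apply: le_of_eq; ring.
Qed.

End DenseClass.

(** * Unfolding integrals over the line into periods *)

Section Unfold.
Variable R : realType.
Local Notation C := R[i].
Local Notation mu := (@lebesgue_measure R).

Lemma integrable_cont (G : R -> R) u v : continuous G -> mu.-integrable `[u, v] (EFin \o G).
Proof.
move=> cG; apply: continuous_compact_integrable; first exact: segment_compact.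
exact: continuous_subspaceT.
Qed.

Lemma Rintegral_chasles (G : R -> R) u v w : continuous G -> u <= v -> v <= w ->
  \int[mu]_(x in `[u, w]) G x = \int[mu]_(x in `[u, v]) G x + \int[mu]_(x in `[v, w]) G x.
Proof.
move=> cG uv vw.
have := @Rintegral_itvB R G (BLeft u) (BRight w) v (integrable_cont u w cG).
rewrite !bnd_simp => /(_ uv vw) e.
rewrite -(@Rintegral_itv_obnd_cbnd R v (BRight w)).
  by rewrite -e addrC subrK.
apply: integrableS (integrable_cont v w cG) => //.
by apply: subset_itvr; rewrite bnd_simp.
Qed.

Lemma Rintegral_shift (G : R -> R) u v s : continuous G -> u <= v ->
  \int[mu]_(x in `[u + s, v + s]) G x = \int[mu]_(x in `[u, v]) G (x + s).
Proof.
move=> cG uv.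
have dF (x : R) : is_derive x 1 (fun x : R => x + s) 1.
  by have := @is_deriveD R _ _ (id : R -> R) (fun=> s) x 1 1 0 _ _; rewrite addr0; apply.
have F' : derive1 (fun x : R => x + s) = fun=> 1.
  by apply/funext => x; rewrite derive1E; apply: derive_val.
have cF : continuous (fun x : R => x + s).
  by move=> x; apply: cvgD; [exact: cvg_id | exact: cvg_cst].
rewrite /Rintegral; congr fine.
rewrite (@integration_by_substitution_increasing R (fun x => x + s) G u v uv).
- by apply: eq_integral => x _; rewrite F' /= mulr1.
- by move=> x y _ _; rewrite ltrD2r.
- by rewrite F' => x _; exact: cvg_cst.
- by rewrite F'; exact: is_cvg_cst.
- by rewrite F'; exact: is_cvg_cst.
- split.
  + by move=> x _; have := dF x; case.
  + by apply: cvg_at_right_filter; exact: cF.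
  + by apply: cvg_at_left_filter; exact: cF.
- exact: continuous_subspaceT.
Qed.

Lemma Rintegral_unfold (G : R -> R) (lam : R) M : continuous G -> 0 <= lam ->
  \int[mu]_(x in `[- (lam * M%:R), lam * M%:R]) G x =
  \sum_(l <- zrange M) \int[mu]_(x in `[0, lam]) G (x + lam * l%:~R).
Proof.
move=> cG la0; elim: M => [|M IH].
  rewrite mulr0 oppr0 big_zrange !big_ord0 addr0.
  by rewrite set_itv1 Rintegral_set1.
have M0 : 0 <= lam * M%:R by rewrite mulr_ge0.
have e1 : lam * M.+1%:R = lam * M%:R + lam by rewrite -natr1 mulrDr mulr1.
rewrite big_zrangeS -IH.
rewrite (Rintegral_chasles (u := - (lam * M.+1%:R)) (v := - (lam * M%:R))) //; last 2 first.
- by rewrite e1; lra.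
- by rewrite e1; lra.
rewrite (Rintegral_chasles (u := - (lam * M%:R)) (v := lam * M%:R)) //; last 2 first.
- by lra.
- by rewrite e1; lra.
rewrite addrCA; congr (_ + _); rewrite addrC; congr (_ + _).
  have := @Rintegral_shift G 0 lam (lam * M%:R) cG la0; rewrite add0r => <-.
  by rewrite e1 addrC.
have := @Rintegral_shift G 0 lam (lam * (Negz M)%:~R) cG la0; rewrite add0r => <-.
rewrite NegzE mulrNz mulrN -pmulrn (_ : lam + - _ = - (lam * M%:R)) //.
by rewrite e1; lra.
Qed.

Lemma Rintegral_support (G : R -> R) (T : R) : (forall x, T < `|x| -> G x = 0) ->
  \int[mu]_x G x = \int[mu]_(x in `[- T, T]) G x.
Proof.
move=> hG; rewrite [RHS]Rintegral_mkcond; apply: eq_Rintegral => x _.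
rewrite patchE; case: ifPn => // /negP; rewrite inE /= in_itv /= => h.
by rewrite hG // ltNge; apply/negP => hx; apply: h; rewrite -ler_norml.
Qed.

Lemma integral_support (G : R -> R) (T : R) : continuous G -> (forall x, T < `|x| -> G x = 0) ->
  (\int[mu]_x (G x)%:E)%E = (\int[mu]_x G x)%:E.
Proof.
move=> cG hG; rewrite /Rintegral fineK //.
have -> : (\int[mu]_x (G x)%:E)%E = (\int[mu]_(x in `[(- T)%R, T]) (G x)%:E)%E.
  rewrite [RHS]integral_mkcond; apply: eq_integral => x _.
  rewrite patchE; case: ifPn => // /negP; rewrite inE /= in_itv /= => h.
  by rewrite hG // ltNge; apply/negP => hx; apply: h; rewrite -ler_norml.
by apply: integrable_fin_num => //; exact: integrable_cont.
Qed.

(** Regular enough for [parseval_fold], and dense in the square-integrable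
    functions. *)
Definition test_function (f : R -> C) : Prop :=
  exists L T, [/\ 0 <= T, clipschitz L f & forall x, T <= `|x| -> f x = 0].

Lemma test_function_bounded f : test_function f -> exists K, forall x, cabs (f x) <= K.
Proof.
move=> [L [T [T0 fL fT]]]; exists (L * (2 * T)) => x.
have L0 : 0 <= L := clipschitz_ge0 fL.
have [h|h] := leP T `|x|; first by rewrite fT // cabs0 !mulr_ge0.
have fT0 : f T = 0 by apply: fT; rewrite ger0_norm.
have := fL x T; rewrite fT0 subr0 => hx; apply: (le_trans hx).
rewrite ler_wpM2l // (le_trans (ler_normB _ _)) // (ger0_norm T0); lra.
Qed.

Definition energy (f : R -> C) : R := \int[mu]_x (cabs (f x) ^+ 2).

Lemma cabs2_continuous L (f : R -> C) : clipschitz L f -> continuous (fun x => cabs (f x) ^+ 2).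
Proof.
move=> fL; have -> : (fun x => cabs (f x) ^+ 2) = (fun x => Re (f x) ^+ 2 + Im (f x) ^+ 2).
  by apply/funext => x; rewrite sqr_cabs.
by move=> x; apply: cvgD; rewrite !expr2; apply: cvgM; first
  [exact: (clipschitz_Re fL) | exact: (clipschitz_Im fL)].
Qed.

Lemma sqL2norm_test_function f : test_function f -> sqL2norm f = (energy f)%:E.
Proof.
move=> [L [T [T0 fL fT]]]; apply: (@integral_support _ T).
  exact: cabs2_continuous fL.
by move=> x /ltW hx; rewrite fT // cabs0 expr0n.
Qed.

Lemma innerE (f h : R -> C) : inner f h = cint [set: R] (fun x => f x * (h x)^*).
Proof. by []. Qed.

Lemma cint_unfold (F : R -> C) L (lam : R) M : clipschitz L F -> 0 <= lam ->
  (forall x, lam * M%:R < `|x| -> F x = 0) ->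
  cint [set: R] F = \sum_(l <- zrange M) cint `[0, lam] (fun x => F (x + lam * l%:~R)).
Proof.
move=> FL la0 hF; apply: complex_eqP; rewrite ?Re_sum ?Im_sum /=.
  rewrite (@Rintegral_support _ (lam * M%:R)); last by move=> x /hF ->.
  exact: (Rintegral_unfold M (clipschitz_Re FL) la0).
rewrite (@Rintegral_support _ (lam * M%:R)); last by move=> x /hF ->.
exact: (Rintegral_unfold M (clipschitz_Im FL) la0).
Qed.

End Unfold.

(** * Frame inequalities on test functions *)

Section DenseFrame.
Variable R : realType.
Local Notation C := R[i].
Local Notation mu := (@lebesgue_measure R).
Variables (a b c : C) (alpha beta : R).
Hypotheses (a0 : Re a < 0) (al0 : 0 < alpha) (be0 : 0 < beta) (ab1 : alpha * beta < 1).
Local Notation g := (gauss a b c).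
Local Notation lam := (beta^-1).
Local Notation D := (`[0, beta^-1]%classic : set R).

Let lam0 : 0 < lam. Proof. by rewrite invr_gt0. Qed.
Let al_lam : alpha < lam. Proof. by rewrite -[ltRHS]mul1r ltr_pdivlMr. Qed.

Section OneFunction.
Variables (f : R -> C) (L T : R) (M : nat).
Hypotheses (fL : clipschitz L f) (T0 : 0 <= T) (fT : forall x, T <= `|x| -> f x = 0)
  (TM : T <= lam * (M%:R - 1)).

Definition windowed (k : int) (x : R) : C := f x * (g (x - alpha * k%:~R))^*.
(** The lam-periodization of the windowed function, restricted to a
    range of shifts outside of which it vanishes on [0, lam]. *)
Definition periodized (k : int) (x : R) : C := \sum_(l <- zrange M) windowed k (x + lam * l%:~R).

Lemma windowed_bounded k : exists K, forall x, cabs (windowed k x) <= K.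
Proof.
have [K1 h1] : exists K, forall x, cabs (f x) <= K by apply: test_function_bounded; exists L, T.
have [K2 K20 h2] := gaussian_bounded b c a0.
by exists (K1 * K2) => x; rewrite cabsM cabsJ ler_pM ?cabs_ge0.
Qed.

Lemma windowed_clipschitz k : exists L', clipschitz L' (windowed k).
Proof.
have [K1 h1] : exists K, forall x, cabs (f x) <= K by apply: test_function_bounded; exists L, T.
have [K2 K20 h2] := gaussian_bounded b c a0.
have [L2 hL2] := gaussian_lip b c a0.
exists (K1 * L2 + K2 * L); apply: clipschitzM => //; first exact: clipschitzJ (clipschitz_shift _ hL2).
by move=> x; rewrite cabsJ.
Qed.

Lemma windowed0 k x : T <= `|x| -> windowed k x = 0.
Proof. by move=> h; rewrite /windowed fT // mul0r. Qed.

Lemma periodized_clipschitz k : exists L', clipschitz L' (periodized k).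
Proof.
have [L' hL'] := windowed_clipschitz k.
exists ((size (zrange M))%:R * L'); apply: clipschitz_sum => l; exact: clipschitz_shift.
Qed.

Let TlamM : T <= lam * M%:R.
Proof. by apply: (le_trans TM); rewrite ler_pM2l //; lra. Qed.

Lemma periodized_periodic k x : 0 <= x <= lam -> periodized k (x + lam) = periodized k x.
Proof.
move=> /andP[x0 x1]; apply/eqP; rewrite -subr_eq0 -oppr_eq0 opprB /periodized -sumrB.
under eq_bigr => l _.
  rewrite (_ : x + lam + lam * l%:~R = x + lam * (l + 1)%:~R); last by rewrite intrD; ring.
  over.
rewrite (telescope_zrange M (fun l => windowed k (x + lam * l%:~R))).
rewrite !windowed0 ?subrr //.
  have := mulrBr lam M%:R 1; rewrite mulr1 => e; have TM2 := TM; rewrite e in TM2.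
  by rewrite -[M%:~R]/(M%:R) ger0_norm ?addr_ge0 ?mulr_ge0 ?(ltW lam0) //; lra.
have := mulrBr lam M%:R 1; rewrite mulr1 => e; have TM2 := TM; rewrite e in TM2.
rewrite mulrNz mulrN -[M%:~R]/(M%:R) -normrN opprB.
by apply: le_trans (ler_norm _); lra.
Qed.

(** e^{2 pi i beta j x} has period 1 / beta, so the integral over the line
    folds to one period. *)
Lemma inner_atom j k : inner f (gabor_atom g alpha beta (j, k)) = fcoef beta (periodized k) j.
Proof.
have [L' wL] := windowed_clipschitz k; have [K wK] := windowed_bounded k.
have bw (l : int) : bmeas (fun x => windowed k (x + lam * l%:~R) * (fexp beta j x)^*).
  apply: bmeasM; last by apply: bmeasJ; exact: bmeas_fexp.
  by split; [exact: clipschitz_cmeas (clipschitz_shift _ wL) | exists K].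
rewrite innerE.
pose P x := windowed k x * (fexp beta j x)^*.
have -> : (fun x => f x * (gabor_atom g alpha beta (j, k) x)^*) = P.
  apply/funext => x; rewrite /P /windowed /gabor_atom /modulation /translation conjcM /fexp.
  by rewrite [X in _ * X]mulrC mulrA.
have PL : clipschitz (K * (2 * pi * (beta * `|j%:~R|)) + 1 * L') P.
  apply: clipschitzM => //; first by apply: clipschitzJ; exact: fexp_lip.
  by move=> x; rewrite cabsJ cabs_fexp.
rewrite (cint_unfold (M := M) PL (ltW lam0)); last first.
  by move=> x hx; rewrite /P windowed0 ?mul0r // (le_trans TlamM) // ltW.
rewrite /fcoef.
transitivity (cint D (fun x => \sum_(l <- zrange M) windowed k (x + lam * l%:~R) * (fexp beta j x)^*)).
  rewrite cint_sum //; apply: eq_bigr => l _; apply: eq_cint => x _; rewrite /P; congr (_ * conjc _).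
  rewrite /fexp mulrDr expiD [X in _ * expi X](_ : _ = (j * l)%:~R) ?expi_int ?mulr1 //.
  rewrite intrM mulrACA [beta * _ * _](_ : _ = j%:~R * l%:~R * (beta * lam)); last by ring.
  by rewrite mulfV ?gt_eqF // mulr1.
by apply: eq_cint => x _; rewrite /periodized mulr_suml.
Qed.

Lemma energy_unfold : energy f = \int[mu]_(x in D) (\sum_(l <- zrange M) cabs (f (x + lam * l%:~R)) ^+ 2).
Proof.
have cf := cabs2_continuous fL.
rewrite /energy (@Rintegral_support _ _ (lam * M%:R)); last first.
  by move=> x hx; rewrite fT ?cabs0 ?expr0n // (le_trans TlamM) // ltW.
rewrite (Rintegral_unfold M cf (ltW lam0)).
have ci (l : int) : continuous (fun x => cabs (f (x + lam * l%:~R)) ^+ 2).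
  exact: cabs2_continuous (clipschitz_shift _ fL).
elim: (zrange M) => [|l s IH].
  by rewrite big_nil; under eq_Rintegral do rewrite big_nil; rewrite Rintegral_cst // mul0r.
rewrite big_cons IH; under [in RHS]eq_Rintegral do rewrite big_cons.
rewrite RintegralD //; first exact: integrable_cont.
apply: integrable_cont; elim: s {IH} => [|i s IH].
  by under eq_fun do rewrite big_nil; move=> x; exact: cvg_cst.
by under eq_fun do rewrite big_cons; move=> x; apply: cvgD; [exact: ci|exact: IH].
Qed.

Lemma parseval_window k :
  (\sum_(j <- zrange N) cabs (inner f (gabor_atom g alpha beta (j, k))) ^+ 2) @[N --> \oo]
   --> lam * \int[mu]_(x in D) (cabs (periodized k x) ^+ 2).
Proof.
have [L' hL'] := periodized_clipschitz k.
rewrite (_ : (fun N => _) = (fun N => \sum_(j <- zrange N) cabs (fcoef beta (periodized k) j) ^+ 2)).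
  exact: (parseval_fold be0 hL' (@periodized_periodic k)).
by apply/funext => N; apply: eq_bigr => j _; rewrite inner_atom.
Qed.

Lemma bessel_window k s : uniq s ->
  \sum_(j <- s) cabs (inner f (gabor_atom g alpha beta (j, k))) ^+ 2 <= lam * \int[mu]_(x in D) (cabs (periodized k x) ^+ 2).
Proof.
move=> us; have [N sN] := seq_sub_zrange s.
apply: (cvgr_to_ge (@parseval_window k)).
exists N => // n /= Nn; apply: ler_sum_sub => //; [exact: zrange_uniq| |by move=> j; exact: sqr_ge0].
by move=> j /sN; rewrite !mem_zrange; lia.
Qed.

(** Conjugation brings the periodization to the form of the sampling
    inequalities, with d_l = conj(f(x + lam l)). *)
Lemma cabs_periodized k x : cabs (periodized k x) =
  cabs (\sum_(l <- zrange M) (f (x + lam * l%:~R))^* * g (x + lam * l%:~R - alpha * k%:~R)).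
Proof.
rewrite -cabsJ; congr (cabs _); rewrite /periodized.
elim: (zrange M) => [|l s IH]; first by rewrite !big_nil conjc0.
rewrite !big_cons -IH /windowed.
set z := \sum_(_ <- _) _.
by case: (f _) (g _) z => [x1 y1] [x2 y2] [x3 y3]; apply: complex_eqP => /=; ring.
Qed.

Lemma periodized_sum_integral (s : seq int) :
  \int[mu]_(x in D) (\sum_(k <- s) cabs (periodized k x) ^+ 2) =
  \sum_(k <- s) \int[mu]_(x in D) (cabs (periodized k x) ^+ 2) /\
  continuous (fun x => \sum_(k <- s) cabs (periodized k x) ^+ 2).
Proof.
have ci k : continuous (fun x => cabs (periodized k x) ^+ 2).
  by have [L' hL'] := periodized_clipschitz k; exact: cabs2_continuous hL'.
elim: s => [|k s [IH1 IH2]].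
  split; first by rewrite big_nil; under eq_Rintegral do rewrite big_nil; rewrite Rintegral_cst // mul0r.
  by under eq_fun do rewrite big_nil; move=> x; exact: cvg_cst.
split; last by under eq_fun do rewrite big_cons; move=> x; apply: cvgD; [exact: ci|exact: IH2].
rewrite big_cons -IH1; under [in LHS]eq_Rintegral do rewrite big_cons.
by rewrite RintegralD //; exact: integrable_cont.
Qed.

Lemma shifts_continuous : continuous (fun x => \sum_(l <- zrange M) cabs (f (x + lam * l%:~R)) ^+ 2).
Proof.
have ci (l : int) : continuous (fun x => cabs (f (x + lam * l%:~R)) ^+ 2).
  exact: cabs2_continuous (clipschitz_shift _ fL).
elim: (zrange M) => [|i s IH].
  by under eq_fun do rewrite big_nil; move=> x; exact: cvg_cst.
by under eq_fun do rewrite big_cons; move=> x; apply: cvgD; [exact: ci|exact: IH].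
Qed.

End OneFunction.

Lemma test_function_cover f : test_function f -> exists L T M, [/\ clipschitz L f, 0 <= T,
  forall x, T <= `|x| -> f x = 0 & T <= lam * (M%:R - 1)].
Proof.
move=> [L [T [T0 fL fT]]]; exists L, T, (Num.bound (T * beta)).+1; split => //.
have := archi_boundP (mulr_ge0 T0 (ltW be0)).
by rewrite -natr1 addrK => /ltW h; rewrite -(ler_pM2l be0) mulrA mulfV ?gt_eqF // mul1r mulrC.
Qed.

(** Bessel's inequality in j, then [sampling_upper] at every x of a period. *)
Lemma test_function_upper : exists2 B, 0 < B & forall f (s1 s2 : seq int), test_function f -> uniq s1 -> uniq s2 ->
  \sum_(k <- s2) \sum_(j <- s1) cabs (inner f (gabor_atom g alpha beta (j, k))) ^+ 2 <= B * energy f.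
Proof.
have [B B0 hB] := sampling_upper b c a0 al0 lam0.
exists (lam * B); first by rewrite mulr_gt0.
move=> f s1 s2 /test_function_cover[L [T [M [fL T0 fT TM]]]] us1 us2.
apply: (@le_trans _ _ (\sum_(k <- s2) lam * \int[mu]_(x in D) (cabs (periodized f M k x) ^+ 2))).
  by apply: ler_sum => k _; apply: (bessel_window fL T0 fT TM).
rewrite -mulr_sumr -mulrA ler_wpM2l ?(ltW lam0) //.
have [<- cp] := periodized_sum_integral M fL T0 fT s2.
rewrite (energy_unfold fL fT TM).
have cs := shifts_continuous (M := M) fL.
rewrite -RintegralZl //; last exact: integrable_cont.
apply: le_Rintegral => //; first exact: integrable_cont.
  by apply: integrable_cont => x; apply: cvgMr; exact: cs.
move=> x _; under eq_bigr do rewrite cabs_periodized.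
apply: (le_trans (hB x (zrange M) s2 (fun l => (f (x + lam * l%:~R))^*) (zrange_uniq M) us2)).
by under eq_bigr do rewrite cabsJ.
Qed.

(** [sampling_lower] at every x of a period; finitely many k suffice since f
    has compact support, and Parseval's identity bounds the resulting integral. *)
Lemma test_function_lower : exists2 A, 0 < A & forall f X, test_function f ->
  (forall s1 s2 : seq int, uniq s1 -> uniq s2 ->
    \sum_(k <- s2) \sum_(j <- s1) cabs (inner f (gabor_atom g alpha beta (j, k))) ^+ 2 <= X) ->
  energy f <= A * X.
Proof.
have [B B0 hB] := sampling_lower b c a0 al0 al_lam.
exists (B / lam); first by rewrite divr_gt0.
move=> f X /test_function_cover[L [T [M [fL T0 fT TM]]]] hX.
(* The range Q contains all k within M + M of the cells of the points x + lam m, for x in one period and m in zrange M. *)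
pose Q := (Num.bound ((lam * (M%:R + 1)) / alpha) + M + M).+2.
pose s := zrange Q.
have us : uniq s by exact: zrange_uniq.
have sumX : \sum_(k <- s) (lam * \int[mu]_(x in D) (cabs (periodized f M k x) ^+ 2)) <= X.
  have h : (\sum_(k <- s) \sum_(j <- zrange N) cabs (inner f (gabor_atom g alpha beta (j, k))) ^+ 2) @[N --> \oo]
     --> \sum_(k <- s) (lam * \int[mu]_(x in D) (cabs (periodized f M k x) ^+ 2)).
    elim: (s) => [|k t IH].
      by under eq_fun do rewrite big_nil; rewrite big_nil; exact: cvg_cst.
    under eq_fun do rewrite big_cons; rewrite big_cons; apply: cvgD => //.
    exact: (parseval_window fL T0 fT TM).
  apply: (cvgr_to_le h); apply: nearW => N; apply: hX => //; exact: zrange_uniq.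
have [e1 cp] := periodized_sum_integral M fL T0 fT s.
rewrite -mulr_sumr -e1 in sumX.
rewrite (energy_unfold fL fT TM).
have cs := shifts_continuous (M := M) fL.
apply: (@le_trans _ _ (B * \int[mu]_(x in D) (\sum_(k <- s) cabs (periodized f M k x) ^+ 2))); last first.
  by rewrite -mulrA ler_wpM2l ?(ltW B0) // mulrC ler_pdivlMr // mulrC.
rewrite -RintegralZl //; last exact: integrable_cont.
apply: le_Rintegral => //; first exact: integrable_cont.
  by apply: integrable_cont => x; apply: cvgMr; exact: cp.
move=> x; rewrite /= in_itv /= => /andP[x0 x1].
under [in leRHS]eq_bigr do rewrite cabs_periodized.
have := hB x (zrange M) s (fun l => (f (x + lam * l%:~R))^*) (M + M)%N (zrange_uniq M) us.
under [in leLHS]eq_bigr do rewrite cabsJ.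
apply.
- by move=> l m; rewrite !mem_zrange => h1 h2; move: h1 h2; clear; lia.
move=> m; rewrite mem_zrange => /andP[m1 m2] k hk.
have Mr : `|m%:~R : R| <= M%:R.
  by rewrite -[M%:R]/(M%:~R) -intr_norm ler_int; move: m1 m2; clear; lia.
have nb : `|(x + lam * m%:~R) / alpha| <= lam * (M%:R + 1) / alpha.
  rewrite normrM normfV (gtr0_norm al0) ler_pM2r ?invr_gt0 //.
  apply: (le_trans (ler_normD _ _)); rewrite (ger0_norm x0) normrM (gtr0_norm lam0) mulrDr mulr1 addrC lerD //.
  by rewrite ler_wpM2l // ltW.
have qb := archi_boundP (le_trans (normr_ge0 _) nb).
set bd := Num.bound _ in qb.
set q := Num.floor _ in hk.
have [q1 q2] : (- (bd%:Z) - 1 <= q)%R /\ (q <= bd%:Z)%R.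
  have := floor_itv ((x + lam * m%:~R) / alpha); rewrite -/q intrD => /andP[f1 f2].
  move: nb; rewrite ler_norml => /andP[n1 n2].
  split; rewrite -(ler_int R) ?intrD ?mulrNz -?[bd%:~R]/(bd%:R); lra.
rewrite mem_zrange; move: hk q1 q2 m1 m2; rewrite /Q -/bd; clear; lia.
Qed.

End DenseFrame.

(** * Density of the test functions *)

Section Density.
Variable R : realType.
Local Notation C := R[i].
Local Notation mu := (@lebesgue_measure R).

Definition sqdist (u v : R -> R) : \bar R := (\int[mu]_x ((u x - v x) ^+ 2)%:E)%E.

Lemma sqdist_meas (u v : R -> R) : measurable_fun [set: R] u -> measurable_fun [set: R] v ->
  measurable_fun [set: R] (fun x => ((u x - v x) ^+ 2)%:E).
Proof.
move=> mu_ mv; apply/measurable_EFinP; apply: measurable_funX; exact: measurable_funB.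
Qed.

Lemma sqdist_triangle (u v w : R -> R) : measurable_fun [set: R] u -> measurable_fun [set: R] v ->
  measurable_fun [set: R] w -> (sqdist u w <= 2%:E * sqdist u v + 2%:E * sqdist v w)%E.
Proof.
move=> mu_ mv mw; rewrite /sqdist -!ge0_integralZl //; try exact: sqdist_meas; try by move=> x _; rewrite lee_fin sqr_ge0.
rewrite -ge0_integralD //; first last.
- by apply: measurable_funeM; exact: sqdist_meas.
- by move=> x _; rewrite -EFinM lee_fin mulr_ge0 ?sqr_ge0.
- by apply: measurable_funeM; exact: sqdist_meas.
- by move=> x _; rewrite -EFinM lee_fin mulr_ge0 ?sqr_ge0.
apply: ge0_le_integral => //.
- by move=> x _; rewrite lee_fin sqr_ge0.
- exact: sqdist_meas.
- by apply: emeasurable_funD; apply: measurable_funeM; exact: sqdist_meas.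
move=> x _; rewrite -!EFinM -EFinD lee_fin -subr_ge0.
set p := u x; set q := v x; set r := w x.
by rewrite (_ : _ - _ = (p - q - (q - r)) ^+ 2) ?sqr_ge0 //; ring.
Qed.

Lemma dominated_small (D : set R) (h : nat -> R -> R) (G : R -> R) eps : measurable D -> 0 < eps ->
  (forall n, measurable_fun D (h n)) -> mu.-integrable D (EFin \o G) ->
  (forall n x, D x -> `|h n x| <= G x) ->
  {ae mu, forall x, D x -> h n x @[n --> \oo] --> (0 : R)} ->
  exists n, (\int[mu]_(x in D) (h n x)%:E <= eps%:E)%E.
Proof.
move=> mD e0 mh iG hG hc.
have [] := @dominated_convergence _ _ _ mu D mD (fun n x => (h n x)%:E) (fun=> 0%E) (EFin \o G) _ _ _ iG.
- by move=> n; apply/measurable_EFinP; exact: mh.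
- exact: measurable_cst.
- apply: filterS hc; first exact: (ae_filter_ringOfSetsType mu).
  by move=> x hx Dx; apply: cvg_EFin; [exact: nearW | exact: hx].
- by apply: aeW => x n Dx /=; rewrite lee_fin hG.
move=> _ _; rewrite integral0 => /fine_cvgP[[n1 _ h1] /cvgrPdist_le/(_ _ e0)[n2 _ h2]].
exists (maxn n1 n2); have /= f1 := h1 (maxn n1 n2) (leq_maxl _ _).
have /= := h2 (maxn n1 n2) (leq_maxr _ _); rewrite -(fineK f1) lee_fin /= sub0r normrN.
by apply: le_trans; exact: ler_norm.
Qed.

Section Mollify.
Variables (v : R -> R) (N : R).
Hypotheses (mv : measurable_fun [set: R] v) (N0 : 0 <= N) (vN : forall x, `|v x| <= N)
  (v0 : forall x, N < `|x| -> v x = 0).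

Lemma bounded_support_integrable : mu.-integrable [set: R] (EFin \o v).
Proof.
have ig : mu.-integrable [set: R] (fun x => (N * \1_`[(- N)%R, N] x)%:E).
  under eq_fun do rewrite EFinM.
  by apply: integrableZl => //; exact: (integrable_indic_itv (- N) N true false).
apply: (le_integrable _ _ _ ig) => //.
  exact/measurable_EFinP.
move=> x _ /=; rewrite lee_fin; have [h|h] := leP `|x| N.
  rewrite indicE mem_set /=; first by rewrite mulr1 (ger0_norm N0).
  by rewrite in_itv /= -ler_norml.
by rewrite v0 // normr0.
Qed.

Local Notation F x := (\int[mu]_(t in `]-oo, x]) v t).

Let iv y : mu.-integrable `]-oo, y] (EFin \o v).
Proof. by apply: integrableS bounded_support_integrable. Qed.

Lemma primitive_diff x y : x <= y -> F y - F x = \int[mu]_(t in `]x, y]) v t.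
Proof.
move=> xy; have := @Rintegral_itvB R v -oo%O (BRight y) x (iv y).
by rewrite !bnd_simp; apply.
Qed.

Lemma primitive_lipschitz x y : `|F y - F x| <= N * `|y - x|.
Proof.
wlog xy : x y / x <= y.
  move=> h; have [/h//|/ltW/h] := leP x y; by rewrite distrC [in leRHS]distrC.
rewrite primitive_diff // (ger0_norm (_ : 0 <= y - x)) ?subr_ge0 //.
have i1 : mu.-integrable `]x, y] (EFin \o v) by apply: integrableS bounded_support_integrable.
apply: (le_trans (le_normr_Rintegral _ i1)) => //.
apply: (@le_trans _ _ (\int[mu]_(t in `]x, y]) N)).
  apply: le_Rintegral => //; first exact: integrable_norm.
  apply: integrableS (integrable_cont x y (G := fun=> N) _) => //; last by move=> z; exact: cvg_cst.
  by apply: subset_itvr; rewrite bnd_simp.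
rewrite Rintegral_cst //= lebesgue_measure_itv /= lte_fin.
by case: ifP => [_|h] //=; rewrite mulr0 mulr_ge0 // subr_ge0.
Qed.

Lemma primitive_const x y : x <= y -> (forall t, x < t <= y -> v t = 0) -> F y = F x.
Proof.
move=> xy h; apply/eqP; rewrite -subr_eq0 primitive_diff //.
rewrite (@eq_Rintegral _ _ _ _ _ (fun=> 0)); first by rewrite Rintegral_cst // mul0r.
by move=> t; rewrite inE /= in_itv /= => /h.
Qed.

(** The difference quotient of the primitive of v: Lipschitz since v is
    bounded, and convergent to v almost everywhere by Lebesgue's
    differentiation theorem. *)
Definition mollified (n : nat) (x : R) : R := n.+1%:R * (F (x + n.+1%:R^-1) - F x).

Lemma mollified_lip n x y : `|mollified n x - mollified n y| <= n.+1%:R * N * 2 * `|x - y|.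
Proof.
rewrite /mollified -mulrBr normrM ger0_norm // -!mulrA ler_wpM2l //.
have -> (p q r s : R) : p - q - (r - s) = (p - r) - (q - s) by ring.
apply: (le_trans (ler_normB _ _)).
have h1 := primitive_lipschitz (y + n.+1%:R^-1) (x + n.+1%:R^-1).
have h2 := primitive_lipschitz y x.
have e : x + n.+1%:R^-1 - (y + n.+1%:R^-1) = x - y by ring.
rewrite e in h1; rewrite mulr_natl mulr2n mulrDr; exact: lerD.
Qed.

Lemma mollified_bound n x : `|mollified n x| <= N.
Proof.
rewrite /mollified normrM ger0_norm //.
apply: (le_trans (ler_wpM2l _ (primitive_lipschitz _ _))) => //.
by rewrite addrAC subrr add0r ger0_norm ?invr_ge0 // mulrCA mulfV ?mulr1 ?pnatr_eq0.
Qed.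

Lemma inv_natS_le1 n : 0 <= (n.+1%:R^-1 : R) <= 1.
Proof. by rewrite invr_ge0 ler0n /= invf_le1 ?ltr0n // ler1n. Qed.

Lemma mollified_support n x : N + 1 < `|x| -> mollified n x = 0.
Proof.
move=> h; have /andP[n0 n1] := inv_natS_le1 n.
rewrite /mollified (@primitive_const x) ?subrr ?mulr0 //; first by rewrite lerDl.
move=> t /andP[t1 t2]; apply: v0; move: h; set y := n.+1%:R^-1 in n0 n1 t2 *; clearbody y.
move: N0 t1; case: (ger0P x) => x0; case: (ger0P t) => t0; lra.
Qed.

Lemma mollified_cvg : {ae mu, forall x, mollified ^~ x n @[n --> \oo] --> v x}.
Proof.
have lv : locally_integrable [set: R] v.
  by apply: open_integrable_locally => //; [exact: openT | exact: bounded_support_integrable].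
have := FTC1Ny iv lv; apply: filterS; first exact: (ae_filter_ringOfSetsType mu).
move=> x [dF eF]; have /cvg_ex[l hl] := dF.
have el : l = v x by rewrite -eF derive1E; apply/esym/cvg_lim => //; exact: hl.
rewrite el in hl; clear l el dF eF.
have := (cvgr_dnbhsP _ _ _).1 hl (fun n => n.+1%:R^-1) _; move=> /(_ (conj _ (@cvg_harmonic R))) h.
have {}h := h (fun n => invr_neq0 (lt0r_neq0 (ltr0Sn R n))).
apply: cvg_trans h; apply: near_eq_cvg; apply: nearW => n /=.
by rewrite /mollified invrK /GRing.scale /= mulr1 [_ + x]addrC.
Qed.

Lemma lip_measurable (w : R -> R) L : (forall x y, `|w x - w y| <= L * `|x - y|) -> measurable_fun [set: R] w.
Proof. by move=> h; apply: continuous_measurable_fun; exact: lip_continuous h. Qed.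

Lemma mollified_approx eps : 0 < eps -> exists n, (sqdist v (mollified n) <= eps%:E)%E.
Proof.
move=> e0; pose D := `[- (N + 1), N + 1]%classic : set R.
have mm n : measurable_fun [set: R] (mollified n) by exact: lip_measurable (mollified_lip n).
have i2 : mu.-integrable D (EFin \o (fun=> (2 * N) ^+ 2)).
  by apply: integrable_cont => z; exact: cvg_cst.
have [] := @dominated_small D (fun n x => (v x - mollified n x) ^+ 2) _ eps _ e0 _ i2.
- exact: measurable_itv.
- by move=> n; apply: measurable_funTS; apply: measurable_funX; exact: measurable_funB.
- move=> n x _ /=; rewrite ger0_norm ?sqr_ge0 // -real_normK ?num_real //.
  rewrite ler_sqr ?nnegrE ?mulr_ge0 // (le_trans (ler_normB _ _)) //.
  by have := vN x; have := mollified_bound n x; lra.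
- apply: filterS mollified_cvg; first exact: (ae_filter_ringOfSetsType mu).
  move=> x hx _; have cx : v x - mollified n x @[n --> \oo] --> (v x - v x : R).
    by apply: cvgB => //; exact: cvg_cst.
  have := cvgM cx cx; rewrite subrr mul0r => h; exact: h.
move=> n hn; exists n; apply: le_trans hn.
rewrite [leRHS]integral_mkcond; apply: ge0_le_integral => //.
- by move=> x _; rewrite lee_fin sqr_ge0.
- exact: sqdist_meas.
- apply/(measurable_restrictT _ _).1; first exact: measurable_itv.
  by apply: measurable_funTS; exact: sqdist_meas.
move=> x _; rewrite patchE; case: ifPn => // /negP; rewrite inE /D /= in_itv /= => hx.
have hx1 : N + 1 < `|x| by rewrite ltNge; apply/negP => hx1; apply: hx; rewrite -ler_norml.
by rewrite mollified_support // v0 ?subrr ?expr0n //; have := hx1; lra.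
Qed.
End Mollify.

Definition truncated (u : R -> R) (n : nat) (x : R) : R :=
  u x * \1_`[- n%:R, n%:R] (u x) * \1_`[- n%:R, n%:R] x.

Lemma truncated_cases u n x : truncated u n x = if (`|u x| <= n%:R) && (`|x| <= n%:R) then u x else 0.
Proof.
rewrite /truncated !indicE !mem_setE /= !in_itv /= -!ler_norml.
by case: leP => _; case: leP => _; rewrite ?mulr1 ?mulr0 ?mul0r.
Qed.

Lemma truncated_meas (u : R -> R) n : measurable_fun [set: R] u -> measurable_fun [set: R] (truncated u n).
Proof.
move=> mu_; apply: measurable_funM; last exact: measurable_indic.
apply: measurable_funM => //; apply: measurableT_comp => //; exact: measurable_indic.
Qed.

Lemma truncated_approx (u : R -> R) eps : measurable_fun [set: R] u ->
  (\int[mu]_x ((u x) ^+ 2)%:E < +oo)%E -> 0 < eps -> exists n, (sqdist u (truncated u n) <= eps%:E)%E.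
Proof.
move=> mu_ fu e0.
apply: (@dominated_small setT (fun n x => (u x - truncated u n x) ^+ 2) (fun x => u x ^+ 2)) => //.
- by move=> n; apply: measurable_funX; apply: measurable_funB => //; exact: truncated_meas.
- apply/integrableP; split; first by apply/measurable_EFinP; exact: measurable_funX.
  by under eq_integral do rewrite gee0_abs ?lee_fin ?sqr_ge0 //.
- move=> n x _; rewrite ger0_norm ?sqr_ge0 // truncated_cases.
  by case: ifP => _; rewrite ?subr0 // subrr expr0n sqr_ge0.
apply: aeW => x _; have [n [n1 n2]] : exists n : nat, `|u x| <= n%:R /\ `|x| <= n%:R.
  exists (maxn (Num.bound `|u x|) (Num.bound `|x|)).
  by split; apply: (le_trans (ltW (archi_boundP (normr_ge0 _)))); rewrite ler_nat ?leq_maxl ?leq_maxr.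
apply/cvgrPdist_le => e e1; exists n => // m /= nm.
have nmR : n%:R <= m%:R :> R by rewrite ler_nat.
by rewrite truncated_cases !(le_trans _ nmR) //= subrr expr0n subrr normr0 ltW.
Qed.

(** Truncate in value and in space, then mollify. *)
Lemma real_dense (u : R -> R) eps : measurable_fun [set: R] u -> (\int[mu]_x ((u x) ^+ 2)%:E < +oo)%E -> 0 < eps ->
  exists (w : R -> R) (L T : R), [/\ forall x y, `|w x - w y| <= L * `|x - y|,
    0 <= T, forall x, T <= `|x| -> w x = 0 & (sqdist u w <= eps%:E)%E].
Proof.
move=> mu_ fu e0; have e4 : 0 < eps / 4 by rewrite divr_gt0.
have [n hn] := truncated_approx mu_ fu e4.
have mt := truncated_meas n mu_.
have N0 : 0 <= n%:R :> R by [].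
have tN x : `|truncated u n x| <= n%:R.
  by rewrite truncated_cases; case: ifP => [/andP[]//|_]; rewrite normr0.
have t0 x : n%:R < `|x| -> truncated u n x = 0.
  by rewrite truncated_cases ltNge => /negbTE ->; rewrite andbF.
have [m hm] := mollified_approx mt N0 tN t0 e4.
exists (mollified (truncated u n) m), (m.+1%:R * n%:R * 2), (n%:R + 2); split.
- exact: mollified_lip.
- by rewrite addr_ge0.
- by move=> x hx; apply: (mollified_support mt N0 tN t0); apply: lt_le_trans hx; rewrite ltrD2l; lra.
have mm : measurable_fun [set: R] (mollified (truncated u n) m).
  exact: lip_measurable (mollified_lip mt N0 tN t0 _).
apply: (le_trans (sqdist_triangle mu_ mt mm)).
apply: (@le_trans _ _ (2%:E * (eps / 4)%:E + 2%:E * (eps / 4)%:E)%E).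
  by apply: leeD; apply: lee_wpmul2l.
by rewrite -!EFinM -EFinD lee_fin; lra.
Qed.

Lemma test_function_dense (f : R -> C) (eps : R) : L2 f -> 0 < eps ->
  exists2 w, test_function w & (sqL2norm (fun x => (f x - w x)%R) <= eps%:E)%E.
Proof.
move=> [mr mi fin] e0; have e2 : 0 < eps / 2 by rewrite divr_gt0.
have fr : (\int[mu]_x ((Re (f x)) ^+ 2)%:E < +oo)%E.
  apply: le_lt_trans fin; apply: ge0_le_integral => //.
  - by move=> x _; rewrite lee_fin sqr_ge0.
  - by apply/measurable_EFinP; exact: measurable_funX.
  - by apply/measurable_EFinP; exact: measurable_cabs2.
  - by move=> x _; rewrite lee_fin sqr_cabs lerDl sqr_ge0.
have fi : (\int[mu]_x ((Im (f x)) ^+ 2)%:E < +oo)%E.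
  apply: le_lt_trans fin; apply: ge0_le_integral => //.
  - by move=> x _; rewrite lee_fin sqr_ge0.
  - by apply/measurable_EFinP; exact: measurable_funX.
  - by apply/measurable_EFinP; exact: measurable_cabs2.
  - by move=> x _; rewrite lee_fin sqr_cabs lerDr sqr_ge0.
have [w1 [L1 [T1 [l1 T10 s1 d1]]]] := real_dense mr fr e2.
have [w2 [L2 [T2 [l2 T20 s2 d2]]]] := real_dense mi fi e2.
exists (fun x => w1 x +i* w2 x).
  exists (L1 + L2), (T1 + T2); split; first exact: addr_ge0.
    move=> x y; rewrite mulrDl; apply: (le_trans (cabs_le_ReIm _)); apply: lerD; [exact: l1 | exact: l2].
  by move=> x hx; rewrite s1 ?s2 //; apply: le_trans hx; rewrite ?lerDl ?lerDr.
rewrite /sqL2norm; have -> : (fun x => (cabs (f x - (w1 x +i* w2 x)) ^+ 2)%:E) =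
   (fun x => ((Re (f x) - w1 x) ^+ 2)%:E + ((Im (f x) - w2 x) ^+ 2)%:E)%E.
  by apply/funext => x; rewrite sqr_cabs -EFinD; case: (f x).
rewrite ge0_integralD //; first last.
- by apply: sqdist_meas => //; exact: lip_measurable l2.
- by move=> x _; rewrite lee_fin sqr_ge0.
- by apply: sqdist_meas => //; exact: lip_measurable l1.
- by move=> x _; rewrite lee_fin sqr_ge0.
by rewrite [in leRHS](_ : eps = eps / 2 + eps / 2) ?EFinD; [exact: leeD | lra].
Qed.
End Density.

(** * From test functions to square-integrable functions *)

Section Extension.
Variable R : realType.
Local Notation C := R[i].
Local Notation mu := (@lebesgue_measure R).

Lemma le_of_sqr_small (x y K : R) : 0 <= K ->
  (forall eta, 0 < eta -> x <= y + eta ^+ 2 * K) -> x <= y.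
Proof.
move=> K0 h; apply/ler_addgt0Pr => e e0.
have K1 : 0 < K + 1 by rewrite ltr_wpDl.
pose t := Num.min 1 (e / (K + 1)).
have t0 : 0 < t by rewrite lt_min ltr01 divr_gt0.
apply: (le_trans (h t t0)); rewrite lerD2l.
have t1 : t <= 1 by rewrite ge_min lexx.
have te : t * (K + 1) <= e by rewrite -ler_pdivlMr // ge_min lexx orbT.
apply: le_trans te; rewrite expr2 -mulrA ler_pM2l //.
have : t * K <= 1 * K by rewrite ler_wpM2r.
by rewrite mul1r; lra.
Qed.

Lemma sqr_cabsD (z w : C) : cabs (z + w) ^+ 2 <= 2 * cabs z ^+ 2 + 2 * cabs w ^+ 2.
Proof.
rewrite !sqr_cabs ReD ImD -subr_ge0.
have e (p q r s : R) : 2 * (p ^+ 2 + q ^+ 2) + 2 * (r ^+ 2 + s ^+ 2) - ((p + r) ^+ 2 + (q + s) ^+ 2)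
  = (p - r) ^+ 2 + (q - s) ^+ 2 by ring.
by rewrite e addr_ge0 ?sqr_ge0.
Qed.

Lemma L2_cmeas (f : R -> C) : L2 f -> cmeas f. Proof. by case. Qed.

Lemma L2_integrable (f : R -> C) : L2 f -> mu.-integrable [set: R] (EFin \o (fun x => cabs (f x) ^+ 2)).
Proof.
move=> [m1 m2 fin]; apply/integrableP; split.
  by apply/measurable_EFinP; exact: measurable_cabs2.
by under eq_integral do rewrite /= ger0_norm ?sqr_ge0 //.
Qed.

Lemma L2P (f : R -> C) : cmeas f -> mu.-integrable [set: R] (EFin \o (fun x => cabs (f x) ^+ 2)) -> L2 f.
Proof.
move=> [m1 m2] /integrableP[_ fin]; split => //; move: fin.
by under eq_integral do rewrite /= ger0_norm ?sqr_ge0 //.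
Qed.

Lemma energy_ge0 (f : R -> C) : 0 <= energy f.
Proof. by apply: Rintegral_ge0 => x _; exact: sqr_ge0. Qed.

Lemma sqL2norm_energy (f : R -> C) : L2 f -> sqL2norm f = (energy f)%:E.
Proof.
move=> f2; rewrite /energy /Rintegral fineK //.
exact: (integrable_fin_num measurableT (L2_integrable f2)).
Qed.

Lemma integrable_sum2 (u v : R -> R) (s t : R) :
  mu.-integrable [set: R] (EFin \o u) -> mu.-integrable [set: R] (EFin \o v) ->
  mu.-integrable [set: R] (EFin \o (fun x => s * u x + t * v x)) /\
  \int[mu]_x (s * u x + t * v x) = s * \int[mu]_x u x + t * \int[mu]_x v x.
Proof.
move=> iu iv.
have i1 : mu.-integrable [set: R] (EFin \o (fun x => s * u x)).
  by have := @integrableZl _ _ _ mu _ measurableT s _ iu; apply: eq_integrable.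
have i2 : mu.-integrable [set: R] (EFin \o (fun x => t * v x)).
  by have := @integrableZl _ _ _ mu _ measurableT t _ iv; apply: eq_integrable.
split; first by have := integrableD measurableT i1 i2; apply: eq_integrable.
by rewrite RintegralD // !RintegralZl.
Qed.

Lemma L2D (u v : R -> C) : L2 u -> L2 v ->
  L2 (fun x => u x + v x) /\ energy (fun x => u x + v x) <= 2 * energy u + 2 * energy v.
Proof.
move=> u2 v2; have mD := cmeasD (L2_cmeas u2) (L2_cmeas v2).
have [i2 e2] := integrable_sum2 2 2 (L2_integrable u2) (L2_integrable v2).
have iD : mu.-integrable [set: R] (EFin \o (fun x => cabs (u x + v x) ^+ 2)).
  apply: (le_integrable _ _ _ i2) => //.
    by apply/measurable_EFinP; exact: measurable_cabs2.
  move=> x _ /=; rewrite lee_fin ger0_norm ?sqr_ge0 //.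
  exact: le_trans (sqr_cabsD _ _) (ler_norm _).
split; first exact: L2P.
by rewrite -e2; apply: le_Rintegral => // x _; exact: sqr_cabsD.
Qed.

Lemma L2B (u v : R -> C) : L2 u -> L2 v -> L2 (fun x => u x - v x).
Proof.
move=> u2 v2; apply: (L2D u2 (v := fun x => - v x) _).1.
have [m1 m2] := L2_cmeas v2; apply: L2P.
  by split; [under eq_fun do rewrite ReN | under eq_fun do rewrite ImN];
    apply: measurableT_comp => //.
by have := L2_integrable v2; apply: eq_integrable => // x _ /=; rewrite cabsN.
Qed.

Lemma test_function_L2 (w : R -> C) : test_function w -> L2 w.
Proof.
move=> nw; have [L [T [T0 wL wT]]] := nw; have [m1 m2] := clipschitz_cmeas wL.
by split => //; rewrite sqL2norm_test_function // ltry.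
Qed.

Section Pairing.
Variables (u h : R -> C).
Hypotheses (u2 : L2 u) (h2 : L2 h).

(** The arithmetic-geometric inequality with a free weight t, which plays
    the role of the Cauchy-Schwarz inequality for integrals. *)
Lemma pairing_le t x : 0 < t -> cabs (u x * (h x)^*) <= t^-1 / 2 * cabs (u x) ^+ 2 + t / 2 * cabs (h x) ^+ 2.
Proof.
move=> t0; rewrite cabsM cabsJ -subr_ge0.
have e (p q r s : R) : s * r = 1 -> s / 2 * p ^+ 2 + r / 2 * q ^+ 2 - p * q = s / 2 * (p - r * q) ^+ 2.
  move=> sr; have -> : r / 2 * q ^+ 2 = s * r * (r / 2 * q ^+ 2) by rewrite sr mul1r.
  have -> : p * q = (s * r) * p * q by rewrite sr mul1r.
  by field.
rewrite e ?mulVf ?gt_eqF // mulr_ge0 ?sqr_ge0 // divr_ge0 // invr_ge0 ltW //.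
Qed.

Lemma pairing_integrable : mu.-integrable [set: R] (EFin \o (fun x => Re (u x * (h x)^*))) /\
  mu.-integrable [set: R] (EFin \o (fun x => Im (u x * (h x)^*))).
Proof.
have [m1 m2] := cmeasM (L2_cmeas u2) (cmeasJ (L2_cmeas h2)).
have [i2 _] := integrable_sum2 (1^-1 / 2) (1 / 2) (L2_integrable u2) (L2_integrable h2).
by split; apply: (le_integrable _ _ _ i2) => //; try exact/measurable_EFinP;
  move=> x _ /=; rewrite lee_fin;
  apply: le_trans (le_trans (pairing_le x ltr01) (ler_norm _)); rewrite ?Re_le_cabs ?Im_le_cabs.
Qed.

Lemma inner_small eta : 0 < eta -> energy u <= eta ^+ 2 ->
  cabs (inner u h) <= eta * (1 + energy h).
Proof.
move=> e0 hu.
have [iR iI] := pairing_integrable.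
have [i2 e2] := integrable_sum2 (eta^-1 / 2) (eta / 2) (L2_integrable u2) (L2_integrable h2).
have b : eta^-1 / 2 * energy u + eta / 2 * energy h <= eta * (1 + energy h) / 2.
  have : eta^-1 / 2 * energy u <= eta^-1 / 2 * eta ^+ 2.
    by rewrite ler_wpM2l // divr_ge0 // invr_ge0 ltW.
  have -> : eta^-1 / 2 * eta ^+ 2 = eta / 2 by field; rewrite gt_eqF.
  by lra.
rewrite /energy -e2 in b.
have bR : `|Re (inner u h)| <= eta * (1 + energy h) / 2.
  apply: (le_trans (le_normr_Rintegral measurableT iR)); apply: le_trans b.
  apply: le_Rintegral => //; first exact: integrable_norm.
  by move=> x _; apply: le_trans (pairing_le x e0); exact: Re_le_cabs.
have bI : `|Im (inner u h)| <= eta * (1 + energy h) / 2.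
  apply: (le_trans (le_normr_Rintegral measurableT iI)); apply: le_trans b.
  apply: le_Rintegral => //; first exact: integrable_norm.
  by move=> x _; apply: le_trans (pairing_le x e0); exact: Im_le_cabs.
by apply: (le_trans (cabs_le_ReIm _)); have := lerD bR bI; rewrite -splitr.
Qed.

End Pairing.

Lemma innerD (u v h : R -> C) : L2 u -> L2 v -> L2 h ->
  inner (fun x => u x + v x) h = inner u h + inner v h.
Proof.
move=> u2 v2 h2; have [u1 u3] := pairing_integrable u2 h2; have [v1 v3] := pairing_integrable v2 h2.
apply: complex_eqP; rewrite ?ReD ?ImD /=.
  under eq_Rintegral do rewrite mulrDl ReD.
  by rewrite RintegralD.
under eq_Rintegral do rewrite mulrDl ImD.
by rewrite RintegralD.
Qed.

Section FrameExtension.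
Variables (I : eqType) (h : I -> R -> C) (S : set (seq I)).
Hypotheses (h2 : forall i, L2 (h i)).
Local Notation sq f s := (\sum_(i <- s) cabs (inner f (h i)) ^+ 2).

Lemma frame_sum_split u v (s : seq I) : L2 u -> L2 v ->
  sq (fun x => u x + v x) s <= 2 * sq u s + 2 * sq v s.
Proof.
move=> u2 v2; rewrite !mulr_sumr -big_split /=; apply: ler_sum => i _.
by rewrite innerD //; exact: sqr_cabsD.
Qed.

Lemma add_subK (f w : R -> C) : f = (fun x => w x + (f x - w x)).
Proof. by apply/funext => x; rewrite addrC subrK. Qed.

Lemma energyB (u v : R -> C) : energy (fun x => u x - v x) = energy (fun x => v x - u x).
Proof. by apply: eq_Rintegral => x _; rewrite -cabsN opprB. Qed.

(** For a fixed finite family s, replacing f by a close test function w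
    changes the sum by as little as desired ([inner_small]); the dependence of
    that error on s is harmless as s is fixed before w. *)
Lemma frame_upper_extend B : 0 < B ->
  (forall f s, test_function f -> S s -> sq f s <= B * energy f) ->
  forall f s, L2 f -> S s -> sq f s <= 4 * B * energy f.
Proof.
move=> B0 hB f s f2 Ss.
pose H := \sum_(i <- s) (1 + energy (h i)) ^+ 2.
have H0 : 0 <= H by apply: sumr_ge0 => i _; exact: sqr_ge0.
apply: (@le_of_sqr_small _ _ (4 * B + 2 * H)).
  by rewrite addr_ge0 ?mulr_ge0 // ltW.
move=> eta e0; have [w nw] := test_function_dense f2 (exprn_gt0 2 e0).
have w2 := test_function_L2 nw; have fw2 := L2B f2 w2; have wf2 := L2B w2 f2.
rewrite sqL2norm_energy // lee_fin => hw.
have := frame_sum_split s w2 fw2; rewrite -add_subK => h1.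
have h3 := hB _ _ nw Ss.
have [_ h4] := L2D f2 wf2; rewrite -add_subK energyB in h4.
have h5 : sq (fun x => f x - w x) s <= eta ^+ 2 * H.
  rewrite mulr_sumr; apply: ler_sum => i _; rewrite -exprMn.
  rewrite ler_sqr ?nnegrE ?cabs_ge0 ?mulr_ge0 ?addr_ge0 ?energy_ge0 ?(ltW e0) //.
  exact: inner_small.
have h6 : B * energy w <= B * (2 * energy f + 2 * eta ^+ 2).
  by rewrite ler_wpM2l ?(ltW B0) //; lra.
move: (sq f s) (sq w s) (sq _ s) (energy f) (energy w) (eta ^+ 2) h1 h3 h5 h6 => p q r e ew t h1 h3 h5 h6.
nra.
Qed.

(** Here the error f - w must be controlled for all s at once, which is what
    [frame_upper_extend] provides. *)
Lemma frame_lower_extend A B f X : 0 < A -> 0 < B ->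
  (forall f s, test_function f -> S s -> sq f s <= B * energy f) ->
  (forall f X, test_function f -> (forall s, S s -> sq f s <= X) -> energy f <= A * X) ->
  L2 f -> (forall s, S s -> sq f s <= X) -> energy f <= 4 * A * X.
Proof.
move=> A0 B0 hB hA f2 hX.
apply: (@le_of_sqr_small _ _ (16 * (A * B) + 2)).
  by rewrite addr_ge0 ?mulr_ge0 // ltW.
move=> eta e0; have [w nw] := test_function_dense f2 (exprn_gt0 2 e0).
have w2 := test_function_L2 nw; have fw2 := L2B f2 w2; have wf2 := L2B w2 f2.
rewrite sqL2norm_energy // lee_fin => hw.
have h1 : energy w <= A * (2 * X + 8 * B * eta ^+ 2).
  apply: hA => // s Ss; have := frame_sum_split s f2 wf2; rewrite -add_subK => h1.
  have h3 := hX _ Ss; have := frame_upper_extend B0 hB wf2 Ss; rewrite energyB => h4.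
  have h5 : B * energy (fun x => f x - w x) <= B * eta ^+ 2 by rewrite ler_wpM2l // ltW.
  move: (sq f s) (sq w s) (sq _ s) h1 h3 h4 => p q r h1 h3 h4.
  by lra.
have [_ h4] := L2D w2 fw2; rewrite -add_subK in h4.
move: (energy f) (energy w) (energy _) (eta ^+ 2) hw h1 h4 => p q r t hw h1 h4.
nra.
Qed.

End FrameExtension.
End Extension.

(** * Gaussian Gabor frames *)

Section Frame.
Variable R : realType.
Local Notation C := R[i].
Local Notation mu := (@lebesgue_measure R).

(** A multiple of the density of a normal law. *)
Lemma gaussian_integrable (A m K : R) : 0 < A ->
  mu.-integrable [set: R] (EFin \o (fun x => K * expR (- A * (x - m) ^+ 2))).
Proof.
move=> A0; pose s := Num.sqrt (2 * A)^-1.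
have i0 : 0 < (2 * A)^-1 by rewrite invr_gt0 mulr_gt0.
have s0 : s != 0 by rewrite gt_eqF // sqrtr_gt0.
have p0 := normal_peak_gt0 s0.
have := @integrableZl _ _ _ mu _ measurableT (K / normal_peak s) _ (integrable_normal_pdf m s).
apply: eq_integrable => // x _ /=; rewrite normal_pdfE // -EFinM /normal_fun; congr (_%:E).
rewrite mulrA divfK ?gt_eqF //; congr (_ * expR _).
rewrite /s sqr_sqrtr ?(ltW i0) //.
by move: ((x - m) ^+ 2) => y; field; rewrite gt_eqF.
Qed.

Variables (a b c : C) (alpha beta : R).
Hypotheses (a0 : Re a < 0) (be0 : 0 < beta).
Local Notation g := (gauss a b c).

Lemma cabs_atom jk x : cabs (gabor_atom g alpha beta jk x) = cabs (g (x - alpha * jk.2%:~R)).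
Proof. by rewrite /gabor_atom /modulation /translation cabsM cabs_expi mul1r. Qed.

Lemma atom_L2 jk : L2 (gabor_atom g alpha beta jk).
Proof.
have [L gL] := gaussian_lip b c a0.
apply: L2P.
  case: jk => j k.
  exact: (cmeasM (bmeas_fexp be0 j).1 (clipschitz_cmeas (clipschitz_shift (- (alpha * k%:~R)) gL))).
pose A := - Re a; have A0 : 0 < A by rewrite oppr_gt0.
set t := alpha * jk.2%:~R.
pose m := Re b / (2 * A).
have := gaussian_integrable (m + t) (expR (2 * (A * m ^+ 2 + Re c))) (mulr_gt0 (ltr0Sn R 1) A0).
apply: eq_integrable => // x _ /=; congr (_%:E); rewrite cabs_atom cabs_gaussian -/t -expRD.
rewrite -expRM_natl; congr expR.
have e : Re b = 2 * A * m by rewrite /m; field; rewrite gt_eqF.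
have -> : Re a = - A by rewrite opprK.
by rewrite e; ring.
Qed.

Hypotheses (al0 : 0 < alpha) (ab1 : alpha * beta < 1).
Local Notation atom := (gabor_atom g alpha beta).

Let rect : set (seq (int * int)) := [set s | exists s1 s2, [/\ uniq s1, uniq s2 & s = [seq (j, k) | k <- s2, j <- s1]]].

Lemma rect_sum (F : int * int -> R) s1 s2 :
  \sum_(i <- [seq (j, k) | k <- s2, j <- s1]) F i = \sum_(k <- s2) \sum_(j <- s1) F (j, k).
Proof. by rewrite big_allpairs_dep. Qed.

Lemma rect_uniq (s1 s2 : seq int) : uniq s1 -> uniq s2 -> uniq [seq (j, k) | k <- s2, j <- s1].
Proof. by move=> u1 u2; apply: allpairs_uniq => // [[k j] [k' j']] _ _ [-> ->]. Qed.

(** The sum over all pairs is the supremum of its finite sums, and a finite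
    set of pairs is contained in a rectangle, where the order of summation of
    the sampling inequalities is available. *)
Lemma gaussian_gabor_frame : is_gabor_frame g alpha beta.
Proof.
have [B B0 hB] := test_function_upper b c a0 al0 be0 ab1.
have [A A0 hA] := test_function_lower b c a0 al0 be0 ab1.
have hB' f s : test_function f -> rect s -> \sum_(i <- s) cabs (inner f (atom i)) ^+ 2 <= B * energy f.
  by move=> nf [s1 [s2 [u1 u2 ->]]]; rewrite rect_sum; exact: hB.
have hA' f X : test_function f -> (forall s, rect s -> \sum_(i <- s) cabs (inner f (atom i)) ^+ 2 <= X) ->
    energy f <= A * X.
  move=> nf h; apply: hA => // s1 s2 u1 u2; rewrite -(rect_sum (fun i => cabs (inner f (atom i)) ^+ 2)); apply: h.
  by exists s1, s2.
exists (4 * A)^-1, (4 * B); split; rewrite ?invr_gt0 ?mulr_gt0 // => f f2 S.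
rewrite sqL2norm_energy //.
have esumE s : uniq s -> ((\sum_(i <- s) cabs (inner f (atom i)) ^+ 2)%:E <= S)%E.
  move=> us; rewrite -sumEFin fsbig_seq //; apply: ereal_sup_ubound.
  by exists [set` s] => //; split => //; exact: finite_seq.
split.
  have S0 : (0 <= S)%E by apply: esum_ge0 => i _; rewrite lee_fin sqr_ge0.
  case E : S => [X| |]; last 2 first.
  - by rewrite leey.
  - by rewrite E in S0.
  rewrite -EFinM lee_fin mulrC ler_pdivrMr ?mulr_gt0 // mulrC.
  apply: (frame_lower_extend atom_L2 A0 B0 hB' hA' f2) => s [s1 [s2 [u1 u2 es]]].
  by rewrite -lee_fin -E; apply: esumE; rewrite es; exact: rect_uniq.
apply: ge_ereal_sup => _ [D [fD _] <-].
rewrite fsbig_finite //= sumEFin -EFinM lee_fin.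
set s := finmap.enum_fset _.
have [N1 h1] := seq_sub_zrange (map fst s); have [N2 h2] := seq_sub_zrange (map snd s).
have u1 := zrange_uniq N1; have u2 := zrange_uniq N2.
apply: le_trans (frame_upper_extend atom_L2 B0 hB' f2 (s := [seq (j, k) | k <- zrange N2, j <- zrange N1]) _); last first.
  by exists (zrange N1), (zrange N2).
apply: ler_sum_sub => //; first exact: finmap.fset_uniq.
- exact: rect_uniq.
- move=> [j k] hi; apply/allpairsP; exists (k, j); split => //=.
    by apply: h2; apply/mapP; exists (j, k).
  by apply: h1; apply/mapP; exists (j, k).
- by move=> i; exact: sqr_ge0.
Qed.
End Frame.

Theorem theorem1 (R : realType) (a b c : R[i]) (ha : complex.Re a < 0) :
  let g : R -> R[i] := extended_gaussian a b c in
  maximal_frame_set g /\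
  exists p : R * R,
    [/\ unit_square p /\ zak g p = 0,
        (forall q : R * R, unit_square q -> zak g q = 0 -> q = p),
        simple_zero (zak g) p &
        (b = 0 -> p = (2^-1, 2^-1))].
Proof.
move=> g; split.
  by move=> [alpha beta] [/= al0 be0 ab1]; split => //; exact: gaussian_gabor_frame.
exists (zak_zero a b); split.
- split; last exact: zak_zeroP.
  by split; exact: frac01.
- by move=> q; exact: zak_zero_unique.
- exact: zak_simple_zero.
- by move=> ->; exact: zak_zero_b0.
Qed.
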